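(* Let $(M,d)$ be a locally compact separable metric space, $\mu$ a $\sigma$-finite Borel measure on $M$, $X$ a Hunt process on $(M,\mathscr{B}(M))$ with life time $\zeta$, and let $N\in\mathscr{B}(M)$ be such that for any $x\in M\setminus N$, $$\mathbb{P}_x[X_t\in M_\Delta\setminus N\text{ for any }t\in[0,\infty)]=1\quad\text{and}\quad\mathbb{P}_x\bigl[[0,\zeta)\ni t\mapsto X_t\in M\text{ is continuous}\bigr]=1.$$ Let $\Psi:[0,\infty)\to[0,\infty)$ be a homeomorphism and $c_\Psi,\beta_1,\beta_2\in(0,\infty)$ with $1<\beta_1\le\beta_2$ be such that $c_\Psi^{-1}(\rho'/\rho)^{\beta_1}\le\Psi(\rho')/\Psi(\rho)\le c_\Psi(\rho'/\rho)^{\beta_2}$ for any $0<\rho\le\rho'<\infty$; set $\Psi(\infty):=\infty$ and, for $(\rho,t)\in[0,\infty)\times(0,\infty)$, $\Phi(\rho,t):=\sup_{r\in(0,\infty)}\{\rho/r-t/\Psi(r)\}$. Let $\delta\in(0,1]$, let $R\in(0,\infty]$ satisfy $R\ge\delta\operatorname{diam}M$, put $I:=(0,\Psi(R)]$ if $R<\infty$ and $I:=(0,\infty)$ if $R=\infty$, and let $F=F_t(x,y):I\times M\times M\to(0,\infty)$ be Borel measurable. Let $\alpha_F,c_F\in(0,\infty)$ be such that for any $(t,x,y),(s,z,w)\in I\times M\times M$ with $s\le t$, $$\frac{F_s(z,w)}{F_t(x,y)}\le c_F\Bigl(\frac{t\vee\Psi(d(x,z))\vee\Psi(d(y,w))}{s}\Bigr)^{\alpha_F}.$$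 Let $c,\gamma\in(0,\infty)$ and assume that for any $(y_0,R')\in M\times(0,\infty)$ with $R'\le R$ the following two conditions hold with $U:=B(y_0,R'/2)$: (i) for any $(t,x)\in(0,\Psi(R'))\times(U\setminus N)$ and any $A\in\mathscr{B}(U)$, $\mathcal{P}^U_t(x,A)\le\int_AF_t(x,y)\,d\mu(y)$; (ii) for any $(x,r)\in(U\setminus N)\times(0,R')$ with $B(x,r)\subset U$ and any $t\in(0,\infty)$, $\mathbb{P}_x[\tau_{B(x,r)}\le t]\le c\exp(-\Phi(\gamma r,t))$. Then there exists a Borel measurable function $p=p_t(x,y):(0,\infty)\times(M\setminus N)\times M\to[0,\infty)$ such that for any $(t,x)\in(0,\infty)\times(M\setminus N)$, $$\mathcal{P}_t(x,A)=\int_Ap_t(x,y)\,d\mu(y)\qquad\text{for any }A\in\mathscr{B}(M),$$ and for any $y\in M$, $$p_t(x,y)\le\begin{cases}c'\delta^{-\beta_2\alpha_F}F_t(x,y)\exp\bigl(-\Phi(\gamma'_\delta d(x,y),t)\bigr)&\text{if }t<\Psi(R),\\ c'\delta^{-\beta_2\alpha_F}\bigl(\inf_{M\times M}F_{\Psi(R)}\bigr)&\text{if }t\ge\Psi(R),\end{cases}$$ where $\gamma'_\delta:=\frac1{40}\delta\gamma$ and $c'\in(0,\infty)$ is a constant explicit in (in particular, depending only on) $c_\Psi,\beta_1,\beta_2,c_F,\alpha_F,c,\gamma$.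
   Context: Conventions: $a\vee b=\max\{a,b\}$, $\inf\emptyset:=\infty$, $\sup\emptyset:=0$; $B(x,r):=\{y\in M\mid d(x,y)<r\}$; $\operatorname{diam}A:=\sup_{x,y\in A}d(x,y)$; $\mathscr{B}(E)$ is the Borel $\sigma$-field of $E$. $M_\Delta=M\cup\{\Delta\}$ is the one-point compactification of $M$. A Hunt process $X=(\Omega,\mathscr{M},\{X_t\}_{t\in[0,\infty]},\{\mathbb{P}_x\}_{x\in M_\Delta})$ on $(M,\mathscr{B}(M))$ is a normal Markov process on $(M,\mathscr{B}(M))$ ($\mathbb{P}_x[X_0=x]=1$, $x\mapsto\mathbb{P}_x[X_t\in A]$ Borel for $A\in\mathscr{B}(M)$) with cemetery $\Delta$ ($X_t(\omega)=\Delta$ for all $t\in[\zeta(\omega),\infty]$, where $\zeta(\omega):=\inf\{t\in[0,\infty)\mid X_t(\omega)=\Delta\}$ is the life time), with shift operators $\theta_t:\Omega\to\Omega$, $X_s\circ\theta_t=X_{s+t}$, whose paths $[0,\infty)\ni t\mapsto X_t(\omega)\in M_\Delta$ are all right-continuous with left limits in $M_\Delta$ on $(0,\infty)$, whose minimum completed admissible filtration is right-continuous, and which is strong Markov and quasi-left-continuous with respect to that filtration. For $B\subset M$, $\tau_B:=\inf\{t\in[0,\infty)\mid X_t\in M_\Delta\setminus B\}$. For $t\in[0,\infty)$, $x\in M$, $A\in\mathscr{B}(M)$: $\mathcal{P}_t(x,A):=\mathbb{P}_x[X_t\in A]$ and $\mathcal{P}^U_t(x,A):=\mathbb{P}_x[X_t\in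 A,\,t<\tau_U]$ for $U\subset M$ non-empty open. *)

(* Defs.v *)
From HB Require Import structures.
From mathcomp Require Import all_boot all_order all_algebra.
From mathcomp Require Import all_classical all_reals all_analysis measurable_realfun.

Set Implicit Arguments.
Unset Strict Implicit.
Unset Printing Implicit Defensive.

Import Order.TTheory GRing.Theory Num.Theory.
Import numFieldTopology.Exports numFieldNormedType.Exports.

Local Open Scope classical_set_scope.
Local Open Scope ring_scope.

(* Measurable types are pointed in the library, hence so is the metric space:
   the state space is nonempty. *)
#[short(type="pmetricType")]
HB.structure Definition PointedMetricSpace (K : numDomainType) :=
  {M of Metric K M & isPointed M}.

Notation borel T := (g_sigma_algebraType (@open T)).

Definition separable (T : topologicalType) :=
  exists2 D : set T, countable D & dense D.

Definition homeomorphism_on (S T : topologicalType) (A : set S) (B : set T)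
    (f : S -> T) :=
  exists g : T -> S,
    [/\ {homo f : x / A x >-> B x}, {homo g : y / B y >-> A y},
        (forall x, A x -> g (f x) = x), (forall y, B y -> f (g y) = y) &
        {within A, continuous f} /\ {within B, continuous g}].

Definition diam (R : realType) (M : metricType R) : \bar R :=
  ereal_sup [set (mdist z.1 z.2)%:E | z in [set: M * M]].

Local Notation completion Q := (@completed_measure_extension _ _ _ Q).

Section hunt_process.
Context {R : realType} {M : pmetricType R} {d : measure_display}
  {Omega : measurableType d}.

(* [None] is the cemetery; it is isolated when [M] is compact. *)
Local Notation MD := (one_point_compactification M).

Definition in_cpt (A : set M) : set MD := Some @` A.

Section filtration.
(* Only the times in [0, +oo] are relevant; negative times are junk. *)
Context (X : \bar R -> Omega -> MD) (P : MD -> probability Omega R).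

Definition lifetime (w : Omega) : \bar R :=
  ereal_inf [set t%:E | t in [set t : R | 0 <= t /\ X t%:E w = None]].

Definition natural_gen (t : \bar R) : set (set Omega) :=
  [set A | exists (s : \bar R) (B : set (borel MD)),
     [/\ (0 <= s)%E, (s <= t)%E, measurable B & A = X s @^-1` B]].

Definition natural_filtration (t : \bar R) : set (set Omega) :=
  <<s natural_gen t >>.

Definition natural_space := g_sigma_algebraType (natural_gen +oo%E).

(* [Q] is the measure P_nu with initial distribution [nu], on sigma(X). *)
Definition law_from (nu : probability (borel MD) R)
    (Q : probability natural_space R) :=
  forall A, natural_filtration +oo%E A -> Q A = (\int[nu]_x P x A)%E.

Definition completed_filtration (Q : probability natural_space R)
    (t : \bar R) : set (set Omega) :=
  [set A | exists2 B, natural_filtration t B &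
     Q.-negligible ((A `\` B) `|` (B `\` A))].

Definition min_filtration (t : \bar R) : set (set Omega) :=
  [set A | forall nu Q, law_from nu Q -> completed_filtration Q t A].

Definition is_stopping_time (sigma : Omega -> \bar R) :=
  (forall w, (0 <= sigma w)%E) /\
  forall t : R, 0 <= t ->
    min_filtration t%:E [set w | (sigma w <= t%:E)%E].

Definition stopped_algebra (sigma : Omega -> \bar R) : set (set Omega) :=
  [set A | min_filtration +oo%E A /\
     forall t : R, 0 <= t ->
       min_filtration t%:E (A `&` [set w | (sigma w <= t%:E)%E])].

(* [g] is a version of the conditional probability of [A] given the
   sub-sigma-algebra [G] of the completion of [Q]. *)
Definition is_cond_prob (Q : probability natural_space R)
    (G : set (set Omega)) (A : set Omega) (g : Omega -> \bar R) :=
  (forall B : set (\bar R), measurable B -> G (g @^-1` B)) /\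
  (forall L, G L ->
     completion Q (L `&` A) =
     \int[completion Q]_(w in L) g w)%E.

Definition markov_property :=
  forall (x : MD) (s t : R) (E : set (borel MD)) (L : set Omega),
    0 <= s -> 0 <= t -> measurable E -> natural_filtration t%:E L ->
    (P x (L `&` [set w | E (X (t + s)%:E w)]) =
     \int[P x]_(w in L) P (X t%:E w) (X s%:E @^-1` E))%E.

Definition strong_markov_property :=
  forall (sigma : Omega -> \bar R) nu Q (s : R) (E : set (borel MD)),
    is_stopping_time sigma -> law_from nu Q -> 0 <= s -> measurable E ->
    is_cond_prob Q (stopped_algebra sigma)
      [set w | E (X (sigma w + s%:E)%E w)]
      (fun w => P (X (sigma w) w) (X s%:E @^-1` E)).

Definition quasi_left_continuous :=
  forall (sigma_ : nat -> Omega -> \bar R) (sigma : Omega -> \bar R) nu Q,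
    (forall n, is_stopping_time (sigma_ n)) -> is_stopping_time sigma ->
    (forall w n, (sigma_ n w <= sigma_ n.+1 w)%E) ->
    (forall w, sigma_ n w @[n --> \oo] --> sigma w) ->
    law_from nu Q ->
    {ae Q, forall w, (sigma w < +oo)%E ->
       X (sigma_ n w) w @[n --> \oo] --> X (sigma w) w}.

End filtration.

Record hunt_process := HuntProcess {
  sample_path : \bar R -> Omega -> MD ;
  start_law : MD -> probability Omega R ;
  time_shift : \bar R -> Omega -> Omega ;
  path_measurable : forall (t : \bar R) (B : set (borel MD)),
    (0 <= t)%E -> measurable B -> measurable (sample_path t @^-1` B) ;
  law_normal : forall x : MD,
    start_law x [set w | sample_path 0%E w = x] = 1%E ;
  law_measurable : forall (t : R) (A : set (borel M)),
    0 <= t -> measurable A ->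
    measurable_fun [set: borel M]
      (fun x => start_law (Some x) (sample_path t%:E @^-1` in_cpt A)) ;
  path_markov : markov_property sample_path start_law ;
  path_cemetery : forall (w : Omega) (t : \bar R),
    (lifetime sample_path w <= t)%E -> sample_path t w = None ;
  path_shift : forall (s t : \bar R) (w : Omega),
    (0 <= s)%E -> (0 <= t)%E ->
    sample_path s (time_shift t w) = sample_path (s + t)%E w ;
  path_right_continuous : forall (w : Omega) (t : R), 0 <= t ->
    sample_path s%:E w @[s --> t^'+] --> sample_path t%:E w ;
  path_left_limit : forall (w : Omega) (t : R), 0 < t ->
    exists l : MD, sample_path s%:E w @[s --> t^'-] --> l ;
  filtration_right_continuous : forall t : R, 0 <= t ->
    min_filtration sample_path start_law t%:E =
    \bigcap_(s in [set s : R | t < s])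
      min_filtration sample_path start_law s%:E ;
  path_strong_markov : strong_markov_property sample_path start_law ;
  path_quasi_left_continuous : quasi_left_continuous sample_path start_law
}.

Context (X : hunt_process).

Definition exit_time (B : set M) (w : Omega) : \bar R :=
  ereal_inf [set t%:E | t in
    [set t : R | 0 <= t /\ ~ in_cpt B (sample_path X t%:E w)]].

(* Events on exit times are measurable only for the completion of P_x. *)
Definition cprob (x : M) (A : set Omega) : \bar R :=
  completion (start_law X (Some x)) A.

Definition transition (t : R) (x : M) (A : set M) : \bar R :=
  start_law X (Some x) [set w | in_cpt A (sample_path X t%:E w)].

Definition killed_transition (U : set M) (t : R) (x : M) (A : set M) : \bar R :=
  cprob x [set w | in_cpt A (sample_path X t%:E w) /\ (t%:E < exit_time U w)%E].

End hunt_process.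

Arguments hunt_process {R} M {d} Omega.

Section scale_function.
Context {R : realType}.
Implicit Types (Psi : R -> R).

Definition scale_ext Psi : \bar R -> \bar R := er_map Psi.

(* The supremum is finite for [0 < t] as soon as [Psi] satisfies
   [scale_regular] with [1 < beta1], so the real-valued [sup] is the actual
   supremum. *)
Definition scale_conj Psi (rho t : R) : R :=
  sup [set rho / r - t / Psi r | r in [set r : R | 0 < r]].

Definition scale_regular (cPsi beta1 beta2 : R) Psi :=
  forall rho rho' : R, 0 < rho -> rho <= rho' ->
    cPsi^-1 * (rho' / rho) `^ beta1 <= Psi rho' / Psi rho /\
    Psi rho' / Psi rho <= cPsi * (rho' / rho) `^ beta2.

(* (0, Psi(rad)] if [rad] is finite, and (0, oo) if [rad] is infinite. *)
Definition time_interval Psi (rad : \bar R) : set R :=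
  [set t | 0 < t /\ (t%:E <= scale_ext Psi rad)%E].

End scale_function.

(* Main.v *)
(* To bound P_x[X_t in A] for A in a ball B(y0, r/4), follow the path backwards
   from time t. Either it has stayed in B(y0, r/2) and the bound on the killed
   transition function applies, or for some k it travels a distance of order
   r/4^k from time t - theta^k t to time t - theta^(k+1) t and stays in B(y0, r/2)
   afterwards. The displacement costs a factor exp(-Phi(gamma r/(16 4^k), theta^k t)),
   which is at most exp(-2^k Phi(gamma r/16, t)), and then the killed bound for
   the remaining time theta^(k+1) t applies. The polynomial loss in F is
   absorbed by half of the exponential and the series over k converges. All
   times are deterministic, so the simple Markov property suffices. These local
   bounds add up to an integral bound on P_t(x, .), which yields a density,
   jointly measurable by Chapman-Kolmogorov, that is finally truncated at the
   bound. *)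
Require Import Defs.
From HB Require Import structures.
From mathcomp Require Import all_boot all_order all_algebra.
From mathcomp Require Import all_classical all_reals all_analysis measurable_realfun.
From mathcomp Require Import ring lra.

Set Implicit Arguments.
Unset Strict Implicit.
Unset Printing Implicit Defensive.

Import Order.TTheory GRing.Theory Num.Theory.
Import numFieldTopology.Exports numFieldNormedType.Exports.

Local Open Scope classical_set_scope.
Local Open Scope ring_scope.

(** * The Legendre-type transform of the scale function *)

(** The Markov property is available for events of the natural filtration, whereas exit events are
    handled only under the completed law. Exit events are therefore replaced by conditions on dyadic
    time grids, which lie in the natural filtration and satisfy the Markov identity by induction on
    the number of grid times. Right continuity compares the two kinds of events at the price of an
    arbitrarily small enlargement of a ball, and the radii of the decomposition leave room for it.
    Continuity of the paths enters at the terminal time [t]: it makes the path stay near [X_t]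
    shortly before [t], so the backward search stops.

    [theta] is tuned so that shrinking the radius by 4 and the time by [theta] at least doubles
    [Phi]. The loss in [F] at step [k] is then geometric in [k], while the gain is exponential in
    [2 ^ k].

    The constants [kappa] and [C1] are produced before the scale function and the process are
    introduced, so the final constant depends on the scalar parameters alone. The integral bound on
    the transition function has two uses: it gives absolute continuity, hence a density, and it
    shows that truncating this density changes it only on a null set. *)

Lemma powR_pred {R : realType} (v k : R) : 0 < v ->
  v `^ k = v * v `^ (k - 1).
Proof.
move=> v0; have := @powRD R v 1 (k - 1).
by rewrite addrC subrK (gt_eqF v0) implybT powRr1 ?ltW// => /(_ isT).
Qed.

Section scale_conjugate.
Context {R : realType} (cPsi beta1 beta2 : R).
Hypotheses (cPsi_gt0 : 0 < cPsi) (beta1_gt1 : 1 < beta1).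

(** The ratio for which upper scaling gives [theta * Psi r <= Psi (r / 8)]. *)
Definition theta : R := (cPsi * 8 `^ beta2)^-1.

Lemma theta_gt0 : 0 < theta.
Proof. by rewrite invr_gt0 mulr_gt0// powR_gt0. Qed.

(** Write the left side as [v * (a - b * v ^ (k - 1))]. Below the threshold
    [(a / b) ^ (1 / (k - 1))] drop the negative term; above it the bracket is negative. It is
    applied with [v] proportional to the inverse of the radius in the supremum [Phi]. *)
Lemma linear_sub_powR_le (a b v k : R) : 0 < a -> 1 < k -> 0 < b -> 0 < v ->
  a * v - b * v `^ k <= a * (a / b) `^ (k - 1)^-1.
Proof.
move=> a0 k1 b0 v0.
have k0 : 0 < k - 1 by rewrite subr_gt0.
have -> : v `^ k = v * v `^ (k - 1).
  exact: powR_pred.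
have [h|h] := leP v ((a / b) `^ (k - 1)^-1).
  apply: (@le_trans _ _ (a * v)).
    by rewrite gerBl !mulr_ge0 ?powR_ge0// ltW.
  by rewrite ler_wpM2l// ltW.
have : a / b < v `^ (k - 1).
  have := @gt0_ltr_powR R (k - 1) k0 ((a / b) `^ (k - 1)^-1) v.
  rewrite !nnegrE powR_ge0 (ltW v0) => /(_ isT isT h).
  by rewrite -powRrM mulVf ?gt_eqF// powRr1// divr_ge0// ltW.
rewrite ltr_pdivrMr// => h2.
apply: (@le_trans _ _ 0); last by rewrite mulr_ge0// ?powR_ge0// ltW.
rewrite subr_le0 mulrC.
have := ler_wpM2l (ltW v0) (ltW h2).
by rewrite (mulrCA b) (mulrC b).
Qed.

Variable Psi : R -> R.
Hypotheses (Psi_gt0 : forall r, 0 < r -> 0 < Psi r)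
  (Psi_reg : scale_regular cPsi beta1 beta2 Psi).

Local Notation Phi := (scale_conj Psi).

Lemma cPsi_ge1 : 1 <= cPsi.
Proof.
have [_] := Psi_reg ltr01 (lexx 1).
by rewrite !divff ?gt_eqF ?Psi_gt0// powR1 mulr1.
Qed.

Lemma Psi_le_scale (r r' : R) : 0 < r -> r <= r' ->
  Psi r' <= cPsi * (r' / r) `^ beta2 * Psi r.
Proof.
by move=> r0 rr'; have [_] := Psi_reg r0 rr'; rewrite ler_pdivrMr ?Psi_gt0.
Qed.

Lemma Psi_ge_scale (r r' : R) : 0 < r -> r <= r' ->
  cPsi^-1 * (r' / r) `^ beta1 * Psi r <= Psi r'.
Proof.
by move=> r0 rr'; have [+ _] := Psi_reg r0 rr'; rewrite ler_pdivlMr ?Psi_gt0.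
Qed.

Lemma scale_conj_le (rho t C : R) :
  (forall r, 0 < r -> rho / r - t / Psi r <= C) -> Phi rho t <= C.
Proof.
move=> h; apply: ge_sup; first by exists (rho / 1 - t / Psi 1), 1 => /=.
by move=> _ [r /= r0 <-]; exact: h.
Qed.

(** The danger is [r] near 0. There lower scaling makes [t / Psi r] at least a multiple of
    [r ^ -beta1], which beats [rho / r] because [1 < beta1]. Without this bound the real supremum
    would be a default value. *)
Lemma scale_conj_has_ubound (rho t : R) : 0 < t ->
  has_ubound [set rho / r - t / Psi r | r in [set r : R | 0 < r]].
Proof.
move=> t0.
pose a := `|rho| + 1; have a0 : 0 < a by rewrite ltr_wpDl.
pose b := cPsi^-1 * t / Psi 1.
have P1 : 0 < Psi 1 by exact: Psi_gt0.
have b0 : 0 < b by rewrite !mulr_gt0 ?invr_gt0.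
exists (a + a * (a / b) `^ (beta1 - 1)^-1) => _ [r /= r0 <-].
have ra : rho <= a by rewrite (le_trans (ler_norm _))// lerDl.
have [r1|r1] := leP 1 r.
  apply: (@le_trans _ _ a); last by rewrite lerDl mulr_ge0 ?powR_ge0// ltW.
  have rr : rho / r <= a.
    rewrite ler_pdivrMr// (le_trans ra)// ler_peMr// ltW//.
  rewrite (le_trans _ rr)// gerBl divr_ge0 ?ltW ?Psi_gt0//.
apply: (@le_trans _ _ (a * (a / b) `^ (beta1 - 1)^-1)); last by rewrite lerDr ltW.
apply: le_trans (linear_sub_powR_le a0 beta1_gt1 b0 (_ : 0 < r^-1)); last by rewrite invr_gt0.
apply: lerB; first by rewrite ler_wpM2r// invr_ge0 ltW.
have := Psi_ge_scale r0 (ltW r1); rewrite div1r => h.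
rewrite /b mulrAC ler_pdivrMr// [leRHS]mulrAC ler_pdivlMr ?Psi_gt0//.
rewrite [leLHS](_ : _ = t * (cPsi^-1 * r^-1 `^ beta1 * Psi r)); last by ring.
by rewrite ler_pM2l.
Qed.

Lemma le_scale_conj (rho t r : R) : 0 < t -> 0 < r ->
  rho / r - t / Psi r <= Phi rho t.
Proof.
by move=> t0 r0; apply: ub_le_sup; [exact: scale_conj_has_ubound|exists r].
Qed.

Lemma le_scale_conj2 (rho rho' t t' : R) : 0 < t' -> t' <= t -> rho <= rho' ->
  Phi rho t <= Phi rho' t'.
Proof.
move=> t'0 tt rr; apply: scale_conj_le => r r0.
apply: le_trans (le_scale_conj rho' t'0 r0).
by rewrite lerB// ler_wpM2r// invr_ge0 ltW// Psi_gt0.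
Qed.

(** Scaling [rho] multiplies the positive term by [l] and leaves the subtracted one alone. *)
Lemma scale_conj_mull (l rho t : R) : 1 <= l -> 0 < t ->
  l * Phi rho t <= Phi (l * rho) t.
Proof.
move=> l1 t0; have l0 : 0 < l by rewrite (lt_le_trans ltr01).
rewrite mulrC -ler_pdivlMr//; apply: scale_conj_le => r r0.
rewrite ler_pdivlMr//; apply: le_trans (le_scale_conj _ t0 r0).
rewrite mulrBl lerB//; first by rewrite mulrC mulrA.
by rewrite ler_peMr// divr_ge0 ?ltW ?Psi_gt0.
Qed.

(* Substitute [r / 8] for [r] in the supremum. *)
Lemma scale_conj_quarter (rho t : R) : 0 < t ->
  2 * Phi rho t <= Phi (rho / 4) (theta * t).
Proof.
move=> t0; rewrite mulrC -ler_pdivlMr//; apply: scale_conj_le => r r0.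
rewrite ler_pdivlMr//.
have r80 : 0 < r / 8 by rewrite divr_gt0.
have tt0 : 0 < theta * t by rewrite mulr_gt0 ?theta_gt0.
apply: le_trans (le_scale_conj _ tt0 r80).
have P8 := Psi_gt0 r80; have Pr := Psi_gt0 r0.
have -> : rho / 4 / (r / 8) = rho / r * 2 by field; rewrite gt_eqF.
rewrite mulrBl lerB//.
have r8r : r / 8 <= r by lra.
have := Psi_le_scale r80 r8r.
have -> : r / (r / 8) = 8 by field; rewrite gt_eqF.
move=> h.
apply: (@le_trans _ _ (t / Psi r)); last first.
  by rewrite ler_peMr ?ler1n// divr_ge0// ltW.
rewrite ler_pdivrMr// mulrAC ler_pdivlMr//.
rewrite [leRHS](_ : _ = theta * t * (cPsi * 8 `^ beta2 * Psi (r / 8))).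
  by rewrite ler_pM2l.
by rewrite /theta; field; rewrite ?gt_eqF ?powR_gt0.
Qed.

Lemma scale_conj_iter (rho t : R) (j : nat) : 0 < t ->
  2 ^+ j * Phi rho t <= Phi (rho / 4 ^+ j) (theta ^+ j * t).
Proof.
move=> t0; elim: j => [|j IH]; first by rewrite !expr0 divr1 !mul1r.
have tj0 : 0 < theta ^+ j * t by rewrite mulr_gt0 ?exprn_gt0 ?theta_gt0.
apply: le_trans (_ : Phi (rho / 4 ^+ j / 4) (theta * (theta ^+ j * t)) <= _).
  by apply: le_trans (scale_conj_quarter _ tj0); rewrite exprS -mulrA ler_pM2l.
by rewrite !exprS !mulrA invfM mulrA mulrAC.
Qed.

(** This is the near-diagonal regime, where the exponential factor is bounded below. Radii above
    [rho] give at most [g]; for smaller ones [t / Psi r >= Psi rho / Psi r >= cPsi^-1 * (rho / r) ^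
    beta1], and [linear_sub_powR_le] applies with [v = rho / r]. *)
Lemma scale_conj_bounded (g rho t : R) : 0 < g -> 0 < rho -> Psi rho <= t ->
  Phi (g * rho) t <= g + g * (g * cPsi) `^ (beta1 - 1)^-1.
Proof.
move=> g0 rho0 Pt; have P0 := Psi_gt0 rho0.
have t0 : 0 < t by exact: lt_le_trans Pt.
apply: scale_conj_le => r r0; have Pr := Psi_gt0 r0.
have [rr|rr] := leP rho r.
  apply: (@le_trans _ _ g); last by rewrite lerDl mulr_ge0 ?powR_ge0// ltW.
  have gr : g * rho / r <= g by rewrite ler_pdivrMr// ler_wpM2l// ltW.
  by rewrite (le_trans _ gr)// gerBl divr_ge0// ltW.
apply: (@le_trans _ _ (g * (g * cPsi) `^ (beta1 - 1)^-1)); last by rewrite lerDr ltW.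
rewrite -[in leRHS](invrK cPsi).
apply: le_trans (linear_sub_powR_le g0 beta1_gt1 (_ : 0 < cPsi^-1) (_ : 0 < rho / r)).
- apply: lerB; first by rewrite mulrA.
  have := Psi_ge_scale r0 (ltW rr) => h.
  by rewrite ler_pdivlMr//; exact: le_trans Pt.
- by rewrite invr_gt0.
- by rewrite divr_gt0.
Qed.

End scale_conjugate.

(** * Constants that are uniform over all scale functions with the given exponents *)

Section scale_constants.
Context {R : realType} (cPsi beta1 beta2 : R).
Hypotheses (cPsi_gt0 : 0 < cPsi) (beta1_gt1 : 1 < beta1)
  (beta12 : beta1 <= beta2).
Local Notation theta := (@theta R cPsi beta2).

(** Off the diagonal, a single well-chosen radius in the supremum already gives a power of
    [Psi rho / t]. The order of quantifiers matters: [kappa] is fixed before [Psi]. *)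
Lemma scale_conj_lower (g : R) : 0 < g ->
  exists2 kappa : R, 0 < kappa &
  forall Psi : R -> R, (forall r, 0 < r -> 0 < Psi r) ->
    scale_regular cPsi beta1 beta2 Psi ->
    forall rho t : R, 0 < rho -> 0 < t -> t <= Psi rho ->
    kappa * (Psi rho / t) `^ beta2^-1 <= scale_conj Psi (g * rho) t.
Proof.
move=> g0.
(* Chosen so that [s ^ (beta1 - 1) >= 2 * cPsi / g], which is [hs]; the summand 1 ensures
   [s >= 1]. *)
pose s := 1 + (2 * cPsi / g) `^ (beta1 - 1)^-1.
have b20 : 0 < beta2 := lt_trans ltr01 (lt_le_trans beta1_gt1 beta12).
have s1 : 1 <= s by rewrite lerDl powR_ge0.
have s0 : 0 < s by rewrite (lt_le_trans ltr01).
have hs : cPsi * s `^ (- beta1) <= g / (2 * s).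
  have b0 : 0 < beta1 - 1 by rewrite subr_gt0.
  have : 2 * cPsi / g <= s `^ (beta1 - 1).
    have := @ge0_ler_powR R (beta1 - 1) (ltW b0) ((2 * cPsi / g) `^ (beta1 - 1)^-1) s.
    rewrite !nnegrE powR_ge0 (ltW s0) => /(_ isT isT).
    rewrite -powRrM mulVf ?gt_eqF// powRr1; last by rewrite divr_ge0 ?mulr_ge0// ltW.
    by apply; rewrite /s lerDr.
  rewrite ler_pdivrMr// => h.
  rewrite powRN -(@ler_pM2r _ (2 * s * s `^ beta1)) ?mulr_gt0 ?powR_gt0//.
  have E : s `^ beta1 = s * s `^ (beta1 - 1).
    exact: powR_pred.
  have e0 : s `^ beta1 != 0 by rewrite gt_eqF ?powR_gt0.
  have -> : cPsi * (s `^ beta1)^-1 * (2 * s * s `^ beta1) = 2 * cPsi * s.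
    by field.
  have -> : g / (2 * s) * (2 * s * s `^ beta1) = g * s `^ beta1.
    by field; rewrite gt_eqF.
  by rewrite E mulrCA mulrC ler_pM2l// [leRHS]mulrC.
exists (g / (2 * s)); first by rewrite divr_gt0 ?mulr_gt0.
move=> Psi P0 reg rho t rho0 t0 tP.
set u := Psi rho / t.
have u1 : 1 <= u by rewrite /u ler_pdivlMr// mul1r.
have u0 : 0 < u by rewrite (lt_le_trans ltr01).
set w := u `^ beta2^-1.
have w1 : 1 <= w by rewrite -(@powRr0 _ u) ler_powR// invr_ge0 ltW.
have w0 : 0 < w by rewrite (lt_le_trans ltr01).
have wu : w `^ beta2 = u by rewrite /w -powRrM mulVf ?gt_eqF// powRr1// ltW.
(* At this radius the first term of [Phi] is [g * w / s], and the rest of the proof shows that the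
   second is at most half of it. *)
pose r := s / w * rho.
have r0 : 0 < r by rewrite !mulr_gt0 ?invr_gt0.
apply: le_trans (le_scale_conj cPsi_gt0 beta1_gt1 P0 reg _ t0 r0).
have -> : g * rho / r = 2 * (g / (2 * s) * w).
  by rewrite /r; field; rewrite !gt_eqF.
suff : t / Psi r <= g / (2 * s) * w by move=> ?; lra.
rewrite ler_pdivrMr ?P0//.
suff h : Psi rho <= cPsi * s `^ (- beta1) * w * u * Psi r.
  have -> : t = Psi rho / u by rewrite /u; field; rewrite !gt_eqF ?P0.
  rewrite ler_pdivrMr//; apply: le_trans h _.
  rewrite [leRHS]mulrAC ler_wpM2r ?(ltW (P0 _ r0))// ler_wpM2r ?(ltW u0)//.
  by rewrite ler_wpM2r// ltW.
have wr : w `^ 1 = w by rewrite powRr1// ltW.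
(* If [s <= w] then [r <= rho]: upper scaling gives [s ^ -beta2 * u], and
   [s ^ -beta2 <= s ^ -beta1]. Otherwise [rho <= r]: lower scaling gives [s ^ -beta1 * w ^ beta1],
   and [w ^ beta1 <= w ^ beta2 = u]. Either way the factor [w >= 1] is to spare. *)
have [sw|sw] := leP s w.
  have rr : r <= rho by rewrite /r ler_piMl ?(ltW rho0)// ler_pdivrMr// mul1r.
  apply: (le_trans (Psi_le_scale P0 reg r0 rr)); rewrite ler_wpM2r ?(ltW (P0 _ r0))//.
  have -> : rho / r = w / s by rewrite /r; field; rewrite !gt_eqF.
  rewrite -!mulrA ler_wpM2l ?(ltW cPsi_gt0)//.
  rewrite powRM ?invr_ge0 ?(ltW w0) ?(ltW s0)// wu mulrCA (mulrC u) mulrC.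
  rewrite -powR_inv1 ?(ltW s0)// -powRrM mulN1r.
  rewrite [leLHS]mulrC [leRHS]mulrA ler_wpM2r ?(ltW u0)//.
  apply: (@le_trans _ _ (s `^ (- beta1))); last by rewrite ler_peMl ?powR_ge0.
  by rewrite ler_powR// lerN2.
have rr : rho <= r by rewrite /r ler_peMl ?(ltW rho0)// ler_pdivlMr// mul1r ltW.
have := Psi_ge_scale P0 reg rho0 rr.
have -> : r / rho = s / w by rewrite /r; field; rewrite !gt_eqF.
move=> h.
have : Psi rho <= cPsi * (s / w) `^ (- beta1) * Psi r.
  rewrite powRN; have q0 : 0 < (s / w) `^ beta1 by rewrite powR_gt0// divr_gt0.
  have : Psi rho <= Psi r / (cPsi^-1 * (s / w) `^ beta1).
    by rewrite ler_pdivlMr ?mulr_gt0 ?invr_gt0// mulrC.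
  congr (_ <= _); field.
  by rewrite !gt_eqF.
move/le_trans; apply; rewrite ler_wpM2r ?(ltW (P0 _ r0))//.
rewrite -!mulrA ler_wpM2l ?(ltW cPsi_gt0)//.
rewrite powRM ?invr_ge0 ?(ltW w0) ?(ltW s0)// ler_wpM2l ?powR_ge0//.
rewrite -powR_inv1 ?(ltW w0)// -powRrM mulrN mulN1r opprK.
apply: (@le_trans _ _ u); first by rewrite -wu ler_powR.
by rewrite ler_peMl// ltW.
Qed.

(* With [u <= (phi / kappa) ^ beta2] and [2 ^ j <= 2 ^ j phi / kappa], every
   polynomial factor is a power of [2 ^ j phi], hence is absorbed by a part of
   the exponential. *)
Lemma scale_absorb (alpha kappa : R) : 0 < alpha -> 0 < kappa ->
  exists2 C : R, 0 < C &
  forall (j : nat) (u phi : R), 1 <= u -> kappa * u `^ beta2^-1 <= phi ->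
    (u / theta ^+ j.+1) `^ alpha * expR (- (2 ^+ j * phi)) <=
    C * 2^-1 ^+ j.+1 * expR (- (phi / 2)).
Proof.
move=> a0 k0.
have b20 : 0 < beta2 := lt_trans ltr01 (lt_le_trans beta1_gt1 beta12).
have th0 : 0 < theta by exact: theta_gt0.
have archi (x : R) : exists n : nat, x <= n%:R.
  exists (Num.truncn `|x|).+1.
  by rewrite (le_trans (ler_norm _))// ltW// truncnS_gt.
have [n0 hn0] : exists n0 : nat, theta^-1 <= 2 ^+ n0.
  have [n hn] := archi theta^-1; exists n; apply: le_trans hn _.
  by rewrite -natrX ler_nat ltnW// ltn_expl.
have [n1 hn1] := archi beta2.
have [n2 hn2] := archi alpha.
(* With [w] below, [w ^ n1] bounds [u], [w ^ n0] bounds [theta ^ -(j + 1)], and [n2] replaces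
   [alpha]. The one extra power pays for the factor [2 ^ (j + 1)] that makes the series converge. *)
pose n := ((n0 + n1) * n2).+1.
exists (n`!%:R * (4 / kappa) ^+ n).
  by rewrite mulr_gt0 ?ltr0n ?fact_gt0// exprn_gt0 ?divr_gt0.
move=> j u phi u1 hphi.
have u0 : 0 < u by rewrite (lt_le_trans ltr01).
have ub1 : 1 <= u `^ beta2^-1 by rewrite -(@powRr0 _ u) ler_powR// invr_ge0 ltW.
have kphi : kappa <= phi by rewrite (le_trans _ hphi)// ler_peMr// ltW.
have phi0 : 0 < phi by rewrite (lt_le_trans k0).
(* Half of the exponent: [expR x] absorbs [x ^ n], and the other half, at least [phi / 2], is
   kept. *)
pose x := 2 ^+ j * phi / 2.
have p1 : 1 <= 2 ^+ j :> R by rewrite exprn_ege1// ler1n.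
have x0 : 0 < x by rewrite divr_gt0 ?mulr_gt0// (lt_le_trans ltr01).
pose w := 4 * x / kappa.
have wE : w = 2 ^+ j.+1 * (phi / kappa) by rewrite /w /x exprS; field; rewrite gt_eqF.
have fk1 : 1 <= phi / kappa by rewrite ler_pdivlMr// mul1r.
have wj : 2 ^+ j.+1 <= w by rewrite wE ler_peMr// exprn_ge0.
have w1 : 1 <= w by rewrite (le_trans _ wj)// exprn_ege1// ler1n.
have w0 : 0 < w by rewrite (lt_le_trans ltr01).
have uw : u <= w ^+ n1.
  apply: (@le_trans _ _ (w `^ beta2)); last first.
    by rewrite -powR_mulrn ?(ltW w0)// ler_powR.
  have : u `^ beta2^-1 <= w.
    rewrite wE (@le_trans _ _ (phi / kappa))//.
      by rewrite ler_pdivlMr// mulrC.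
    by rewrite ler_peMl ?(le_trans ler01 fk1)// exprn_ege1// ler1n.
  move/(@ge0_ler_powR R beta2 (ltW b20) _ _); rewrite !nnegrE powR_ge0 (ltW w0).
  move=> /(_ isT isT); rewrite -powRrM mulVf ?gt_eqF// powRr1//.
  exact: ltW.
have thw : (theta ^+ j.+1)^-1 <= w ^+ n0.
  rewrite -exprVn (@le_trans _ _ ((2 ^+ n0) ^+ j.+1))//.
    by apply: lerXn2r => //; rewrite nnegrE ?exprn_ge0 ?ler0n// invr_ge0 (ltW th0).
  by rewrite -exprM mulnC exprM; apply: lerXn2r => //; rewrite nnegrE ?exprn_ge0 ?ler0n ?(ltW w0).
have h1 : (u / theta ^+ j.+1) `^ alpha <= w ^+ ((n0 + n1) * n2).
  apply: (@le_trans _ _ ((w ^+ (n0 + n1)) `^ alpha)).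
    apply: ge0_ler_powR; first exact: ltW.
    - by rewrite nnegrE divr_ge0 ?exprn_ge0 ?(ltW u0) ?(ltW th0).
    - by rewrite nnegrE exprn_ge0 ?(ltW w0).
    - by rewrite addnC exprD ler_pM// ?invr_ge0 ?exprn_ge0// ?(ltW u0) ?(ltW th0).
  rewrite exprM -[leRHS]powR_mulrn ?exprn_ge0 ?(ltW w0)//.
  by rewrite ler_powR// exprn_ege1.
have h2 : (u / theta ^+ j.+1) `^ alpha * 2 ^+ j.+1 <= w ^+ n.
  by rewrite /n [leRHS]exprSr ler_pM ?powR_ge0 ?exprn_ge0 ?ler0n.
have h3 : w ^+ n <= n`!%:R * (4 / kappa) ^+ n * expR x.
  have -> : w = 4 / kappa * x by rewrite /w; ring.
  rewrite exprMn [leRHS]mulrAC [leRHS]mulrC ler_wpM2l//.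
    by rewrite exprn_ge0// divr_ge0// ltW.
  have := expR_ge1Dxn ((n0 + n1) * n2)%N (ltW x0); rewrite -/n.
  have f0 : 0 < n`!%:R :> R by rewrite ltr0n fact_gt0.
  move=> h; have : x ^+ n / n`!%:R <= expR x by rewrite (le_trans _ h)// lerDr.
  by rewrite ler_pdivrMr// [leRHS]mulrC.
have h4 : expR (- (2 ^+ j * phi)) <= expR (- x) * expR (- (phi / 2)).
  rewrite -expRD ler_expR /x; have : phi <= 2 ^+ j * phi by rewrite ler_peMl// ltW.
  by lra.
have j0 : 0 < 2 ^+ j.+1 :> R by rewrite exprn_gt0.
set a := (_ `^ alpha) in h1 h2 *.
have ha : a <= n`!%:R * (4 / kappa) ^+ n * expR x * 2^-1 ^+ j.+1.
  by rewrite exprVn ler_pdivlMr//; exact: le_trans h3.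
apply: (le_trans (ler_pM _ _ ha h4)); rewrite ?powR_ge0 ?expR_ge0//.
rewrite [leLHS](_ : _ = n`!%:R * (4 / kappa) ^+ n * 2^-1 ^+ j.+1 *
  (expR x * expR (- x)) * expR (- (phi / 2))); last by ring.
by rewrite -expRD subrr expR0 mulr1.
Qed.

End scale_constants.

(** * Densities of kernels *)

Section product_measure.
Context d1 d2 (Z : measurableType d1) (Y : measurableType d2) (R : realType).
Variables (m : {sigma_finite_measure set Z -> \bar R})
  (mu : {sigma_finite_measure set Y -> \bar R}).
Local Open Scope ereal_scope.

(* The library attaches the sigma-finite structure of [m \x mu] to
   subprobabilities only. *)
Definition product_measure : set (Z * Y) -> \bar R := (m \x mu).

HB.instance Definition _ := Measure.copy product_measure (m \x mu).

Let product_measure_sigma_finite : sigma_finite setT product_measure.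
Proof.
have /sigma_finiteP[F [TF ndF Foo]] := sigma_finiteT m.
have /sigma_finiteP[G [TG ndG Goo]] := sigma_finiteT mu.
exists (fun n => F n `*` G n).
  apply/esym/seteqP; split => // -[z y] _.
  have : setT z by []; rewrite TF => -[i _ Fz].
  have : setT y by []; rewrite TG => -[j _ Gy].
  exists (maxn i j) => //; split => /=.
  - by move: Fz; exact/subsetPset/ndF/leq_maxl.
  - by move: Gy; exact/subsetPset/ndG/leq_maxr.
move=> n; have [mF fF] := Foo n; have [mG fG] := Goo n.
split; first exact: measurableX.
by rewrite /product_measure product_measure1E// lte_mul_pinfty// ge0_fin_numE.
Qed.

HB.instance Definition _ := Measure_isSigmaFinite.Build _ _ _ product_measure
  product_measure_sigma_finite.

End product_measure.

Section semidirect_product.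
Context d1 d2 (Z : measurableType d1) (Y : measurableType d2) (R : realType).
Variables (m : {finite_measure set Z -> \bar R}) (k : R.-fker Z ~> Y).
Local Open Scope ereal_scope.

(** The measure [m(dz) k(z, dy)]. Its Radon-Nikodym derivative on the product is a density of the
    kernel that is measurable in both variables at once. *)
Definition semidirect (C : set (Z * Y)) : \bar R :=
  \int[m]_z k z (xsection C z).

Let mxk C : measurable C -> measurable_fun setT (fun z => k z (xsection C z)).
Proof. by move=> mC; apply: measurable_fun_xsection_finite_kernel; rewrite inE. Qed.

Let semidirect0 : semidirect set0 = 0.
Proof. by apply: integral0_eq => z _; rewrite xsection0 measure0. Qed.

Let semidirect_ge0 C : 0 <= semidirect C.
Proof. exact: integral_ge0. Qed.

Let semidirect_sigma_additive : semi_sigma_additive semidirect.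
Proof.
move=> F mF tF mUF.
have -> : semidirect (\bigcup_n F n) = \sum_(n <oo) semidirect (F n).
  rewrite /semidirect -integral_nneseries//; last by move=> n; exact: mxk.
  apply: eq_integral => z _; rewrite xsection_bigcup.
  rewrite measure_semi_bigcup//.
  - by move=> n; exact: measurable_xsection.
  - exact: trivIset_xsection.
  - by apply: bigcup_measurable => n _; exact: measurable_xsection.
exact: is_cvg_nneseries.
Qed.

HB.instance Definition _ := isMeasure.Build _ _ _ semidirect
  semidirect0 semidirect_ge0 semidirect_sigma_additive.

Let semidirect_fin : fin_num_fun semidirect.
Proof.
apply: lty_fin_num_fun; have [r hr] := measure_uub k.
have r0 : (0 <= r)%R.
  by rewrite -lee_fin; apply: ltW; apply: le_lt_trans (hr point).
apply: (@le_lt_trans _ _ (\int[m]_z r%:E)).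
  apply: ge0_le_integral => //.
  - exact: mxk.
  - move=> z _; apply: ltW; apply: le_lt_trans (hr z); rewrite le_measure ?inE//.
    exact: measurable_xsection.
by rewrite integral_cst// lte_mul_pinfty// ltey_eq fin_num_measure.
Qed.

HB.instance Definition _ := @Measure_isFinite.Build _ _ _ semidirect semidirect_fin.

(** A null set of the product has [mu]-null sections over [m]-almost every [z], and [k z] vanishes
    on them. *)
Lemma semidirect_dominates (mu : {sigma_finite_measure set Y -> \bar R}) :
  {ae m, forall z, k z `<< mu} -> semidirect `<< (m \x mu).
Proof.
move=> kmu; apply/null_content_dominatesP => C mC C0.
rewrite /semidirect.
have mmu : measurable_fun setT (fun z => mu (xsection C z)).
  exact: measurable_fun_xsection.
have : ae_eq m setT (fun z => mu (xsection C z)) (cst 0).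
  apply/ae_eq_integral_abs => //.
  by under eq_integral do rewrite gee0_abs//; exact: C0.
move=> mu0.
rewrite -(integral0 m setT); apply: ge0_ae_eq_integral => //; first exact: mxk.
apply: filterS2 kmu mu0 => z /null_content_dominatesP kz mz _ /=.
by apply: kz; [exact: measurable_xsection|exact: mz].
Qed.

(** Evaluating the density of [semidirect] on rectangles [E * A] shows that both sides have the same
    integral over every [E], hence agree almost everywhere. The exceptional set may depend on
    [A]. *)
Lemma finite_kernel_density (mu : {sigma_finite_measure set Y -> \bar R}) :
  {ae m, forall z, k z `<< mu} ->
  exists q : Z * Y -> \bar R, [/\ forall z, 0 <= q z, measurable_fun setT q &
    forall A, measurable A ->
      {ae m, forall z, k z A = \int[mu]_(y in A) q (z, y)}].
Proof.
move=> kmu.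
pose nu : {finite_measure set (Z * Y)%type -> \bar R} := semidirect.
pose mm : {sigma_finite_measure set (Z * Y)%type -> \bar R} :=
  product_measure m mu.
have [q [q0 _ iq nuq]] :=
  @radon_nikodym_sigma_finite _ _ _ mm nu (semidirect_dominates kmu).
have mq := measurable_int _ iq.
exists q; split => // A mA.
pose qA (z : Z * Y) := q z * (\1_A z.2)%:E.
have mqA : measurable_fun setT qA.
  apply: emeasurable_funM => //; apply/measurable_EFinP.
  by apply: measurableT_comp => //; exact: measurable_snd.
have qA0 z : 0 <= qA z by rewrite mule_ge0// lee_fin.
have intA z : \int[mu]_(y in A) q (z, y) = \int[mu]_y qA (z, y).
  rewrite integral_mkcond; apply: eq_integral => y _.
  by rewrite /qA patchE /= indicE; case: ifPn => _; rewrite ?mule1 ?mule0.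
have mk := measurable_kernel k _ mA.
have mF : measurable_fun setT (fun z => \int[mu]_y qA (z, y)).
  exact: measurable_fun_fubini_tonelli_F.
suff : ae_eq m setT (k ^~ A) (fun z => \int[mu]_y qA (z, y)).
  by apply: filterS => z /(_ I) ->; rewrite intA.
apply: integral_ae_eq => //.
  apply/integrableP; split => //; under eq_integral do rewrite gee0_abs//.
  have := fin_num_measure semidirect (setT `*` A) (measurableX measurableT mA).
  rewrite ltey_eq => h; apply/orP; left; congr (_ \is a fin_num): h.
  by apply: eq_integral => z _; rewrite in_xsectionX// inE.
move=> E _ mE.
have mEA : measurable (E `*` A) by exact: measurableX.
transitivity (semidirect (E `*` A)).
  rewrite /semidirect integral_mkcond; apply: eq_integral => z _.
  rewrite patchE; case: ifPn => zE; first by rewrite in_xsectionX.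
  by rewrite notin_xsectionX// measure0.
rewrite nuq//.
pose qEA (z : Z * Y) := qA z * (\1_E z.1)%:E.
have mqEA : measurable_fun setT qEA.
  apply: emeasurable_funM => //; apply/measurable_EFinP.
  by apply: measurableT_comp => //; exact: measurable_fst.
have qEA0 z : 0 <= qEA z by rewrite mule_ge0// lee_fin.
transitivity (\int[m \x mu]_z qEA z).
  rewrite -[RHS]/(\int[mm]_z qEA z) [LHS]integral_mkcond.
  apply: eq_integral => -[z y] _; rewrite patchE /qEA /qA /= !indicE in_setX /=.
  by case: (z \in E); case: (y \in A); rewrite /= ?mule1 ?mule0.
rewrite (@fubini_tonelli1 _ _ _ _ _ m mu qEA mqEA qEA0).
rewrite [RHS]integral_mkcond; apply: eq_integral => z _.
rewrite patchE /fubini_F /qEA /= indicE; case: ifPn => zE.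
  by apply: eq_integral => y _; rewrite mule1.
by rewrite integral0_eq// => y _; rewrite mule0.
Qed.

End semidirect_product.

(** Extension to a sigma-finite [m] and to a kernel dominated only over [D]: apply the finite case
    to the restrictions of [m] to disjoint pieces of finite measure intersected with [D], and glue
    the densities along the pieces. *)
Lemma kernel_density d1 d2 (Z : measurableType d1) (Y : measurableType d2)
    (R : realType) (m : {sigma_finite_measure set Z -> \bar R})
    (mu : {sigma_finite_measure set Y -> \bar R}) (k : R.-fker Z ~> Y)
    (D : set Z) : measurable D ->
  (forall z, D z -> k z `<< mu) ->
  exists q : Z * Y -> \bar R,
    [/\ forall z, (0 <= q z)%E, measurable_fun setT q &
    forall A, measurable A ->
      {ae m, forall z, D z -> k z A = \int[mu]_(y in A) q (z, y)}%E].
Proof.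
move=> mD kmu.
have [F TF /all_and2[mF mFoo]] := sigma_finiteT m.
pose E := seqDU F.
have mE n : measurable (E n).
  by apply: measurableD => //; exact: bigsetU_measurable.
have mED n : measurable (E n `&` D) by exact: measurableI.
have mEoo n : (m (E n `&` D) < +oo)%E.
  rewrite (le_lt_trans _ (mFoo n))// le_measure ?inE//.
  by apply: subset_trans (@subIsetl _ _ _) _; exact: subDsetl.
have UET : \bigcup_i E i = [set: Z] by rewrite TF [RHS]seqDU_bigcup_eq.
have tE := trivIset_seqDU F.
pose m_ n : {finite_measure set Z -> \bar R} := mfrestr (mED n) (mEoo n).
have m_E n (P : Z -> Prop) : {ae m_ n, forall z, P z} <->
    {ae m, forall z, (E n `&` D) z -> P z}.
  split=> -[B [mB B0 PB]].
    exists (B `&` (E n `&` D)); split => //; first exact: measurableI.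
    by move=> z /not_implyP[Ez Pz]; split => //; exact: PB.
  exists (B `|` ~` (E n `&` D)); split => //.
  - by apply: measurableU => //; exact: measurableC.
  - rewrite /m_ /= /mfrestr /= /mrestr setIUl setICl setU0.
    by apply: subset_measure0 B0 => //; exact: measurableI.
  - move=> z /= Pz; have [Ez|] := pselect ((E n `&` D) z); last by right.
    by left; apply: PB => /(_ Ez).
have kmu_ n : {ae m_ n, forall z, k z `<< mu}.
  by apply/m_E; apply: aeW => z [_]; exact: kmu.
have [q_ /all_and3[q0 mq hq]] := choice (fun n => finite_kernel_density (kmu_ n)).
have hE z : exists n, E n z.
  by have : [set: Z] z by []; rewrite -UET => -[n _ Ez]; exists n.
have [idx hidx] := choice hE.
have idxE n z : E n z -> idx z = n.
  move=> Ez; apply: contrapT => h.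
  have /trivIsetP := tE => /(_ (idx z) n I I).
  move/eqP: h => h /(_ h); rewrite -subset0; apply; exact: (conj (hidx z) Ez).
exists (fun z => q_ (idx z.1) z); split; first by [].
  have -> : [set: Z * Y] = \bigcup_n (E n `*` setT).
    by rewrite -setX_bigcupl UET setXTT.
  apply/measurable_fun_bigcup => [n|n]; first exact: measurableX.
  apply: (@eq_measurable_fun _ _ _ _ _ (q_ n)).
    by move=> [z y] /[!inE] -[/= /idxE ->].
  exact: measurable_funTS.
move=> A mA.
have /ae_foralln : forall n, {ae m, forall z, (E n `&` D) z ->
    k z A = (\int[mu]_(y in A) q_ n (z, y))%E}.
  by move=> n; apply/m_E; exact: hq.
by apply: filterS => z hz Dz; exact: (hz (idx z) (conj (hidx z) Dz)).
Qed.

(** * Borel sets of a separable metric space, and integration tools *)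

Section metric_borel.
Context {R : realType} {M : pmetricType R}.

Lemma open_metric_ball (x : M) (r : R) : open (ball x r).
Proof.
rewrite openE => y; rewrite ballEmdist /= => xy.
apply/nbhs_ballP; exists (r - mdist x y) => /=; first by rewrite subr_gt0.
move=> z; rewrite !ballEmdist /= => yz.
by rewrite (le_lt_trans (metric_triangle x y z))// -ltrBrDl.
Qed.

Lemma measurable_metric_ball (x : M) (r : R) :
  measurable (ball x r : set (borel M)).
Proof. by apply: sub_sigma_algebra; exact: open_metric_ball. Qed.

Hypothesis sepM : separable M.

Lemma separable_dense_seq : exists c : nat -> M,
  forall (x : M) (e : R), 0 < e -> exists n, mdist x (c n) < e.
Proof.
have [D /pcard_surjP [f surjf] dD] := sepM.
exists f => x e e0.
have [||z [xz Dz]] := dD (ball x e).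
- by exists x; exact: ballxx.
- exact: open_metric_ball.
have [n _ fn] := surjf _ Dz.
by exists n; rewrite fn; move: xz; rewrite ballEmdist.
Qed.

(** Measurability is for the product of the Borel sigma-algebras, so continuity alone is not enough.
    Separability writes [d(x, y) < r] as a countable union of products of balls with a common centre
    in the dense sequence and rational radii. *)
Lemma measurable_mdist :
  measurable_fun setT (fun z : borel M * borel M => mdist z.1 z.2).
Proof.
have [c cP] := separable_dense_seq.
apply: (measurability _ (RGenInftyO.measurableE R)) => _ [_ [r ->] <-].
rewrite setTI [X in measurable X](_ : _ = \bigcup_n \bigcup_(q : rat)
      ((ball (c n) (ratr q) : set (borel M)) `*`
       (ball (c n) (r - ratr q) : set (borel M)))).
  apply: bigcup_measurable => n _; apply: bigcupT_measurable_rat => q.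
  by apply: measurableX; exact: measurable_metric_ball.
apply/seteqP; split=> [[x y] /=|[x y] [n _ [q _ [/=]]]].
  rewrite in_itv /= => xy.
  have e0 : 0 < (r - mdist x y) / 2 by rewrite divr_gt0// subr_gt0.
  have [n hn] := cP x _ e0; exists n => //.
  have [q] := rat_in_itvoo hn; rewrite in_itv /= => /andP[q1 q2].
  exists q => //; split => /=; rewrite ballEmdist /=; first by rewrite metric_sym.
  have := metric_triangle (c n) x y; rewrite (metric_sym (c n) x).
  by move: q1 q2 hn; lra.
rewrite !ballEmdist /= => nx ny; rewrite in_itv /=.
have := metric_triangle x (c n) y; rewrite (metric_sym x (c n)).
by move: nx ny; lra.
Qed.

End metric_borel.

Section integral_restriction.
Context d (T : measurableType d) (R : realType).
Local Open Scope ereal_scope.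

Lemma ge0_integral_mrestr (m : {measure set T -> \bar R}) (D : set T)
    (mD : measurable D) (f : T -> \bar R) :
  (forall x, 0 <= f x) -> measurable_fun setT f ->
  \int[mrestr m mD]_x f x = \int[m]_(x in D) f x.
Proof.
move=> f0 mf; rewrite -[in LHS](setUv D) ge0_integral_setU//; last 3 first.
- exact: measurableC.
- by rewrite setUv.
- exact/disj_set2P/setICr.
rewrite [X in _ + X](_ : _ = 0) ?adde0; last first.
  rewrite (@eq_measure_integral _ _ _ _ mzero) ?integral_measure_zero//.
  move=> A mA AD; rewrite /= /mrestr /mzero.
  rewrite (_ : A `&` D = set0) ?measure0//.
  by rewrite -subset0 => z [/AD].
apply: eq_measure_integral => A mA AD.
by rewrite /= /mrestr; congr (m _); exact/setIidPl.
Qed.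

End integral_restriction.

Section kernel_mixture.
Context d d' (T : measurableType d) (S : measurableType d') (R : realType).
Variables (m : {finite_measure set T -> \bar R}) (k : R.-spker T ~> S).
Local Open Scope ereal_scope.

(** A measure seen as a kernel from a point, so that integration against a mixture becomes an
    instance of composition of kernels. *)
Definition constant_kernel (_ : unit) : {measure set T -> \bar R} := m.

Let measurable_constant_kernel U : measurable U ->
  measurable_fun setT (constant_kernel ^~ U).
Proof. by []. Qed.

HB.instance Definition _ :=
  isKernel.Build _ _ _ _ _ constant_kernel measurable_constant_kernel.

Let constant_kernel_uub : measure_fam_uub constant_kernel.
Proof.
exists (fine (m setT) + 1)%R => u; rewrite /constant_kernel EFinD fineK ?fin_num_measure//.
by rewrite lteDl ?fin_num_measure// lte01.
Qed.

HB.instance Definition _ :=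
  Kernel_isFinite.Build _ _ _ _ _ constant_kernel constant_kernel_uub.

Lemma integral_finite_mixture (nu : {measure set S -> \bar R}) (f : S -> \bar R) :
  (forall E, measurable E -> nu E = \int[m]_y k y E) ->
  (forall z, 0 <= f z) -> measurable_fun setT f ->
  \int[nu]_z f z = \int[m]_y \int[k y]_z f z.
Proof.
move=> nuE f0 mf.
rewrite (eq_measure_integral (kcomp constant_kernel (kernel.kernel_snd k) tt)).
  by rewrite integral_kcomp.
by move=> A mA _; rewrite nuE.
Qed.

End kernel_mixture.

Lemma integral_mixture d d' (T : measurableType d) (S : measurableType d')
    (R : realType) (m : {measure set T -> \bar R}) (k : R.-spker T ~> S)
    (nu : {measure set S -> \bar R}) (f : S -> \bar R) :
  (m setT < +oo)%E ->
  (forall E, measurable E -> nu E = \int[m]_y k y E)%E ->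
  (forall z, 0 <= f z)%E -> measurable_fun setT f ->
  (\int[nu]_z f z = \int[m]_y \int[k y]_z f z)%E.
Proof.
move=> moo nuE f0 mf.
pose m' : {finite_measure set T -> \bar R} := mfrestr measurableT moo.
have m'E (g : T -> \bar R) : (\int[m]_y g y = \int[m']_y g y)%E.
  by apply: eq_measure_integral => A mA _; rewrite /m' /= /mfrestr /mrestr setIT.
rewrite m'E; apply: integral_finite_mixture => // E mE.
by rewrite nuE// m'E.
Qed.

(** * The simple Markov property *)

Section one_point_borel.
Context {R : realType} {M : pmetricType R}.
Local Notation MD := (one_point_compactification M).

Lemma measurable_in_cpt (A : set (borel M)) : measurable A ->
  measurable (in_cpt A : set (borel MD)).
Proof.
move: A; apply: smallest_sub; last first.
  move=> A oA; apply: sub_sigma_algebra.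
  exact: one_point_compactification_open_some.
have mT : measurable (in_cpt setT : set (borel MD)).
  apply: sub_sigma_algebra; apply: one_point_compactification_open_some.
  exact: openT.
split.
- by rewrite /in_cpt image_set0.
- move=> A mA; rewrite [X in measurable X](_ : _ = in_cpt setT `\` in_cpt A).
    exact: measurableD.
  apply/seteqP; split=> [_ [z [_ Az] <-]|_ [[z _ <-] Az]].
    by split; [exists z|case=> y Ay [yz]; apply: Az; rewrite -yz].
  by exists z => //; split => // ?; apply: Az; exists z.
- by move=> F mF; rewrite /in_cpt image_bigcup; exact: bigcupT_measurable.
Qed.

Lemma measurable_None : measurable ([set None] : set (borel MD)).
Proof.
rewrite [X in measurable X](_ : _ = ~` in_cpt setT).
  by apply: measurableC; exact: measurable_in_cpt.
apply/seteqP; split=> [_ -> [z _]//|[z|//] h].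
by exfalso; apply: h; exists z.
Qed.

Lemma measurable_Some : measurable_fun setT (Some : borel M -> borel MD).
Proof.
apply: (measurability _ (erefl : @measurable _ (borel MD) = <<s open >>)).
move=> _ [A oA <-]; rewrite setTI; apply: sub_sigma_algebra.
by apply: open_comp => // z _; exact: one_point_compactification_some_continuous.
Qed.

Lemma measurable_fun_opc d' (S : measurableType d') (f : borel MD -> S) :
  measurable_fun setT (f \o Some : borel M -> S) -> measurable_fun setT f.
Proof.
move=> mf _ B mB; rewrite setTI.
rewrite [X in measurable X](_ : _ =
    in_cpt ((f \o Some) @^-1` B) `|` [set z | z = None /\ B (f None)]).
  apply: measurableU.
    by apply: measurable_in_cpt; rewrite -[X in measurable X]setTI; exact: mf.
  have [h|h] := pselect (B (f None)).
    rewrite [X in measurable X](_ : _ = [set None]); first exact: measurable_None.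
    by apply/seteqP; split => z /=; [case|move=> ->].
  rewrite [X in measurable X](_ : _ = set0)//.
  by rewrite -subset0 => z [].
apply/seteqP; split=> [[z|] /= h|z [[y By <-]//|[-> //]]].
- by left; exists z.
- by right.
Qed.

Lemma measurable_odflt (p : M) :
  measurable_fun setT (odflt p : borel MD -> borel M).
Proof. by apply: measurable_fun_opc; exact: measurable_id. Qed.

End one_point_borel.

Section markov_process.
Context {R : realType} {M : pmetricType R} {d : measure_display}
  {Omega : measurableType d} (X : hunt_process M Omega).
Local Notation MD := (one_point_compactification M).
Local Notation P := (start_law X).
Local Notation path := (sample_path X).
Local Notation filt := (natural_filtration path).

Lemma measurable_path (t : R) : 0 <= t ->
  measurable_fun setT (path t%:E : Omega -> borel MD).
Proof.
move=> t0 _ B mB; rewrite setTI; apply: path_measurable => //.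
Qed.

Lemma path_dead (w : Omega) (s t : R) : 0 <= s -> s <= t ->
  path s%:E w = None -> path t%:E w = None.
Proof.
move=> s0 st Xs; apply: path_cemetery; apply: (@le_trans _ _ s%:E).
  by apply: ereal_inf_lbound; exists s.
by rewrite lee_fin.
Qed.

Lemma path_alive (w : Omega) (s t : R) (z : M) : 0 <= s -> s <= t ->
  path t%:E w = Some z -> exists y, path s%:E w = Some y.
Proof.
move=> s0 st Xt; case: (path s%:E w) (@path_dead w s t s0 st) => [y|]; first by exists y.
by rewrite Xt => /(_ erefl).
Qed.

Lemma path_filtration_measurable (t : \bar R) (L : set Omega) :
  filt t L -> measurable L.
Proof.
move: L; apply: smallest_sub.
  split; first exact: measurable0.
  - by move=> A mA; rewrite setTD; exact: measurableC.
  - by move=> F mF; exact: bigcupT_measurable.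
move=> _ [s [B [s0 _ mB ->]]].
by apply: path_measurable.
Qed.

Lemma path_filtration_sigma (t : \bar R) : sigma_algebra setT (filt t).
Proof. exact: smallest_sigma_algebra. Qed.

Lemma path_filtrationI (t : \bar R) (A B : set Omega) :
  filt t A -> filt t B -> filt t (A `&` B).
Proof. exact: (@measurableI _ (g_sigma_algebraType (natural_gen path t))). Qed.

Lemma path_filtrationC (t : \bar R) (A : set Omega) :
  filt t A -> filt t (~` A).
Proof. exact: (@measurableC _ (g_sigma_algebraType (natural_gen path t))). Qed.

Lemma path_filtration_bigcap (t : \bar R) (F : (set Omega)^nat) :
  (forall n, filt t (F n)) -> filt t (\bigcap_n F n).
Proof.
exact: (@bigcapT_measurable _ (g_sigma_algebraType (natural_gen path t))).
Qed.

Lemma path_filtration_bigcup (t : \bar R) (F : (set Omega)^nat) :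
  (forall n, filt t (F n)) -> filt t (\bigcup_n F n).
Proof.
exact: (@bigcupT_measurable _ (g_sigma_algebraType (natural_gen path t))).
Qed.

Lemma path_filtrationT (t : \bar R) : filt t setT.
Proof. exact: (@measurableT _ (g_sigma_algebraType (natural_gen path t))). Qed.

Lemma path_filtration_le (s t : \bar R) (L : set Omega) : (s <= t)%E ->
  filt s L -> filt t L.
Proof.
move=> st; move: L; apply: smallest_sub; first exact: path_filtration_sigma.
move=> A [u [B [u0 us mB ->]]]; apply: sub_sigma_algebra.
by exists u, B; split => //; exact: le_trans st.
Qed.

Lemma path_filtration_path (s t : R) (B : set (borel MD)) : 0 <= s -> s <= t ->
  measurable B -> filt t%:E (path s%:E @^-1` B).
Proof.
move=> s0 st mB; apply: sub_sigma_algebra; exists s%:E, B.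
by split => //; rewrite lee_fin.
Qed.

Lemma law_start (x : MD) : {ae P x, forall w, path 0%E w = x}.
Proof.
have mX (y : MD) : measurable ([set y] : set (borel MD)).
  case: y => [y|]; last exact: measurable_None.
  rewrite [X in measurable X](_ : _ = in_cpt [set y]).
    apply: measurable_in_cpt; rewrite -[X in measurable X]setCK; apply: measurableC.
    apply: sub_sigma_algebra; apply: closed_openC.
    by apply: accessible_closed_set1; exact/hausdorff_accessible/metric_hausdorff.
  by apply/seteqP; split=> [_ ->|_ [z -> <-]//]; exists y.
have mE : measurable [set w | path 0%E w = x] by exact: path_measurable (mX x).
exists (~` [set w | path 0%E w = x]); split => //; first exact: measurableC.
by have := probability_setC (P x) mE; rewrite law_normal => ->; rewrite subee.
Qed.

Lemma law_None (t : R) (A : set (borel M)) : 0 <= t -> measurable A ->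
  P None (path t%:E @^-1` in_cpt A) = 0%E.
Proof.
move=> t0 mA.
have mE : measurable (path t%:E @^-1` in_cpt A).
  by apply: path_measurable => //; exact: measurable_in_cpt.
apply/(@negligibleP _ _ _ (P None) _ mE); apply: negligibleS (law_start None) => w [z _ Xt] X0.
by have := path_dead (lexx 0) t0 X0; rewrite -Xt.
Qed.

(** The process only provides measurability for starting points and targets in [M]. When [E]
    contains the cemetery, its probability is that of the part of [E] in [M] plus the complement of
    the probability of being in [M]. *)
Lemma measurable_law (t : R) (E : set (borel MD)) : 0 <= t -> measurable E ->
  measurable_fun setT (fun x : borel MD => P x (path t%:E @^-1` E)).
Proof.
move=> t0 mE; apply: measurable_fun_opc.
pose A : set (borel M) := Some @^-1` E.
have mA : measurable A.
  by rewrite -[X in measurable X]setTI; exact: measurable_Some.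
have mp (B : set (borel MD)) : measurable B -> measurable (path t%:E @^-1` B).
  by move=> mB; apply: path_measurable.
have mcA := mp _ (measurable_in_cpt mA).
have mcT := mp _ (@measurable_in_cpt _ M setT measurableT).
have mlA := law_measurable X t0 mA.
have mlT := law_measurable X t0 (@measurableT _ (borel M)).
have [EN|EN] := pselect (E None).
  have -> : (fun x : borel MD => P x (path t%:E @^-1` E)) \o Some =
      (fun x : borel M => P (Some x) (path t%:E @^-1` in_cpt A) +
        (1 - P (Some x) (path t%:E @^-1` in_cpt setT)))%E.
    apply/funext => x /=.
    rewrite -(probability_setC _ mcT) -measureU//; last 2 first.
    - exact: measurableC.
    - by rewrite -subset0 => w [[z Az Xt]] /=; apply; exists z.
    congr (P _ _); apply/seteqP; split=> w /=.
      case Xt : (path t%:E w) => [z|] Ez; first by left; exists z.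
      by right => -[z _].
    case=> [[z Az <-] //|]; case: (path t%:E w) => // z; case.
    by exists z.
  apply: emeasurable_funD => //; apply: emeasurable_funB => //.
have -> : (fun x : borel MD => P x (path t%:E @^-1` E)) \o Some =
    (fun x : borel M => P (Some x) (path t%:E @^-1` in_cpt A)) => //.
apply/funext => x /=; congr (P _ _); apply/seteqP; split=> w /=.
  by case: (path t%:E w) => [z|//] Ez; exists z.
by case=> z Az <-.
Qed.

End markov_process.

Section path_kernel.
Context {R : realType} {M : pmetricType R} {d : measure_display}
  {Omega : measurableType d} (X : hunt_process M Omega) (t : R).
Local Notation MD := (one_point_compactification M).
Local Notation P := (start_law X).
Local Notation path := (sample_path X).
Local Open Scope ereal_scope.

(* The absolute value only makes the kernel total in [t]. *)
Definition path_kernel (x : borel MD) (E : set (borel MD)) : \bar R :=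
  P x (path `|t|%R%:E @^-1` E).

Let mpath (E : set (borel MD)) : measurable E -> measurable (path `|t|%R%:E @^-1` E).
Proof. by move=> mE; apply: path_measurable. Qed.

Let path_kernel0 x : path_kernel x set0 = 0.
Proof. by rewrite /path_kernel preimage_set0 measure0. Qed.

Let path_kernel_ge0 x E : 0 <= path_kernel x E.
Proof. exact: measure_ge0. Qed.

Let path_kernel_sigma_additive x : semi_sigma_additive (path_kernel x).
Proof.
move=> F mF tF mUF; rewrite /path_kernel preimage_bigcup.
apply: measure_semi_sigma_additive.
- by move=> n; exact: mpath.
- apply/trivIsetP => i j _ _ ij; rewrite -preimage_setI.
  by move/trivIsetP : tF => /(_ _ _ _ _ ij) ->//; rewrite preimage_set0.
- by rewrite -preimage_bigcup; exact: mpath.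
Qed.

HB.instance Definition _ x := isMeasure.Build _ _ _ (path_kernel x)
  (path_kernel0 x) (path_kernel_ge0 x) (@path_kernel_sigma_additive x).

Let path_kernel_measure (x : borel MD) : {measure set (borel MD) -> \bar R} :=
  path_kernel x.

Let measurable_path_kernel E : measurable E ->
  measurable_fun setT (path_kernel_measure ^~ E).
Proof. by move=> mE; apply: measurable_law. Qed.

HB.instance Definition _ := isKernel.Build _ _ _ _ _ path_kernel_measure
  measurable_path_kernel.

Let path_kernel_prob x : path_kernel_measure x setT = 1.
Proof. by rewrite /path_kernel_measure /= /path_kernel preimage_setT probability_setT. Qed.

HB.instance Definition _ := Kernel_isProbability.Build _ _ _ _ _
  path_kernel_measure path_kernel_prob.

Definition path_pkernel : R.-pker (borel MD) ~> (borel MD) := path_kernel_measure.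

End path_kernel.

Section markov_integral.
Context {R : realType} {M : pmetricType R} {d : measure_display}
  {Omega : measurableType d} (X : hunt_process M Omega).
Local Notation MD := (one_point_compactification M).
Local Notation P := (start_law X).
Local Notation path := (sample_path X).
Local Notation filt := (natural_filtration path).
Local Open Scope ereal_scope.

Lemma integral_path_kernel (t : R) (x : borel MD) (f : borel MD -> \bar R) :
  (0 <= t)%R -> (forall z, 0 <= f z) -> measurable_fun setT f ->
  \int[path_pkernel X t x]_z f z = \int[P x]_w f (path t%:E w).
Proof.
move=> t0 f0 mf.
have mX := @measurable_path _ _ _ _ X t t0.
transitivity (\int[pushforward (P x) (path t%:E : Omega -> borel MD)]_z f z).
  by apply: eq_measure_integral => A mA _; rewrite /= /path_kernel ger0_norm.
by rewrite ge0_integral_pushforward// preimage_setT.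
Qed.

Lemma measurable_integral_path (t : R) (f : borel MD -> \bar R) :
  (0 <= t)%R -> (forall z, 0 <= f z) -> measurable_fun setT f ->
  measurable_fun setT (fun x : borel MD => \int[P x]_w f (path t%:E w)).
Proof.
move=> t0 f0 mf.
rewrite (_ : (fun _ => _) = fun x => \int[path_pkernel X t x]_z f z).
  apply: measurable_fun_integral_kernel => // U mU.
  exact: measurable_kernel.
by apply/funext => x; rewrite integral_path_kernel.
Qed.

(** On [L], the Markov property for sets says that the law of [X_(t + s)] is the mixture of the
    kernels [path_pkernel X s] by the law of [X_t]; integrals against a mixture are iterated
    integrals. *)
Lemma markov_integral (x : MD) (s t : R) (L : set Omega) (f : borel MD -> \bar R) :
  (0 <= s)%R -> (0 <= t)%R -> filt t%:E L ->
  (forall z, 0 <= f z) -> measurable_fun setT f ->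
  \int[P x]_(w in L) f (path (t + s)%:E w) =
  \int[P x]_(w in L) \int[P (path t%:E w)]_v f (path s%:E v).
Proof.
move=> s0 t0 FL f0 mf.
have ts0 : (0 <= t + s)%R by exact: addr_ge0.
have mL := path_filtration_measurable FL.
have mXt := @measurable_path _ _ _ _ X t t0.
have mXts := @measurable_path _ _ _ _ X _ ts0.
have mg := measurable_integral_path s0 f0 mf.
have g0 z : 0 <= \int[P z]_v f (path s%:E v) by apply: integral_ge0.
rewrite -(@ge0_integral_mrestr _ _ _ _ _ mL (fun w => f (path (t + s)%:E w)))//; last first.
  exact: measurableT_comp mf mXts.
rewrite -(@ge0_integral_mrestr _ _ _ _ _ mL
  (fun w => \int[P (path t%:E w)]_v f (path s%:E v)))//; last first.
  exact: measurableT_comp mg mXt.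
pose m0 : {measure set (borel MD) -> \bar R} :=
  pushforward (mrestr (P x) mL) (path t%:E : Omega -> borel MD).
pose nu0 : {measure set (borel MD) -> \bar R} :=
  pushforward (mrestr (P x) mL) (path (t + s)%:E : Omega -> borel MD).
pose m := m0 mXt.
transitivity (\int[m]_y \int[P y]_v f (path s%:E v)); last first.
  by rewrite ge0_integral_pushforward// preimage_setT.
transitivity (\int[m]_y \int[path_pkernel X s y]_z f z); last first.
  by apply: eq_integral => y _; rewrite integral_path_kernel.
rewrite -(integral_mixture (nu := nu0 mXts))//.
- by rewrite ge0_integral_pushforward// preimage_setT.
- rewrite /m /m0 /= /pushforward /mrestr /= preimage_setT setTI.
  exact: (le_lt_trans (probability_le1 _ mL) (ltry _)).
- move=> E mE; rewrite /m /m0 ge0_integral_pushforward//; last first.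
    exact: measurable_kernel.
  rewrite preimage_setT ge0_integral_mrestr//; last first.
    exact: measurableT_comp (measurable_kernel (path_pkernel X s) _ mE) mXt.
  rewrite /= /pushforward /mrestr setIC.
  have -> := @path_markov _ _ _ _ X x s t E L s0 t0 mE FL.
  by apply: eq_integral => w _; rewrite /= /path_kernel ger0_norm.
Qed.

End markov_integral.

Section markovian_events.
Context {R : realType} {M : pmetricType R} {d : measure_display}
  {Omega : measurableType d} (X : hunt_process M Omega).
Local Notation MD := (one_point_compactification M).
Local Notation P := (start_law X).
Local Notation path := (sample_path X).
Local Notation filt := (natural_filtration path).

(* [C t] stands for the event [C 0] shifted by the time [t]. *)
Definition markovian (C : R -> set Omega) :=
  [/\ forall t, 0 <= t -> measurable (C t),
    measurable_fun setT (fun y : borel MD => P y (C 0%R)) &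
    forall x t L, 0 <= t -> filt t%:E L ->
      (P x (L `&` C t) = \int[P x]_(w in L) P (path t%:E w) (C 0%R))%E].

Lemma markovian_path (C : R -> set Omega) (t : R) : 0 <= t -> markovian C ->
  measurable_fun setT (fun w => P (path t%:E w) (C 0%R)).
Proof.
by move=> t0 [_ mC _]; exact: (measurableT_comp mC (measurable_path X t0)).
Qed.

Lemma markovianC (C : R -> set Omega) : markovian C ->
  markovian (fun t => ~` C t).
Proof.
move=> mkC; have [mC mPC PC] := mkC; split.
- by move=> t t0; apply: measurableC; exact: mC.
- rewrite (_ : (fun _ => _) = fun y : borel MD => (1 - P y (C 0%R))%E).
    exact: emeasurable_funB.
  by apply/funext => y; rewrite probability_setC//; exact: mC.
move=> x t L t0 FL; have mL := path_filtration_measurable FL.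
rewrite -setDE measureD//; last 2 first.
- exact: mC.
- by rewrite (le_lt_trans (probability_le1 _ mL))// ltry.
transitivity (P x L - \int[P x]_(w in L) P (path t%:E w) (C 0%R))%E.
  by congr (_ - _)%E; exact: PC.
transitivity (\int[P x]_(w in L) (1 - P (path t%:E w) (C 0%R)))%E; last first.
  by apply: eq_integral => w _; rewrite probability_setC//; exact: mC.
rewrite integralB//.
- by rewrite integral_cst// mul1e.
- exact: finite_measure_integrable_cst.
- apply: (@le_integrable _ _ _ (P x) L mL _ (EFin \o cst 1)).
  + by apply: measurable_funTS; exact: markovian_path.
  + move=> w _ /=; rewrite gee0_abs// normr1.
    by apply: probability_le1; exact: mC.
  + exact: finite_measure_integrable_cst.
Qed.

(** The identity is a limit of identities: continuity from above on the left, dominated convergence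
    on the right. Both rest on the sequence being nonincreasing. *)
Lemma markovian_bigcap (C : nat -> R -> set Omega) :
  (forall t, 0 <= t -> nonincreasing_seq (C ^~ t)) ->
  (forall n, markovian (C n)) -> markovian (fun t => \bigcap_n C n t).
Proof.
move=> ndC mkC.
have mC n t : 0 <= t -> measurable (C n t) by have [h _ _] := mkC n; exact: h.
have mI t : 0 <= t -> measurable (\bigcap_n C n t).
  by move=> t0; apply: bigcapT_measurable => n; exact: mC.
have cvgP (y : MD) (t : R) (L : set Omega) : 0 <= t -> measurable L ->
    P y (L `&` C n t) @[n --> \oo] --> P y (L `&` \bigcap_n C n t).
  move=> t0 mL; have -> : L `&` \bigcap_n C n t = \bigcap_n (L `&` C n t).
    apply/seteqP; split=> w /=; first by case=> Lw Cw n _; split => //; exact: Cw.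
    by move=> h; split; [have [] := h 0%N I|move=> n _; have [] := h n I].
  apply: nonincreasing_cvg_mu.
  - by rewrite (le_lt_trans (probability_le1 _ _)) ?ltry//; apply: measurableI => //; exact: mC.
  - by move=> n; apply: measurableI => //; exact: mC.
  - by apply: bigcapT_measurable => n; apply: measurableI => //; exact: mC.
  - move=> m n mn; apply/subsetPset; apply: setIS.
    by apply/subsetPset; exact: ndC.
have cvgPT (y : MD) : P y (C n 0%R) @[n --> \oo] --> P y (\bigcap_n C n 0%R).
  have := cvgP y 0 setT (lexx _) measurableT; rewrite setTI.
  by under eq_fun do rewrite setTI.
have mPI : measurable_fun setT (fun y : borel MD => P y (\bigcap_n C n 0%R)).
  apply: (emeasurable_fun_cvg (fun n (y : borel MD) => P y (C n 0%R))).
    by move=> n; have [] := mkC n.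
  by move=> y _; exact: cvgPT.
split => //.
move=> x t L t0 FL; have mL := path_filtration_measurable FL.
have h1 := cvgP x t L t0 mL.
have h2 : (\int[P x]_(w in L) P (path t%:E w) (C n 0%R))%E @[n --> \oo] -->
    (\int[P x]_(w in L) P (path t%:E w) (\bigcap_n C n 0%R))%E.
  have [] // := @dominated_convergence _ Omega R (P x) L mL
    (fun n w => P (path t%:E w) (C n 0%R))
    (fun w => P (path t%:E w) (\bigcap_n C n 0%R)) (cst 1%E).
  - by move=> n; apply: measurable_funTS; exact: markovian_path.
  - apply: measurable_funTS.
    exact: (measurableT_comp mPI (measurable_path X t0)).
  - by apply: aeW => w _; exact: cvgPT.
  - exact: finite_measure_integrable_cst.
  - apply: aeW => w n _; rewrite gee0_abs//.
    by apply: probability_le1; exact: mC.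
have h3 n : P x (L `&` C n t) = (\int[P x]_(w in L) P (path t%:E w) (C n 0%R))%E.
  by have [_ _] := mkC n; exact.
have E : (fun n => P x (L `&` C n t)) =
    (fun n => \int[P x]_(w in L) P (path t%:E w) (C n 0%R))%E.
  by apply/funext => n; exact: h3.
rewrite E in h1; exact: cvg_unique h1 h2.
Qed.

(** The initial time [t] is not tested, since conditions there belong to the past event [L]. The
    target may vary with the grid time so that the last one can be a prescribed set. *)
Definition grid_event (h : R) (B : nat -> set MD) (m : nat) (t : R) : set Omega :=
  [set w | forall j, (j < m)%N -> B j (path (t + j.+1%:R * h)%:E w)].

Lemma grid_event0 h B t : grid_event h B 0 t = setT.
Proof. exact/seteqP. Qed.

Lemma grid_eventS h B m t : grid_event h B m.+1 t =
  path (t + h)%:E @^-1` B 0%N `&` grid_event h (B \o S) m (t + h).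
Proof.
have tE j : t + h + j.+1%:R * h = t + j.+2%:R * h by rewrite -[in RHS]natr1; ring.
apply/seteqP; split=> w /=.
  move=> hw; split; first by have := hw 0%N erefl; rewrite mul1r.
  by move=> j jm; rewrite tE; exact: (hw j.+1).
by case=> h0 hS [|j] jm; [rewrite mul1r|rewrite -tE; exact: hS].
Qed.

Lemma grid_event_filtration h B m t T : 0 <= h -> 0 <= t -> t + m%:R * h <= T ->
  (forall j, measurable (B j : set (borel MD))) ->
  filt T%:E (grid_event h B m t).
Proof.
move=> h0 t0 tT mB; elim: m B t t0 tT mB => [|m IH] B t t0 tT mB.
  by rewrite grid_event0; exact: path_filtrationT.
have mh : 0 <= m%:R * h by rewrite mulr_ge0.
move: tT; rewrite -natr1 mulrDl mul1r => tT.
rewrite grid_eventS; apply: path_filtrationI.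
  by apply: path_filtration_path; rewrite ?addr_ge0//; lra.
apply: IH; rewrite ?addr_ge0//; first by lra.
by move=> j; exact: mB.
Qed.

(** Induction on the number of times: the induction hypothesis at [t + h] handles all times but the
    first, leaving an integral of a function of [X_(t + h)], to which [markov_integral] applies at
    [t]. *)
Lemma grid_event_markovian h B m : 0 <= h ->
  (forall j, measurable (B j : set (borel MD))) -> markovian (grid_event h B m).
Proof.
move=> h0; elim: m B => [|m IH] B mB.
  rewrite (_ : grid_event h B 0 = fun=> setT); last first.
    by apply/funext => t; rewrite grid_event0.
  split=> //.
  - rewrite (_ : (fun _ => _) = cst 1%E)//.
    by apply/funext => y; exact: probability_setT.
  - move=> x t L t0 FL; have mL := path_filtration_measurable FL.
    rewrite setIT (eq_integral (cst 1%E)); last first.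
      by move=> w _; rewrite probability_setT.
    by rewrite integral_cst// mul1e.
have mB' j : measurable ((B \o S) j : set (borel MD)) by exact: mB.
have [mC mPC PC] := IH (B \o S) mB'.
pose C := grid_event h (B \o S) m.
pose f (y : borel MD) : \bar R := (P y (C 0%R) * (\1_(B 0%N) y)%:E)%E.
have f0 y : (0 <= f y)%E by rewrite mule_ge0// lee_fin.
have mf : measurable_fun setT f.
  apply: emeasurable_funM => //; apply/measurable_EFinP.
  exact: measurable_indic.
have key x t L : 0 <= t -> filt t%:E L -> (P x (L `&` grid_event h B m.+1 t) =
    \int[P x]_(w in L) \int[P (path t%:E w)]_v f (path h%:E v))%E.
  move=> t0 FL; have th0 : 0 <= t + h by rewrite addr_ge0.
  have mL := path_filtration_measurable FL.
  rewrite grid_eventS setIA PC//; last first.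
    apply: path_filtrationI.
      by apply: path_filtration_le FL; rewrite lee_fin lerDl.
    exact: path_filtration_path.
  rewrite -markov_integral// integral_mkcondr; apply: eq_integral => w _.
  rewrite /f patchE indicE.
  have -> : (w \in path (t + h)%:E @^-1` B 0%N) = (path (t + h)%:E w \in B 0%N).
    by apply/idP/idP; rewrite !inE.
  by case: ifPn => _; rewrite ?mule1 ?mule0.
have keyP (y : MD) : (P y (grid_event h B m.+1 0) = \int[P y]_v f (path h%:E v))%E.
  have := key y 0 setT (lexx _) (@path_filtrationT _ _ _ _ X _).
  by rewrite setTI => ->; rewrite -markov_integral ?add0r//; exact: path_filtrationT.
split.
- move=> t t0; apply: (@path_filtration_measurable _ _ _ _ X (t + m.+1%:R * h)%:E).
  exact: grid_event_filtration.
- rewrite (_ : (fun _ => _) = fun y : borel MD => \int[P y]_v f (path h%:E v))%E.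
    exact: measurable_integral_path.
  by apply/funext => y; exact: keyP.
- move=> x t L t0 FL; rewrite key//.
  by apply: eq_integral => w _; rewrite -keyP.
Qed.

End markovian_events.

(** The first point of a fine enough grid strictly after [s] has index [truncn (s / h) + 1] and lies
    within [h] of [s]; [s < T] keeps it in the grid. This is how a countable grid controls a
    right-continuous path. *)
Lemma dyadic_near (R : realType) (t0 T s : R) (Q : R -> Prop) :
  0 < T -> 0 <= s -> s < T -> (\forall u \near (t0 + s)^'+, Q u) ->
  exists n j : nat, (j < 2 ^ n)%N /\ Q (t0 + j.+1%:R * (T / 2 ^+ n)).
Proof.
move=> T0 s0 sT /nbhs_ballP[e /= e0 he].
have [n hn] : exists n : nat, T / 2 ^+ n < e.
  exists (Num.truncn (T / e)).+1.
  rewrite ltr_pdivrMr ?exprn_gt0// mulrC -ltr_pdivrMr//.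
  rewrite (lt_trans (truncnS_gt _))// -natrX ltr_nat.
  exact: ltn_expl.
pose h := T / 2 ^+ n.
have h0 : 0 < h by rewrite divr_gt0 ?exprn_gt0.
have sh0 : 0 <= s / h by rewrite divr_ge0// ltW.
have /andP[j1 j2] := truncn_itv sh0.
exists n, (Num.truncn (s / h)); split.
  rewrite -(ltr_nat R) (le_lt_trans j1)// ltr_pdivrMr// natrX.
  by rewrite /h mulrC divfK// gt_eqF// exprn_gt0.
rewrite -/h; move: j1 j2; rewrite ler_pdivlMr// ltr_pdivrMr// => j1 j2.
apply: he => /=; last by rewrite ltrD2l.
rewrite /ball /= ltr_norml; move: hn j1 j2; rewrite -/h -natr1.
set q := _%:R; move=> hn j1 j2; apply/andP; split; nra.
Qed.

(** * Localization of the transition function *)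

Section path_events.
Context {R : realType} {M : pmetricType R} {d : measure_display}
  {Omega : measurableType d} (X : hunt_process M Omega).
Local Notation MD := (one_point_compactification M).
Local Notation P := (start_law X).
Local Notation path := (sample_path X).
Local Notation filt := (natural_filtration path).

Lemma cprob_measurable (x : M) (S : set Omega) : measurable S ->
  cprob X x S = P (Some x) S.
Proof. by move=> mS; exact: measurable_mu_extE. Qed.

Lemma le_cprob (x : M) (S S' : set Omega) : S `<=` S' ->
  (cprob X x S <= cprob X x S')%E.
Proof. by move=> SS'; exact: le_mu_ext. Qed.

Lemma path_right_ball (w : Omega) (t e : R) (z : M) : 0 <= t -> 0 < e ->
  path t%:E w = Some z ->
  \forall u \near t^'+, in_cpt (ball z e) (path u%:E w).
Proof.
move=> t0 e0 Xt; have := @path_right_continuous _ _ _ _ X w t t0; rewrite Xt.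
move=> h; apply: (h (in_cpt (ball z e))).
by apply: one_point_compactification_some_nbhs; exact: nbhsx_ballx.
Qed.

Lemma in_cpt_ballP (y : M) (r : R) (a : MD) :
  in_cpt (ball y r) a <-> exists2 z, a = Some z & mdist y z < r.
Proof.
by split=> [[z]|[z -> h]]; [rewrite ballEmdist => h <-; exists z|exists z; rewrite // ballEmdist].
Qed.

(** The end point of the grid shows that the path is still alive. If it were at distance at least
    [rho'] from [y] at some time, it would by right continuity be outside the ball of radius [rho]
    at a grid time just after. Limits from the right only give the closed ball, whence the loss from
    [rho] to [rho']. *)
Lemma path_in_ball_dyadic (w : Omega) (t0 T : R) (y : M) (rho : R) :
  0 <= t0 -> 0 < T ->
  (forall n j, (j < 2 ^ n)%N ->
    in_cpt (ball y rho) (path (t0 + j.+1%:R * (T / 2 ^+ n))%:E w)) ->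
  forall s rho', 0 <= s -> s < T -> rho < rho' ->
    in_cpt (ball y rho') (path (t0 + s)%:E w).
Proof.
move=> t00 T0 hw s rho' s0 sT rr.
have ts0 : 0 <= t0 + s by rewrite addr_ge0.
have [zT XT _] : exists2 z, path (t0 + T)%:E w = Some z & mdist y z < rho.
  apply/in_cpt_ballP; have := hw 0%N 0%N erefl.
  by rewrite expr0 divr1 mul1r.
have [z Xs] : exists z, path (t0 + s)%:E w = Some z.
  by apply: path_alive XT; rewrite ?lerD2l// ltW.
apply/in_cpt_ballP; exists z => //; rewrite ltNge; apply/negP => yz.
have e0 : 0 < mdist y z - rho by lra.
have [n [j [jn]]] := dyadic_near T0 s0 sT (path_right_ball ts0 e0 Xs).
have /in_cpt_ballP[a -> ya] := hw n j jn.
move=> /in_cpt_ballP[_ [<-] za].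
by have := metric_triangle y a z; rewrite (metric_sym a z); lra.
Qed.

(* The index [2 ^ n - 1] is the end point [t + T] of the [n]-th dyadic grid. *)
Definition dyadic_event (B A : set M) (T t : R) : set Omega :=
  \bigcap_n grid_event X (T / 2 ^+ n)
    (fun j => in_cpt (if j == (2 ^ n).-1 then A else B)) (2 ^ n) t.

Lemma dyadic_eventP (B A : set M) (T t : R) (w : Omega) : A `<=` B ->
  dyadic_event B A T t w <->
  (forall n j, (j < 2 ^ n)%N ->
    in_cpt B (path (t + j.+1%:R * (T / 2 ^+ n))%:E w)) /\
  in_cpt A (path (t + T)%:E w).
Proof.
move=> AB; split.
  move=> h; split=> [n j jn|].
    have := h n I j jn; case: ifP => // _ [z Az <-].
    by exists z => //; exact: AB.
  by have := h 0%N I 0%N erefl; rewrite expr0 divr1 mul1r.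
move=> [h hA] n _ j jn; case: ifPn => [/eqP jE|_]; last exact: h.
have -> : t + j.+1%:R * (T / 2 ^+ n) = t + T => //.
rewrite jE prednK ?expn_gt0// natrX; congr (_ + _).
by rewrite mulrC divfK// gt_eqF// exprn_gt0.
Qed.

Lemma measurable_in_cpt_if (b : bool) (A B : set (borel M)) :
  measurable A -> measurable B ->
  measurable (in_cpt (if b then A else B) : set (borel MD)).
Proof. by case: b => mA mB; exact: measurable_in_cpt. Qed.

Lemma dyadic_event_filtration (B A : set (borel M)) (T t : R) :
  measurable B -> measurable A -> 0 <= T -> 0 <= t ->
  filt (t + T)%:E (dyadic_event B A T t).
Proof.
move=> mB mA T0 t0; apply: path_filtration_bigcap => n.
apply: grid_event_filtration => //.
- by rewrite divr_ge0// exprn_ge0.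
- by rewrite natrX mulrC divfK// gt_eqF// exprn_gt0.
- by move=> j; exact: measurable_in_cpt_if.
Qed.

Lemma dyadic_event_markovian (B A : set (borel M)) (T : R) :
  measurable B -> measurable A -> 0 <= T ->
  markovian X (dyadic_event B A T).
Proof.
move=> mB mA T0; apply: markovian_bigcap => [t t0|n].
  apply/nonincreasing_seqP => n; apply/subsetPset => w /= h j jn.
  (* Index [j] stands for the grid time of rank [j + 1], so in the refined grid it becomes
     [2 * j + 1]. This also sends the last index to the last index, hence the target [A] to [A]. *)
  have E : t + j.+1%:R * (T / 2 ^+ n) = t + (j.*2.+1).+1%:R * (T / 2 ^+ n.+1).
    rewrite -doubleS -muln2 natrM exprSr; field.
    by rewrite gt_eqF// exprn_gt0.
  have jn2 : (j.*2.+1 < 2 ^ n.+1)%N.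
    by rewrite expnS mul2n -doubleS leq_double.
  have := h j.*2.+1 jn2; rewrite -E.
  suff -> : (j.*2.+1 == (2 ^ n.+1).-1) = (j == (2 ^ n).-1) by [].
  have n0 : (0 < 2 ^ n)%N by rewrite expn_gt0.
  rewrite -(prednK n0) /= expnS mul2n -(prednK n0) doubleS /=.
  by rewrite eqSS -!muln2 eqn_mul2r.
apply: grid_event_markovian; first by rewrite divr_ge0// exprn_ge0.
by move=> j; exact: measurable_in_cpt_if.
Qed.

Lemma dyadic_event_measurable (B A : set (borel M)) (T t : R) :
  measurable B -> measurable A -> 0 <= T -> 0 <= t ->
  measurable (dyadic_event B A T t).
Proof.
move=> mB mA T0 t0.
exact: path_filtration_measurable (dyadic_event_filtration mB mA T0 t0).
Qed.

(** On the grid event the path stays in the larger ball on the whole interval, so the exit from that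
    ball comes after [T]. This bounds a grid event by the killed transition function. *)
Lemma dyadic_event_killed (z y : M) (A : set (borel M)) (rho rho' T : R) :
  measurable A -> A `<=` ball y rho -> rho < rho' -> 0 < T ->
  (P (Some z) (dyadic_event (ball y rho) A T 0) <=
   killed_transition X (ball y rho') T z A)%E.
Proof.
move=> mA Ay rr T0.
have mB : measurable (ball y rho : set (borel M)) by exact: measurable_metric_ball.
rewrite -cprob_measurable; last by apply: dyadic_event_measurable => //; exact: ltW.
apply: le_cprob => w /(dyadic_eventP _ _ _ Ay)[hw]; rewrite add0r => XT.
split => //.
have [a Aa XTa] := XT.
have ya : mdist y a < rho by have := Ay _ Aa; rewrite ballEmdist.
(* The inequality [T < exit_time] is strict: right continuity at [T] must keep the path in the ball
   for a further time [e]. *)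
have e0 : 0 < rho' - mdist y a by lra.
have := path_right_ball (ltW T0) e0 (esym XTa).
move=> /nbhs_ballP[e /= e_gt0 he].
apply: (@lt_le_trans _ _ (T + e)%:E); first by rewrite lte_fin ltrDl.
apply: le_ereal_inf_tmp => _ [u [u0 Xu] <-]; rewrite lee_fin leNgt; apply/negP => uTe.
apply: Xu; case: (ltgtP u T) => [uT|Tu|->].
- by have := path_in_ball_dyadic (lexx 0) T0 hw u0 uT rr; rewrite add0r.
- have [|//|b -> ab] := (in_cpt_ballP _ _ _).1 (he u _ _).
    by rewrite /ball /= ltr_norml; apply/andP; split; lra.
  apply/in_cpt_ballP; exists b => //.
  by have := metric_triangle y a b; lra.
- rewrite -XTa; apply/in_cpt_ballP; exists a => //; lra.
Qed.

(** The comparison in the other direction: a path that misses [B] at a grid time has left the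
    smaller ball by then, so failure of the grid event inherits the exit bound. *)
Lemma dyadic_event_exit (z : M) (B : set (borel M)) (r T : R) :
  measurable B -> ball z r `<=` B -> 0 <= T ->
  (P (Some z) (~` dyadic_event B B T 0) <=
   cprob X z [set w | (exit_time X (ball z r) w <= T%:E)%E])%E.
Proof.
move=> mB zB T0.
rewrite -cprob_measurable; last first.
  by apply: measurableC; exact: dyadic_event_measurable.
apply: le_cprob => w; apply: contra_notP => h.
apply/dyadic_eventP => //.
have Xu u : 0 <= u -> u <= T -> in_cpt B (path u%:E w).
  move=> u0 uT; apply: contra_notP h => Xu; apply: (@le_trans _ _ u%:E); last by rewrite lee_fin.
  apply: ereal_inf_lbound; exists u => //; split => // -[a za XE].
  by apply: Xu; rewrite -XE; exists a => //; exact: zB.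
split=> [n j jn|]; rewrite add0r; apply: Xu => //.
- by rewrite mulr_ge0 ?divr_ge0 ?exprn_ge0.
- rewrite mulrA ler_pdivrMr ?exprn_gt0// mulrC ler_wpM2l//.
  by rewrite -natrX ler_nat.
Qed.

End path_events.

Section dyadic_localization.
Context {R : realType} {M : pmetricType R} {d : measure_display}
  {Omega : measurableType d} (X : hunt_process M Omega).
Local Notation MD := (one_point_compactification M).
Local Notation P := (start_law X).
Local Notation path := (sample_path X).
Local Notation filt := (natural_filtration path).
Variables (N : set (borel M)) (x : M).
Hypothesis sepM : separable M.
Hypothesis pathN : {ae P (Some x), forall w, forall t : R, 0 <= t ->
  ~ in_cpt N (path t%:E w)}.

(** Almost surely [X_t] avoids [N], so the bound on [f] is required only off [N]. *)
Lemma le_integral_path (t : R) (L : set Omega) (B : set M) (f : MD -> \bar R)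
    (c : \bar R) : 0 <= t -> measurable L -> L `<=` path t%:E @^-1` in_cpt B ->
  measurable_fun setT (f : borel MD -> \bar R) -> (forall y, 0 <= f y)%E ->
  (0 <= c)%E -> (forall z, ~ N z -> B z -> f (Some z) <= c)%E ->
  (\int[P (Some x)]_(w in L) f (path t%:E w) <= c * P (Some x) L)%E.
Proof.
move=> t0 mL LB mf f0 c0 fc; rewrite -integral_cst//.
apply: ae_ge0_le_integral => //.
- apply: measurable_funTS; exact: measurableT_comp mf (measurable_path X t0).
- apply: filterS pathN => w Nw /LB [z Bz Xt]; rewrite -Xt; apply: fc => //.
  by move=> Nz; apply: (Nw t t0); rewrite -Xt; exists z.
Qed.

(* The start point [X_t] is first localized to small disjoint cells, so that
   the ball to be left does not depend on it. *)
Lemma exit_cover (eta r T t e : R) :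
  0 < eta -> 0 < T -> 0 <= t -> 0 <= e ->
  (forall z, ~ N z ->
    cprob X z [set w | (exit_time X (ball z r) w <= T%:E)%E] <= e%:E)%E ->
  exists E : set Omega,
    [/\ filt (t + T)%:E E, (P (Some x) E <= e%:E)%E &
     forall w y, path t%:E w = Some y -> exists c : M, mdist y c < eta /\
       (E w \/ forall n j, (j < 2 ^ n)%N ->
         in_cpt (ball c (r + eta)) (path (t + j.+1%:R * (T / 2 ^+ n))%:E w))].
Proof.
move=> eta0 T0 t0 e0 he.
have [c cP] := separable_dense_seq sepM.
pose C := seqDU (fun n => ball (c n) eta : set (borel M)).
have mC n : measurable (C n : set (borel M)).
  apply: measurableD; first exact: measurable_metric_ball.
  by apply: bigsetU_measurable => i _; exact: measurable_metric_ball.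
(* The radius [r + eta] makes this ball contain [ball z r] for every [z] in the cell [C n]. *)
pose H n := dyadic_event X (ball (c n) (r + eta)) (ball (c n) (r + eta)) T.
have mball n : measurable (ball (c n) (r + eta) : set (borel M)).
  exact: measurable_metric_ball.
have mkH n : markovian X (fun t => ~` H n t).
  by apply: markovianC; apply: dyadic_event_markovian => //; exact: ltW.
pose E n := path t%:E @^-1` in_cpt (C n) `&` ~` H n t.
have FC n : filt t%:E (path t%:E @^-1` in_cpt (C n)).
  by apply: path_filtration_path => //; exact: measurable_in_cpt.
have mXC n : measurable (path t%:E @^-1` in_cpt (C n)).
  exact: path_filtration_measurable (FC n).
have FE n : filt (t + T)%:E (E n).
  apply: path_filtrationI.
    by apply: path_filtration_le (FC n); rewrite lee_fin lerDl ltW.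
  by apply: path_filtrationC; apply: dyadic_event_filtration => //; exact: ltW.
exists (\bigcup_n E n); split; first exact: path_filtration_bigcup.
- have mE n : measurable (E n) by exact: path_filtration_measurable (FE n).
  apply: (@le_trans _ _ (\sum_(n <oo) P (Some x) (E n))%E).
    apply: measure_sigma_subadditive => //.
    by apply: bigcupT_measurable.
  apply: (@le_trans _ _ (\sum_(n <oo) e%:E * P (Some x) (path t%:E @^-1` in_cpt (C n)))%E).
    apply: lee_nneseries => // n _.
    have [_ mPH PH] := mkH n.
    have -> : P (Some x) (E n) = (\int[P (Some x)]_(w in path t%:E @^-1` in_cpt (C n))
      P (path t%:E w) (~` H n 0%R))%E by exact: PH.
    apply: (@le_integral_path t _ (C n) (fun y => P y (~` H n 0%R))) => //.
    move=> z Nz [/= cz _]; apply: le_trans (he z Nz).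
    apply: dyadic_event_exit => //; last exact: ltW.
    move=> y; rewrite !ballEmdist /= => zy; move: cz; rewrite ballEmdist /= => cz.
    by have := metric_triangle (c n) z y; lra.
  rewrite nneseriesZl//.
  rewrite -[leRHS]mule1; apply: lee_wpmul2l => //.
  rewrite -measure_semi_bigcup//; last 2 first.
  - apply/trivIsetP => i j _ _ ij; rewrite -preimage_setI -subset0.
    move=> w [[z Cz <-] [y Cy [yz]]].
    have /trivIsetP := trivIset_seqDU (fun n => ball (c n) eta : set (borel M)).
    move=> /(_ i j I I ij); rewrite -subset0; apply; split; first exact: Cz.
    by rewrite -yz.
  - exact: bigcupT_measurable.
  by apply: probability_le1; exact: bigcupT_measurable.
- move=> w y Xt.
  have [n [Cny _]] : exists n, C n y /\ True.
    have [m ym] := cP y _ eta0.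
    have : (\bigcup_n (ball (c n) eta : set (borel M))) y.
      by exists m => //; rewrite ballEmdist /= metric_sym.
    by rewrite seqDU_bigcup_eq => -[n _ Cy]; exists n.
  exists (c n); split.
    by case: (Cny) => + _; rewrite ballEmdist /= metric_sym.
  have [Hw|Hw] := pselect (H n t w).
    by right; have [] := (dyadic_eventP _ _ _ _ (fun z h => h)).1 Hw.
  by left; exists n => //; split => //; rewrite /preimage /= Xt; exists y.
Qed.

Hypothesis path_cont : {ae P (Some x), forall w,
  {within [set t : R | 0 <= t /\ (t%:E < lifetime path w)%E],
    continuous (fun t : R => path t%:E w)}}.

(* Take [t_k = t - theta ^ k t] and radii [r_k] decreasing from below [r / 2] to
   [r / 4]. If [X_t] is in [A], either the path stays in [ball y0 r_0] up to
   [t], or, for the least [k] such that it stays in [ball y0 r_(k+1)] from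
   [t_(k+1)] to [t], it leaves a ball of radius [r / 16 / 4 ^ k] around [X_(t_k)]
   between [t_k] and [t_(k+1)]. By the simple Markov property at these two
   times, the latter event has probability at most [e k * s k]. *)
Lemma dyadic_localization (y0 : M) (r t theta : R) (A : set (borel M))
    (e : nat -> R) (s : nat -> \bar R) :
  0 < r -> 0 < t -> 0 < theta -> theta < 1 ->
  measurable A -> A `<=` ball y0 (r / 4) ->
  (forall k, 0 <= e k) -> (forall k, 0 <= s k)%E ->
  (forall k z, ~ N z -> cprob X z
    [set w | (exit_time X (ball z (r / 16 / 4 ^+ k)) w <= (theta ^+ k * t)%:E)%E]
    <= (e k)%:E)%E ->
  (forall k z, ~ N z -> ball y0 (r / 2) z ->
    killed_transition X (ball y0 (r / 2)) (theta ^+ k.+1 * t) z A <= s k)%E ->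
  (transition X t x A <=
   killed_transition X (ball y0 (r / 2)) t x A + \sum_(k <oo) (e k)%:E * s k)%E.
Proof.
move=> r0 t0 th0 th1 mA Ay e0 s0 he hs.
(* The factor 2/9 makes the gap [rho k - rho k.+1] equal to [r / 6 / 4 ^ k], exactly twice the
   radius [r / 16 / 4 ^ k + r / 48 / 4 ^ k] provided by [exit_cover], while [rho 0 = 17 * r / 36]
   stays below [r / 2]. *)
pose rho k := r / 4 + 2 / 9 * (r / 4 ^+ k).
pose tau k := t - theta ^+ k * t.
pose ln k := theta ^+ k * t - theta ^+ k.+1 * t.
have pk k : 0 < 4 ^+ k :> R by rewrite exprn_gt0.
have thk k : 0 < theta ^+ k by rewrite exprn_gt0.
have ln0 k : 0 < ln k.
  by rewrite /ln -mulrBl mulr_gt0// subr_gt0 exprS gtr_pMl.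
have tau0 k : 0 <= tau k.
  by rewrite /tau subr_ge0 ler_piMl ?(ltW t0)// exprn_ile1// ltW.
have tauS k : tau k + ln k = tau k.+1 by rewrite /tau /ln; ring.
have taut k : tau k + theta ^+ k * t = t by rewrite /tau subrK.
have rho_gt k : r / 4 < rho k by rewrite /rho ltrDl !mulr_gt0 ?invr_gt0.
have rho_lt k : rho k < r / 2.
  have : r / 4 ^+ k <= r by rewrite ler_pdivrMr// ler_peMr ?(ltW r0)// exprn_ege1// ler1n.
  by rewrite /rho; lra.
have rhoS k : rho k - rho k.+1 = r / 6 / 4 ^+ k.
  by rewrite /rho exprS; field; rewrite gt_eqF.
have rhoS_lt k : rho k.+1 < rho k by rewrite -subr_gt0 rhoS !divr_gt0.
have Arho k : A `<=` ball y0 (rho k).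
  by move=> z /Ay; rewrite !ballEmdist /= => h; rewrite (lt_trans h).
pose Q k (E : set Omega) :=
  [/\ filt (tau k + ln k)%:E E, (P (Some x) E <= (e k)%:E)%E &
     forall w y, path (tau k)%:E w = Some y -> exists c : M,
       mdist y c < r / 48 / 4 ^+ k /\
       (E w \/ forall n j, (j < 2 ^ n)%N ->
         in_cpt (ball c (r / 16 / 4 ^+ k + r / 48 / 4 ^+ k))
           (path (tau k + j.+1%:R * (ln k / 2 ^+ n))%:E w))].
(* The interval from [tau k] to [tau k.+1] has length [ln k <= theta ^ k * t], so the exit bound for
   the longer horizon applies. *)
have hQ k : exists E, Q k E.
  apply: exit_cover => //; first by rewrite !divr_gt0.
  move=> z Nz; apply: le_trans (he k z Nz); apply: le_cprob => w h.
  apply: le_trans h _; rewrite lee_fin /ln gerBl.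
  by rewrite mulr_ge0// ltW.
have [E hE] := choice hQ.
have mU k : measurable (ball y0 (rho k) : set (borel M)) by exact: measurable_metric_ball.
pose K k := dyadic_event X (ball y0 (rho k)) A (theta ^+ k * t).
have tht k : 0 < theta ^+ k * t by rewrite mulr_gt0.
pose V k := path (tau k)%:E @^-1` in_cpt (ball y0 (rho k)).
have FV k : filt (tau k)%:E (V k).
  by apply: path_filtration_path => //; exact: measurable_in_cpt.
have mK k : measurable (K k (tau k)).
  by apply: dyadic_event_measurable => //; exact: ltW.
pose L k := E k `&` V k.+1.
have FL k : filt (tau k.+1)%:E (L k).
  by apply: path_filtrationI => //; have [+ _ _] := hE k; rewrite tauS.
have mL k := path_filtration_measurable (FL k).
pose F k := L k `&` K k.+1 (tau k.+1).
have mF k : measurable (F k) by exact: measurableI.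
(* Conditioning at [tau k.+1] bounds the final stretch by [s k]; what remains is the probability of
   [E k], at most [e k]. *)
have PF k : (P (Some x) (F k) <= (e k)%:E * s k)%E.
  have [_ mPK PK] := dyadic_event_markovian X (mU k.+1) mA (ltW (tht k.+1)).
  have -> : P (Some x) (F k) =
    (\int[P (Some x)]_(w in L k) P (path (tau k.+1)%:E w) (K k.+1 0%R))%E by exact: PK.
  apply: (@le_trans _ _ (s k * P (Some x) (L k))%E).
    apply: (@le_integral_path (tau k.+1) _ (ball y0 (rho k.+1))
      (fun y => P y (K k.+1 0%R))) => //; first by move=> w [].
    move=> z Nz zU; apply: le_trans (hs k z Nz _); last first.
      by move: zU; rewrite !ballEmdist /= => h; rewrite (lt_trans h).
    exact: dyadic_event_killed.
  rewrite muleC; apply: lee_wpmul2r => //; have [FE PE _] := hE k.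
  apply: le_trans PE; apply: le_measure; rewrite ?inE//.
    exact: path_filtration_measurable FE.
  exact: subIsetl.
have PK0 : (P (Some x) (K 0%N (tau 0%N)) <=
    killed_transition X (ball y0 (r / 2)) t x A)%E.
  by rewrite /K /tau expr0 mul1r subrr; exact: dyadic_event_killed.
have [Z [mZ Z0 hZ]] := path_cont.
have mXt : measurable (path t%:E @^-1` in_cpt A).
  by apply: path_measurable; rewrite ?lee_fin ?ltW//; exact: measurable_in_cpt.
have incl : path t%:E @^-1` in_cpt A `<=`
    Z `|` (K 0%N (tau 0%N) `|` \bigcup_k F k).
  move=> w [a Aa Xta]; have [Zw|Zw] := pselect (Z w); [by left|right].
  have cw : {within [set t : R | 0 <= t /\ (t%:E < lifetime path w)%E],
      continuous (fun t : R => path t%:E w)}.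
    by apply: contrapT => h; apply: Zw; exact: hZ.
  have tlife : (t%:E < lifetime path w)%E.
    by rewrite ltNge; apply/negP => /path_cemetery; rewrite -Xta.
  pose G k := forall s, tau k <= s -> s <= t ->
    in_cpt (ball y0 (rho k)) (path s%:E w).
  have GK k : G k -> K k (tau k) w.
    move=> Gk; apply/dyadic_eventP; first exact: Arho.
    split=> [n j jn|]; last by rewrite taut; exists a.
    apply: Gk.
      by rewrite lerDl mulr_ge0// divr_ge0 ?exprn_ge0// ltW.
    rewrite -[leRHS](taut k) lerD2l mulrA ler_pdivrMr ?exprn_gt0// mulrC.
    by rewrite ler_wpM2l ?(ltW (tht k))// -natrX ler_nat.
  (* Left continuity of the path at [t] is used here: near [t] it stays in the open ball of radius
     [r / 4], which contains [X_t], and [tau k] tends to [t]. *)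
  have [k Gk] : exists k, G k.
    pose D := [set u : R | 0 <= u /\ (u%:E < lifetime path w)%E].
    have Dt : D t by split => //; exact: ltW.
    have ct : (fun u : R => path u%:E w) u @[u --> within D (nbhs t)] -->
        path t%:E w.
      by have /subspace_continuousP := cw; exact.
    move: ct; rewrite -Xta => /(_ (in_cpt (ball y0 (r / 4)))).
    have nba : nbhs (Some a : MD) (in_cpt (ball y0 (r / 4))).
      apply: one_point_compactification_some_nbhs; apply: open_nbhs_nbhs.
      by split; [exact: open_metric_ball|exact: Ay].
    move=> /(_ nba) /nbhs_ballP[eps /= eps0 heps].
    have [k hk] : exists k, theta ^+ k * t < eps.
      have th1' : `|theta| < 1 by rewrite gtr0_norm.
      have /cvgrPdist_lt/(_ (eps / t)) := cvg_expr th1'.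
      rewrite divr_gt0// => /(_ isT) [k _ /(_ k (leqnn k))] /=.
      rewrite sub0r normrN gtr0_norm// ltr_pdivlMr// => h.
      by exists k.
    exists k => u ku ut.
    have u0 : 0 <= u by rewrite (le_trans (tau0 k)).
    have tu : ball t eps u.
      by rewrite /ball /= ger0_norm ?subr_ge0//; move: ku hk; rewrite /tau; lra.
    have Du : D u by split => //; rewrite (le_lt_trans _ tlife)// lee_fin.
    have /in_cpt_ballP[z -> yz] := heps u tu Du.
    by apply/in_cpt_ballP; exists z => //; rewrite (lt_trans yz).
  have [G0|[{Gk}k [nGk GkS]]] : G 0%N \/ exists k, ~ G k /\ G k.+1.
    elim: k Gk => [|k IH] Gk; first by left.
    by have [/IH//|nG] := pselect (G k); right; exists k.
  - by left; exact: GK.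
  right; exists k => //; split; last exact: GK.
  have tk : tau k.+1 <= t by rewrite /tau gerBl ltW.
  split; last by apply: GkS.
  have /existsNP [u /not_implyP[ku /not_implyP[ut nu]]] := nGk.
  have u0 : 0 <= u by rewrite (le_trans (tau0 k)).
  have uS : u < tau k.+1.
    rewrite ltNge; apply/negP => Su; apply: nu.
    have /in_cpt_ballP[z -> yz] := GkS u Su ut.
    by apply/in_cpt_ballP; exists z; rewrite // (lt_trans yz).
  have [y Xy] := path_alive (tau0 k) (le_trans ku ut) (esym Xta).
  have [b Xb] := path_alive u0 ut (esym Xta).
  have /in_cpt_ballP[b' Xb' yb'] := GkS _ (lexx _) tk.
  have yb : rho k <= mdist y0 b.
    rewrite leNgt; apply/negP => h; apply: nu.
    by apply/in_cpt_ballP; exists b.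
  have [_ _ /(_ w y Xy) [c [yc [//|hc]]]] := hE k.
  exfalso.
  have cb' : mdist c b' < r / 16 / 4 ^+ k + r / 48 / 4 ^+ k.
    have := hc 0%N 0%N erefl; rewrite expr0 divr1 mul1r tauS Xb'.
    by move=> /in_cpt_ballP[_ [<-]].
  have rE : r / 16 / 4 ^+ k + r / 48 / 4 ^+ k = (r / 6 / 4 ^+ k) / 2.
    by field; rewrite gt_eqF.
  have uk0 : 0 <= u - tau k by rewrite subr_ge0.
  have ukl : u - tau k < ln k by rewrite ltrBlDl tauS.
  (* Since [b'] lies strictly inside the ball around [c], the radius on the right exceeds the grid
     radius, as [path_in_ball_dyadic] requires. Then [b] and [b'] are closer than [r / 6 / 4 ^ k],
     although they are separated by the shell between [rho k.+1] and [rho k]. *)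
  have rc : r / 16 / 4 ^+ k + r / 48 / 4 ^+ k < r / 6 / 4 ^+ k - mdist c b'.
    by move: cb'; rewrite rE; lra.
  have := path_in_ball_dyadic (tau0 k) (ln0 k) hc uk0 ukl rc.
  have -> : tau k + (u - tau k) = u by ring.
  rewrite Xb => /in_cpt_ballP[_ [<-] cb].
  have := metric_triangle y0 b' b; have := metric_triangle b' c b.
  rewrite (metric_sym b' c); move: cb yb yb' (rhoS k); lra.
apply: (@le_trans _ _ (P (Some x) (Z `|` (K 0%N (tau 0%N) `|` \bigcup_k F k)))).
  apply: le_measure; rewrite ?inE//; apply: measurableU => //.
  by apply: measurableU => //; exact: bigcupT_measurable.
have mbF : measurable (\bigcup_k F k) by exact: bigcupT_measurable.
apply: le_trans (measureU2 _ _ _) _ => //; first exact: measurableU.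
rewrite [X in (X + _)%E]Z0 add0e.
apply: le_trans (measureU2 _ _ _) _ => //.
apply: leeD => //.
apply: (@le_trans _ _ (\sum_(k <oo) P (Some x) (F k))%E).
  exact: measure_sigma_subadditive.
by apply: lee_nneseries => // k _; exact: measure_ge0.
Qed.

End dyadic_localization.

(** * Joint measurability of the transition function in time and starting point *)

Lemma continuous_borel_measurable {R : realType} {M : pmetricType R} (g : M -> R) :
  continuous g -> measurable_fun setT (g : borel M -> R).
Proof.
move=> cg; apply: (measurability _ (RGenOpens.measurableE R)) => _ [B [a [b ->]] <-].
rewrite setTI; apply: sub_sigma_algebra; exact: open_comp.
Qed.

Section time_space_measurability.
Context {R : realType} {M : pmetricType R} {d : measure_display}
  {Omega : measurableType d} (X : hunt_process M Omega).
Local Notation MD := (one_point_compactification M).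
Local Notation P := (start_law X).
Local Notation path := (sample_path X).

(** The extension of [g] by [b] need not be continuous at the cemetery. Along paths it is
    right-continuous nevertheless, because the cemetery is absorbing and the function is constant
    from there on. *)
Lemma path_right_continuous_oapp (S : topologicalType) (g : M -> S) (b : S)
    (w : Omega) (t : R) : continuous g -> 0 <= t ->
  oapp g b (path s%:E w) @[s --> t^'+] --> oapp g b (path t%:E w).
Proof.
move=> cg t0; have := @path_right_continuous _ _ _ _ X w t t0.
case Xt : (path t%:E w) => [z|] /= h.
  move=> B nB; apply: (h [set y | B (oapp g b y)]).
  by rewrite /nbhs /=; exact: cg.
apply: cvg_near_cst; near=> s.
have ts : t <= s by apply/ltW; near: s; exact: nbhs_right_gt.
by rewrite (path_dead t0 ts Xt).
Unshelve. all: by end_near. Qed.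

(** Strictly above [t], so that right continuity applies, and countably valued, so that
    measurability reduces to fixed times. *)
Definition dyadic_above (n : nat) (t : R) : R :=
  (Num.truncn (2 ^+ n * t)).+1%:R / 2 ^+ n.

Lemma dyadic_above_gt n t : 0 <= t -> t < dyadic_above n t.
Proof.
by move=> t0; rewrite ltr_pdivlMr ?exprn_gt0// mulrC truncnS_gt.
Qed.

Lemma dyadic_above_cvg t : 0 <= t -> dyadic_above n t @[n --> \oo] --> t.
Proof.
move=> t0; apply: (@squeeze_cvgr _ _ _ _ (cst t) (fun n => t + 2^-1 ^+ n)).
- near=> n; rewrite /cst (ltW (dyadic_above_gt n t0)) /=.
  have p0 : 0 < 2 ^+ n :> R by rewrite exprn_gt0.
  have h : (Num.truncn (2 ^+ n * t))%:R <= 2 ^+ n * t.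
    have /truncn_itv/andP[] // : 0 <= 2 ^+ n * t by rewrite mulr_ge0// ltW.
  rewrite /dyadic_above -natr1 ler_pdivrMr// mulrDl exprVn mulVf ?gt_eqF//.
  by rewrite [t * _]mulrC lerD2r.
- exact: cvg_cst.
- rewrite -[X in _ --> X]addr0; apply: cvgD; first exact: cvg_cst.
  by apply: cvg_expr; rewrite ger0_norm// invf_lt1// ltr1n.
Unshelve. all: by end_near. Qed.

(** Replace the time by [dyadic_above n]: on each of countably many strips the time is constant and
    the integral is measurable in the starting point. Right continuity and dominated convergence
    give the limit. *)
Lemma measurable_integral_continuous (g : M -> R) : continuous g ->
  (forall z, 0 <= g z) -> (forall z, g z <= 1) ->
  measurable_fun setT (fun a : R * borel M =>
    \int[P (Some a.2)]_w (oapp g 0 (path `|a.1|%:E w))%:E)%E.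
Proof.
move=> cg g0 g1; pose gh : borel MD -> \bar R := fun y => (oapp g 0 y)%:E.
have gh0 y : (0 <= gh y)%E by rewrite lee_fin; case: y.
have gh1 y : (gh y <= 1)%E by rewrite lee_fin; case: y => //=.
have mgh : measurable_fun setT gh.
  apply: measurable_fun_opc; apply/measurable_EFinP.
  exact: continuous_borel_measurable.
pose I n (a : R * borel M) :=
  (\int[P (Some a.2)]_w gh (path (dyadic_above n `|a.1|)%:E w))%E.
apply: (@emeasurable_fun_cvg _ _ _ _ I) => [n|[t x] _].
- pose D m := [set a : R * borel M | Num.truncn (2 ^+ n * `|a.1|) = m].
  have mD m : measurable (D m).
    have -> : D m = (fun a : R * borel M => 2 ^+ n * `|a.1|) @^-1` `[m%:R, m.+1%:R[.
      apply/seteqP; split=> a; rewrite /D /= in_itv /=.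
        by move=> <-; apply: truncn_itv; rewrite mulr_ge0 ?exprn_ge0.
      by move=> /truncn_def.
    rewrite -[X in measurable X]setTI.
    have : measurable_fun setT (fun a : R * borel M => 2 ^+ n * `|a.1|).
      apply: measurable_funM => //.
      by apply: measurableT_comp => //; exact: measurable_fst.
    by apply => //; exact: measurable_itv.
  have -> : [set: R * borel M] = \bigcup_m D m.
    by apply/esym/seteqP; split => // a _; exists (Num.truncn (2 ^+ n * `|a.1|)).
  apply/measurable_fun_bigcup => // m.
  apply: (@eq_measurable_fun _ _ _ _ _ (fun a : R * borel M =>
    \int[P (Some a.2)]_w gh (path (m.+1%:R / 2 ^+ n)%:E w))%E).
    by move=> a /[!inE] Da; rewrite /I /dyadic_above Da.
  apply: measurable_funTS.
  have t0 : 0 <= m.+1%:R / 2 ^+ n :> R by rewrite divr_ge0 ?exprn_ge0.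
  apply: (measurableT_comp (measurable_integral_path X t0 gh0 mgh)).
  by apply: (measurableT_comp measurable_Some); exact: measurable_snd.
- rewrite /I /=; have t0 : 0 <= `|t| by [].
  have [] // := @dominated_convergence _ Omega R (P (Some x)) setT measurableT
    (fun n w => gh (path (dyadic_above n `|t|)%:E w)) (fun w => gh (path `|t|%:E w))
    (cst 1%E).
  + move=> n; apply: (measurableT_comp mgh).
    by apply: measurable_path; rewrite (le_trans t0)// ltW// dyadic_above_gt.
  + by apply: (measurableT_comp mgh); exact: measurable_path.
  + apply: aeW => w _; apply: cvg_EFin; first by apply: nearW.
    have /cvg_at_rightP := @path_right_continuous_oapp R g 0 w `|t| cg t0.
    move=> /(_ (fun n => dyadic_above n `|t|)); apply; split.
      by move=> n; exact: dyadic_above_gt.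
    exact: dyadic_above_cvg.
  + exact: finite_measure_integrable_cst.
  + by apply: aeW => w n _; rewrite gee0_abs.
Qed.

(* The constant [1] keeps the set nonempty when [A] is everything. *)
Definition codist (A : set M) (z : M) : R :=
  inf [set r | r = 1 \/ exists2 a, ~ A a & r = mdist z a].

Lemma codist_set_has_inf (A : set M) (z : M) :
  has_inf [set r | r = 1 \/ exists2 a, ~ A a & r = mdist z a].
Proof.
split; first by exists 1; left.
by exists 0 => _ [->//|[a _ ->]]; exact: mdist_ge0.
Qed.

Lemma codist_ge0 A z : 0 <= codist A z.
Proof.
apply: lb_le_inf; first by exists 1; left.
by move=> _ [->//|[a _ ->]]; exact: mdist_ge0.
Qed.

Lemma codist_le1 A z : codist A z <= 1.
Proof. by apply: ge_inf; [exact: (codist_set_has_inf A z).2|left]. Qed.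

Lemma codist_lipschitz A y z : codist A y <= codist A z + mdist y z.
Proof.
rewrite -lerBlDr; apply: lb_le_inf; first by exists 1; left.
move=> _ [->|[a Aa ->]].
  by rewrite lerBlDr (le_trans (codist_le1 A y))// lerDl mdist_ge0.
rewrite lerBlDr (@le_trans _ _ (mdist y a))//.
  by apply: ge_inf; [exact: (codist_set_has_inf A y).2|right; exists a].
by rewrite addrC metric_triangle.
Qed.

Lemma codist_continuous A : continuous (codist A).
Proof.
move=> z; apply/cvgrPdist_lt => e e0; apply/nbhs_ballP; exists e => //= y.
rewrite ballEmdist /= => zy.
have := codist_lipschitz A y z; have := codist_lipschitz A z y.
rewrite (metric_sym y z) ltr_norml => h1 h2; apply/andP; split; lra.
Qed.

Lemma codist_out A z : ~ A z -> codist A z = 0.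
Proof.
move=> Az; apply/eqP; rewrite eq_le codist_ge0 andbT.
apply: ge_inf; first exact: (codist_set_has_inf A z).2.
by right; exists z; rewrite ?mdistxx.
Qed.

Lemma codist_in A z : open A -> A z -> 0 < codist A z.
Proof.
move=> oA Az; have : nbhs z A by exact: open_nbhs_nbhs.
move=> /nbhs_ballP[e /= e0 he].
apply: (@lt_le_trans _ _ (Num.min e 1)); first by rewrite lt_min e0 ltr01.
apply: lb_le_inf; first by exists 1; left.
move=> _ [->|[a Aa ->]]; first by rewrite ge_min lexx orbT.
rewrite ge_min leNgt; apply/orP; left; apply/negP => za; apply: Aa; apply: he.
by rewrite ballEmdist.
Qed.

(** For open [S] the continuous functions [1 - (1 - codist S) ^ k] tend to the indicator of [S],
    since [codist S] is positive exactly on [S]. The Dynkin argument passes from open to Borel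
    sets. *)
Lemma measurable_transition_joint (A : set (borel M)) : measurable A ->
  measurable_fun setT (fun a : R * borel M =>
    P (Some a.2) (path `|a.1|%:E @^-1` in_cpt A)).
Proof.
have mp (t : R) (S : set (borel M)) : measurable S ->
    measurable (path `|t|%:E @^-1` in_cpt S).
  by move=> mS; apply: path_measurable => //; exact: measurable_in_cpt.
have mopen (S : set M) : open S -> measurable_fun setT (fun a : R * borel M =>
    P (Some a.2) (path `|a.1|%:E @^-1` in_cpt S)).
  move=> oS; have mS : measurable (S : set (borel M)) by exact: sub_sigma_algebra.
  pose g k (z : M) : R := 1 - (1 - codist S z) ^+ k.
  have c01 z : 0 <= 1 - codist S z <= 1.
    by have := codist_le1 S z; have := codist_ge0 S z; lra.
  have cg k : continuous (g k).
    move=> z; apply: cvgB; first exact: cvg_cst.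
    apply: (@continuous_comp _ _ _ (fun z => 1 - codist S z) (fun r : R => r ^+ k)).
      by apply: cvgB; [exact: cvg_cst|exact: codist_continuous].
    exact: exprn_continuous.
  have g0 k z : 0 <= g k z.
    by have /andP[? ?] := c01 z; rewrite subr_ge0 exprn_ile1.
  have g1 k z : g k z <= 1.
    by have /andP[? ?] := c01 z; rewrite gerBl exprn_ge0.
  apply: (@emeasurable_fun_cvg _ _ _ _ (fun k (a : R * borel M) =>
    \int[P (Some a.2)]_w (oapp (g k) 0 (path `|a.1|%:E w))%:E)%E).
    by move=> k; exact: measurable_integral_continuous.
  move=> [t x] _ /=.
  have mXS := mp t S mS.
  have -> : P (Some x) (path `|t|%:E @^-1` in_cpt S) =
      (\int[P (Some x)]_w (\1_(path `|t|%:E @^-1` in_cpt S) w)%:E)%E.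
    by rewrite integral_indic// setIT.
  have [] // := @dominated_convergence _ Omega R (P (Some x)) setT measurableT
    (fun k w => (oapp (g k) 0 (path `|t|%:E w))%:E)
    (fun w => (\1_(path `|t|%:E @^-1` in_cpt S) w)%:E) (cst 1%E).
  - move=> k; apply/measurable_EFinP.
    apply: (measurableT_comp (f := fun y : borel MD => oapp (g k) 0 y)).
      by apply: measurable_fun_opc; exact: continuous_borel_measurable (cg k).
    exact: measurable_path.
  - apply/measurable_EFinP; exact: measurable_indic.
  - apply: aeW => w _; apply: cvg_EFin; first by apply: nearW.
    rewrite indicE.
    case Xt : (path `|t|%:E w) => [z|] /=; last first.
      rewrite memNset; first exact: cvg_cst.
      by rewrite /preimage /= Xt => -[].
    have [Sz|Sz] := pselect (S z).
      rewrite mem_set; last by rewrite /preimage /= Xt; exists z.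
      rewrite -[X in _ --> X]subr0; apply: cvgB; first exact: cvg_cst.
      apply: cvg_expr; have c0 := codist_in oS Sz; have /andP[c1 c2] := c01 z.
      by rewrite ger0_norm//; lra.
    rewrite memNset; last by rewrite /preimage /= Xt => -[y Sy [yz]]; apply: Sz; rewrite -yz.
    rewrite /g codist_out// subr0.
    rewrite (_ : (fun _ => _) = cst 0); first exact: cvg_cst.
    by apply/funext => k; rewrite expr1n subrr.
  - exact: finite_measure_integrable_cst.
  - apply: aeW => w n _; rewrite gee0_abs ?lee_fin; first by case: (path _ w) => [z|] /=.
    by case: (path _ w) => [z|] /=.
pose Pr (S : set (borel M)) := measurable_fun setT (fun a : R * borel M =>
  P (Some a.2) (path `|a.1|%:E @^-1` in_cpt S)).
suff key : forall S, <<s open >> S -> Pr S by exact: key.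
apply: (@dynkin_induction _ (borel M) open Pr) => //.
- exact: openI.
- by apply: mopen; exact: openT.
- move=> S mS IS.
  rewrite /Pr (_ : (fun _ => _) = fun a : R * borel M =>
    (P (Some a.2) (path `|a.1|%:E @^-1` in_cpt setT) -
     P (Some a.2) (path `|a.1|%:E @^-1` in_cpt S))%E).
    by apply: emeasurable_funB => //; apply: mopen; exact: openT.
  apply/funext => a.
  rewrite (_ : path `|a.1|%:E @^-1` in_cpt (~` S) =
    path `|a.1|%:E @^-1` in_cpt setT `\` path `|a.1|%:E @^-1` in_cpt S); last first.
    apply/seteqP; split=> w /=.
      case=> z Sz <-; split; first by exists z.
      by case=> y Sy [yz]; apply: Sz; rewrite -yz.
    by case=> -[z _ <-] h; exists z => // Sz; apply: h; exists z.
  rewrite measureD; last 3 first.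
  - by apply: mp.
  - by apply: mp.
  - by rewrite (le_lt_trans (probability_le1 _ (mp _ _ measurableT)))// ltry.
  congr (_ - P _ _)%E; apply/setIidPr => w [z _ Xz]; by exists z.
- move=> F mF tF IF.
  rewrite /Pr (_ : (fun _ => _) = fun a : R * borel M =>
    (\sum_(n <oo) P (Some a.2) (path `|a.1|%:E @^-1` in_cpt (F n)))%E).
    apply: (@ge0_emeasurable_sum _ _ _ setT (fun n (a : R * borel M) =>
      P (Some a.2) (path `|a.1|%:E @^-1` in_cpt (F n))) xpredT).
      by move=> n a _ _; exact: measure_ge0.
    by move=> n _; exact: IF.
  apply/funext => a; rewrite -measure_semi_bigcup//.
  + by congr (P _ _); rewrite /in_cpt image_bigcup preimage_bigcup.
  + by move=> n; exact: mp.
  + apply/trivIsetP => i j _ _ ij; rewrite -subset0 => w /= [[z Fz Xz] [y Fy Xy]].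
    have [yz] : Some y = Some z by rewrite Xz Xy.
    move/trivIsetP : tF => /(_ i j I I ij); rewrite -subset0; apply; split; first exact: Fz.
    by rewrite -yz.
  + by apply: bigcupT_measurable => n; exact: mp.
Qed.

End time_space_measurability.

Section transition_kernel.
Context {R : realType} {M : pmetricType R} {d : measure_display}
  {Omega : measurableType d} (X : hunt_process M Omega).
Context {d' : measure_display} {T : measurableType d'}.
Variables (f : T -> R) (g : T -> borel M).
Local Notation MD := (one_point_compactification M).
Local Notation P := (start_law X).
Local Notation path := (sample_path X).
Local Open Scope ereal_scope.

(** Time and starting point are both functions of a parameter, so one construction serves fixed
    times and jointly varying ones. The measurability proofs are arguments because the kernel
    structure depends on them; the absolute value makes every time admissible. *)
Definition transition_kernel (mf : measurable_fun setT f)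
    (mg : measurable_fun setT g) (a : T) (A : set (borel M)) : \bar R :=
  P (Some (g a)) (path `|f a|%R%:E @^-1` in_cpt A).

Hypotheses (mf : measurable_fun setT f) (mg : measurable_fun setT g).
Local Notation K := (transition_kernel mf mg).

Let mpath (t : R) (A : set (borel M)) : measurable A ->
  measurable (path `|t|%R%:E @^-1` in_cpt A).
Proof. by move=> mA; apply: path_measurable => //; exact: measurable_in_cpt. Qed.

Let kernel0 a : K a set0 = 0.
Proof. by rewrite /transition_kernel /in_cpt image_set0 preimage_set0 measure0. Qed.

Let kernel_ge0 a A : 0 <= K a A.
Proof. exact: measure_ge0. Qed.

Let kernel_sigma_additive a : semi_sigma_additive (K a).
Proof.
move=> F mF tF mUF; rewrite /transition_kernel /in_cpt image_bigcup preimage_bigcup.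
apply: measure_semi_sigma_additive.
- by move=> n; exact: mpath.
- apply/trivIsetP => i j _ _ ij; rewrite -subset0 => w /= [[z Fz Xz] [y Fy Xy]].
  have [yz] : Some y = Some z by rewrite Xz Xy.
  move/trivIsetP : tF => /(_ i j I I ij); rewrite -subset0; apply; split; first exact: Fz.
  by rewrite -yz.
- by apply: bigcupT_measurable => n; exact: mpath.
Qed.

HB.instance Definition _ a := isMeasure.Build _ _ _ (K a)
  (kernel0 a) (kernel_ge0 a) (@kernel_sigma_additive a).

Let kernel_measure (a : T) : {measure set (borel M) -> \bar R} := K a.

Let measurable_kernel_measure A : measurable A ->
  measurable_fun setT (kernel_measure ^~ A).
Proof.
move=> mA; apply: (measurableT_comp (measurable_transition_joint X mA)
  (g := fun a => (f a, g a))).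
by apply/measurable_fun_pairP.
Qed.

HB.instance Definition _ := isKernel.Build _ _ _ _ _ kernel_measure
  measurable_kernel_measure.

Let kernel_uub : measure_fam_uub kernel_measure.
Proof.
exists 2%R => a; rewrite (@le_lt_trans _ _ 1)//.
  by apply: probability_le1; exact: mpath.
by rewrite lte_fin ltr1n.
Qed.

HB.instance Definition _ := Kernel_isFinite.Build _ _ _ _ _ kernel_measure
  kernel_uub.

Definition transition_fkernel : R.-fker T ~> (borel M) := kernel_measure.

Lemma integral_transition_kernel (a : T) (h : borel M -> \bar R) :
  (forall z, 0 <= h z) -> measurable_fun setT h ->
  \int[transition_fkernel a]_z h z =
  \int[P (Some (g a))]_w (oapp h 0 (path `|f a|%R%:E w)).
Proof.
move=> h0 mh; pose hh : borel MD -> \bar R := oapp h 0.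
have hh0 y : 0 <= hh y by case: y => /=.
have mhh : measurable_fun setT hh by apply: measurable_fun_opc.
rewrite -(integral_path_kernel X (Some (g a)) _ hh0 mhh)//.
have mcT : measurable (in_cpt setT : set (borel MD)) by exact: measurable_in_cpt.
transitivity (\int[path_pkernel X `|f a| (Some (g a))]_(y in in_cpt setT) hh y); last first.
  rewrite integral_mkcond; apply: eq_integral => -[z|] _; rewrite patchE.
    by rewrite mem_set//; exists z.
  by rewrite memNset//= => -[].
transitivity (\int[path_pkernel X `|f a| (Some (g a))]_(y in in_cpt setT)
    h (odflt point y)); last first.
  by apply: eq_integral => y /[!inE] -[z _ <-].
have mo := @measurable_odflt _ M point.
rewrite -(@ge0_integral_mrestr _ _ _ _ _ mcT (fun y => h (odflt point y)))//; last first.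
  exact: measurableT_comp mh mo.
pose m0 : {measure set (borel M) -> \bar R} :=
  pushforward (mrestr (path_pkernel X `|f a| (Some (g a))) mcT)
   (odflt point : borel MD -> borel M).
transitivity (\int[m0 mo]_z h z); last by rewrite ge0_integral_pushforward// preimage_setT.
apply: eq_measure_integral => A mA _.
rewrite /= /transition_kernel /pushforward /mrestr /= /path_kernel normr_id.
congr (P _ _); apply/seteqP; split=> w /=.
  by case=> z Az <-; split => //; exists z.
by case=> + [z _ zE]; rewrite -zE => Az; exists z.
Qed.

End transition_kernel.

Lemma fubini_mrestr d1 d2 (Z : measurableType d1) (Y : measurableType d2)
    (R : realType) (m : {measure set Z -> \bar R})
    (mu : {sigma_finite_measure set Y -> \bar R}) (q : Z * Y -> \bar R)
    (A : set Y) : measurable A -> (m setT < +oo)%E ->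
  (forall z, 0 <= q z)%E -> measurable_fun setT q ->
  (\int[m]_z \int[mu]_(y in A) q (z, y) = \int[mu]_(y in A) \int[m]_z q (z, y))%E.
Proof.
move=> mA moo q0 mq.
pose m0 : {finite_measure set Z -> \bar R} := mfrestr measurableT moo.
have m0E (h : Z -> \bar R) : (\int[m]_z h z = \int[m0]_z h z)%E.
  apply: eq_measure_integral => B mB _.
  by rewrite /m0 /= /mfrestr /= /mrestr setIT.
have mR : measurable (setT `*` A : set (Z * Y)) by exact: measurableX.
pose f : Z * Y -> \bar R := q \_ (setT `*` A).
have fE z y : f (z, y) = ((fun y => q (z, y)) \_ A) y.
  by rewrite /f !patchE; congr (if _ then _ else _); apply/idP/idP; rewrite !inE /=; tauto.
have mf : measurable_fun setT f.
  by apply/(measurable_restrictT _ _).1 => //; exact: measurable_funTS.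
have f0 z : (0 <= f z)%E by rewrite /f patchE; case: ifP.
rewrite m0E; transitivity (\int[m0]_z \int[mu]_y f (z, y))%E.
  apply: eq_integral => z _; rewrite integral_mkcond.
  by apply: eq_integral => y _; rewrite fE.
rewrite (@fubini_tonelli _ _ _ _ R m0 mu f)// [RHS]integral_mkcond.
apply: eq_integral => y _; rewrite patchE; case: ifPn => yA.
  by rewrite m0E; apply: eq_integral => z _; rewrite fE patchE yA.
by apply: integral0_eq => z _; rewrite fE patchE (negbTE yA).
Qed.

(** * The transition density and its bounds *)

Section transition_density.
Context {R : realType} {M : pmetricType R} {d : measure_display}
  {Omega : measurableType d} (X : hunt_process M Omega).
Local Notation MD := (one_point_compactification M).
Local Notation P := (start_law X).
Local Notation path := (sample_path X).

Lemma measurable_transition (t : R) (A : set (borel M)) : 0 <= t -> measurable A ->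
  measurable_fun setT (fun z : borel M => transition X t z A).
Proof. by move=> t0 mA; exact: law_measurable. Qed.

Lemma chapman_kolmogorov d' (T : measurableType d') (f : T -> R) (g : T -> borel M)
    (mf : measurable_fun setT f) (mg : measurable_fun setT g) (a : T) (s : R)
    (A : set (borel M)) : 0 <= f a -> 0 <= s -> measurable A ->
  (transition X (f a + s) (g a) A =
   \int[transition_fkernel X mf mg a]_z transition X s z A)%E.
Proof.
move=> t0 s0 mA; rewrite integral_transition_kernel//; last first.
  exact: measurable_transition.
have := path_markov (h := X) (Some (g a)) s0 t0 (measurable_in_cpt mA)
  (@path_filtrationT _ _ _ _ X (f a)%:E).
rewrite setTI => h; rewrite [LHS]h; apply: eq_integral => w _.
rewrite (ger0_norm t0); case: (path (f a)%:E w) => [z|] //=.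
exact: law_None.
Qed.

Variables (N : set (borel M)) (mu : {sigma_finite_measure set (borel M) -> \bar R}).
Hypotheses (mN : measurable N)
  (pathN : forall x, ~ N x -> {ae P (Some x), forall w, forall t : R, 0 <= t ->
     ~ in_cpt N (path t%:E w)})
  (transition_dominated : forall (t : R) (x : M) (A : set (borel M)),
     0 < t -> ~ N x -> measurable A -> mu A = 0%E -> transition X t x A = 0%E).

Lemma transition_exceptional (t : R) (x : M) : 0 <= t -> ~ N x ->
  transition X t x N = 0%E.
Proof.
move=> t0 Nx; apply/negligibleP.
  by apply: path_measurable => //; exact: measurable_in_cpt.
apply: negligibleS (pathN Nx) => w /= XN h; exact: (h t t0).
Qed.

(* By Chapman-Kolmogorov [P_t = P_(t - u) P_u], so it is enough to disintegrate
   the kernels [P_u] for [u = 1 / n]; the null sets of the starting point are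
   not charged by [P_(t - u)]. Selecting [u < t] among countably many values
   makes the density jointly measurable in time as well. *)
Lemma transition_density :
  exists q : R * borel M * borel M -> \bar R,
    [/\ forall a, (0 <= q a)%E, measurable_fun setT q &
    forall (t : R) (x : M) (A : set (borel M)), 0 < t -> ~ N x -> measurable A ->
      (transition X t x A = \int[mu]_(y in A) q (t, x, y))%E].
Proof.
pose u n : R := n.+1%:R^-1.
have u0 n : 0 < u n by rewrite invr_gt0.
pose K n := transition_fkernel X (measurable_cst (u n)) (@measurable_id _ (borel M) setT).
have Kmu n z : (~` N) z -> K n z `<< mu.
  move=> Nz; apply/null_content_dominatesP => A mA muA.
  rewrite /K /= /transition_kernel /= ger0_norm; last exact: ltW (u0 n).
  exact: (@transition_dominated (u n) z A).
(* The measure [mu] serves both as reference measure and as measure on starting points, so the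
   exceptional starting points form a [mu]-null set. *)
have [q_ /all_and3[q0 mq hq]] :=
  choice (fun n => @kernel_density _ _ _ _ R mu mu (K n) _ (measurableC mN) (@Kmu n)).
(* The integer part of [1 / t], so that [u (n_ t) < t]. *)
pose n_ (t : R) : nat := Num.truncn `|t|^-1.
have mt n : measurable_fun setT (fun a : R * borel M * borel M => a.1.1 - u n).
  apply: measurable_funB => //.
  exact: (measurableT_comp measurable_fst measurable_fst).
have mt' n : measurable_fun setT (fun a : R * borel M => a.1 - u n).
  by apply: measurable_funB => //; exact: measurable_fst.
have mx : measurable_fun setT (fun a : R * borel M * borel M => a.1.2).
  exact: (measurableT_comp measurable_snd measurable_fst).
have mx' : measurable_fun setT (fun a : R * borel M => a.2).
  exact: measurable_snd.
pose Q n (a : R * borel M * borel M) : \bar R :=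
  (\int[transition_fkernel X (mt n) mx a]_z q_ n (z, a.2))%E.
exists (fun a => Q (n_ a.1.1) a); split.
- by move=> a; apply: integral_ge0 => z _; exact: q0.
- pose D n : set (R * borel M * borel M) := [set a | n_ a.1.1 = n].
  have mD n : measurable (D n).
    have -> : D n = (fun a : R * borel M * borel M => `|a.1.1|^-1) @^-1` `[n%:R, n.+1%:R[.
      apply/seteqP; split=> a; rewrite /D /= in_itv /=.
        by move=> <-; apply: truncn_itv; rewrite invr_ge0.
      by move=> /truncn_def.
    rewrite -[X in measurable X]setTI.
    have : measurable_fun setT (fun a : R * borel M * borel M => `|a.1.1|^-1).
      rewrite (_ : (fun _ => _) = fun a : R * borel M * borel M => `|a.1.1| `^ -1).
        apply: (measurableT_comp (measurable_powR _)); apply: measurableT_comp => //.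
        exact: (measurableT_comp measurable_fst measurable_fst).
      by apply/funext => a; rewrite powR_inv1.
    by apply => //; exact: measurable_itv.
  have -> : [set: R * borel M * borel M] = \bigcup_n D n.
    by apply/esym/seteqP; split => // a _; exists (n_ a.1.1).
  apply/measurable_fun_bigcup => // n.
  apply: (@eq_measurable_fun _ _ _ _ _ (Q n)).
    by move=> a /[!inE] Da; rewrite Da.
  apply: measurable_funTS.
  apply: (measurable_fun_integral_finite_kernel (fun b => q_ n (b.2, b.1.2))
    (transition_fkernel X (mt n) mx)) => //.
  apply: (measurableT_comp (mq n)); apply/measurable_fun_pairP; split.
    exact: measurable_snd.
  exact: (measurableT_comp measurable_snd measurable_fst).
- move=> t x A t0 Nx mA; rewrite /=.
  set n := n_ t.
  have ut : u n < t.
    rewrite /u -[t]invrK ltf_pV2 ?posrE ?invr_gt0//.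
    by rewrite /n /n_ ger0_norm ?ltW// truncnS_gt.
  have tu : 0 < t - u n by rewrite subr_gt0.
  pose k : {measure set (borel M) -> \bar R} := transition_fkernel X (mt' n) mx' (t, x).
  have kE (B : set (borel M)) : measurable B -> k B = transition X (t - u n) x B.
    by move=> mB; rewrite /k /= /transition_kernel /= ger0_norm// ltW.
  have koo : (k setT < +oo)%E.
    rewrite kE//; apply: (@le_lt_trans _ _ 1%E); last by rewrite ltry.
    apply: probability_le1; apply: path_measurable; first by rewrite lee_fin ltW.
    exact: measurable_in_cpt measurableT.
  transitivity (\int[mu]_(y in A) \int[k]_z q_ n (z, y))%E; last first.
    by apply: eq_integral => y _; apply: eq_measure_integral.
  rewrite -fubini_mrestr//.
  have -> : transition X t x A = (\int[k]_z K n z A)%E.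
    have := chapman_kolmogorov (mt' n) mx' (a := (t, x)) (s := u n) (A := A).
    rewrite /= subrK => ->//; [|exact: ltW|exact: ltW].
    by apply: eq_integral => z _; rewrite /K /= /transition_kernel /= ger0_norm// (ltW (u0 n)).
  apply: ge0_ae_eq_integral => //.
  + exact: measurable_kernel.
  + have -> : (fun z => \int[mu]_(y in A) q_ n (z, y))%E =
      (fun z => \int[mu]_y ((q_ n) \_ (setT `*` A)) (z, y))%E.
      apply/funext => z; rewrite integral_mkcond; apply: eq_integral => y _.
      by rewrite !patchE; congr (if _ then _ else _); apply/idP/idP; rewrite !inE /=; tauto.
    apply: measurable_fun_fubini_tonelli_F.
      apply/(measurable_restrictT _ _).1; first exact: measurableX.
      exact: measurable_funTS.
    by move=> z; rewrite patchE; case: ifP.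
  + by move=> z _; apply: integral_ge0 => y _.
  (* The law at time [t - u n] charges neither the [mu]-null set [B], by domination, nor [N], by
     [transition_exceptional]. *)
  + have [B [mB muB hB]] := hq n A mA.
    exists (B `|` N); split.
    * exact: measurableU.
    * rewrite measureU0//; first by rewrite kE//; exact: transition_dominated.
      by rewrite kE// transition_exceptional// ltW.
    * move=> z /= hz; apply: contrapT => /not_orP[Bz Nz]; apply: hz => _.
      by apply: contrapT => e; apply: Bz; apply: hB => /(_ Nz).
Qed.

End transition_density.

(** * Monotonicity of the scale function, measurability of its transform, and two general facts on
    densities *)

Section scale_homeomorphism.
Context {R : realType} (cPsi beta1 beta2 : R) (Psi : R -> R).
Hypotheses (cPsi_gt0 : 0 < cPsi)
  (Psi_homeo : homeomorphism_on [set r : R | 0 <= r] [set r : R | 0 <= r] Psi)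
  (Psi_reg : scale_regular cPsi beta1 beta2 Psi).

(** If [Psi r = 0], scaling with both radii equal to [r] would read [cPsi^-1 <= 0], since division
    by 0 gives 0. *)
Lemma scale_gt0 (r : R) : 0 < r -> 0 < Psi r.
Proof.
move=> r0; have [g [Pg _ _ _ _]] := Psi_homeo.
rewrite lt_neqAle (Pg r (ltW r0)) andbT eq_sym; apply/eqP => P0.
have [+ _] := Psi_reg r0 (lexx r).
by rewrite P0 mul0r leNgt divff ?gt_eqF// powR1 mulr1 invr_gt0 cPsi_gt0.
Qed.

Lemma scale_zero : Psi 0 = 0.
Proof.
have [g [_ hg _ Pg _]] := Psi_homeo.
have := hg 0 (lexx 0); rewrite /= le_eqVlt => /orP[/eqP g0|/scale_gt0].
  by rewrite [X in Psi X]g0 Pg//=.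
by rewrite Pg//= ltxx.
Qed.

Lemma scale_surjective (t : R) : 0 < t -> exists2 r, 0 < r & Psi r = t.
Proof.
move=> t0; have [g [_ hg _ Pg _]] := Psi_homeo; exists (g t); last exact/Pg/ltW.
rewrite lt_neqAle (hg t (ltW t0)) andbT; apply/eqP => g0.
have := Pg t (ltW t0); rewrite -g0 scale_zero => t1.
by move: t0; rewrite -t1 ltxx.
Qed.

(** An injective continuous function vanishing only at 0 increases: if [Psi b <= Psi a], the
    intermediate value theorem finds [z <= a] with [Psi z = Psi b], and injectivity forces
    [z = b]. *)
Lemma scale_lt (a b : R) : 0 <= a -> a < b -> Psi a < Psi b.
Proof.
move=> a0 ab; have b0 : 0 < b by exact: le_lt_trans ab.
have [g [_ _ gP _ [cP _]]] := Psi_homeo.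
rewrite ltNge; apply/negP => Pba.
move: a0; rewrite le_eqVlt => /orP[/eqP a0|a0].
  by move: Pba; rewrite -a0 scale_zero leNgt scale_gt0.
have [||z] := @IVT R Psi 0 a (Psi b) (ltW a0).
- apply: continuous_subspaceW cP => z /=; rewrite in_itv /=.
  by case/andP.
- rewrite scale_zero; apply/andP; split.
    by rewrite ge_min (ltW (scale_gt0 b0)).
  by rewrite le_max Pba orbT.
- rewrite in_itv /= => /andP[z0 za] /(congr1 g); rewrite !gP//= ?ltW// => zb.
  by move: za; rewrite zb leNgt ab.
Qed.

Lemma scale_le (a b : R) : 0 <= a -> a <= b -> Psi a <= Psi b.
Proof.
move=> a0; rewrite le_eqVlt => /orP[/eqP ->//|ab].
by rewrite ltW// scale_lt.
Qed.

Lemma scale_lt_ext (r : R) (rad : \bar R) : 0 <= r -> (r%:E <= rad)%E ->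
  ((Psi r)%:E <= scale_ext Psi rad)%E.
Proof.
by case: rad => //= [s|]; rewrite ?leey// !lee_fin => r0; exact: scale_le.
Qed.

Hypothesis beta1_gt1 : 1 < beta1.

(* Monotonicity of [Psi] lets the radius range over the rationals. *)
Lemma measurable_scale_conj d (T : measurableType d) (D : set T) (rho t : T -> R) :
  measurable D -> (forall a, D a -> 0 <= rho a) -> (forall a, D a -> 0 < t a) ->
  measurable_fun D rho -> measurable_fun D t ->
  measurable_fun D (fun a => scale_conj Psi (rho a) (t a)).
Proof.
move=> mD rho0 t0 mrho mt.
apply: (measurability _ (RGenOInfty.measurableE R)) => _ [_ [s ->] <-].
rewrite [X in measurable X](_ : _ = \bigcup_(q : rat)
    (if 0 < q then D `&` (fun a => rho a / ratr q - t a / Psi (ratr q)) @^-1` `]s, +oo[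
     else set0)); last first.
  apply/seteqP; split=> a.
    move=> [Da]; rewrite /= in_itv /= andbT => /sup_gt[].
      by exists (rho a / 1 - t a / Psi 1), 1 => /=.
    move=> _ [r /= r0 <-] sr.
    (* The rational is taken slightly above [r]: [rho / q] barely decreases, while
       [t / Psi q <= t / Psi r] goes in the favourable direction. *)
    have [q rq hq] : exists2 q : rat, r < ratr q & s + t a / Psi r < rho a / ratr q.
      have sr' : s + t a / Psi r < rho a / r by rewrite -ltrBrDr.
      have [h|h] := leP (s + t a / Psi r) 0.
        have [q] := rat_in_itvoo (ltr_pwDr ltr01 (lexx r)); rewrite in_itv /= => /andP[rq _].
        exists q => //; move: (rho0 a Da); rewrite le_eqVlt => /orP[/eqP e|e].
          by move: sr'; rewrite -e !mul0r.
        by rewrite (le_lt_trans h)// divr_gt0// (lt_trans r0).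
      have : r < rho a / (s + t a / Psi r) by rewrite ltr_pdivlMr// mulrC -ltr_pdivlMr.
      move=> /rat_in_itvoo[q]; rewrite in_itv /= => /andP[rq qr]; exists q => //.
      by rewrite ltr_pdivlMr ?(lt_trans r0)// mulrC -ltr_pdivlMr.
    exists q => //; have q0 : 0 < q by rewrite -(ltr0q R) (lt_trans r0).
    rewrite q0; split => //=; rewrite in_itv /= andbT ltrBrDr (le_lt_trans _ hq)//.
    rewrite lerD2l ler_wpM2l ?(ltW (t0 a Da))// lef_pV2 ?posrE ?scale_gt0//.
      by rewrite scale_le// ltW.
    exact: lt_trans rq.
  move=> [q _]; case: ifPn => // q0 [Da]; rewrite /= in_itv /= andbT => h.
  split => //=; rewrite in_itv /= andbT; apply: lt_le_trans h _.
  apply: (le_scale_conj (cPsi := cPsi) (beta1 := beta1) (beta2 := beta2)) => //.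
    exact: scale_gt0.
    exact: t0.
  by rewrite ltr0q.
apply: bigcupT_measurable_rat => q; case: ifPn => // q0.
have : measurable_fun D (fun a => rho a / ratr q - t a / Psi (ratr q)).
  by apply: measurable_funB; apply: measurable_funM.
by apply => //; exact: measurable_itv.
Qed.

End scale_homeomorphism.

(** Cut the space into countably many disjoint cells, each inside a ball of radius [r], and add up.
    The radius must be the same for all centres. *)
Lemma le_integral_local {R : realType} {M : pmetricType R}
    (mu nu : {measure set (borel M) -> \bar R}) (b : borel M -> \bar R) (r : R) :
  separable M -> 0 < r ->
  (forall y, 0 <= b y)%E -> measurable_fun setT b ->
  (forall (y0 : M) (A : set (borel M)), measurable A -> A `<=` ball y0 r ->
     (nu A <= \int[mu]_(y in A) b y)%E) ->
  forall A, measurable A -> (nu A <= \int[mu]_(y in A) b y)%E.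
Proof.
move=> sepM r0 b0 mb h A mA.
have [c cP] := separable_dense_seq sepM.
pose C := seqDU (fun n => ball (c n) r : set (borel M)).
have mC n : measurable (C n).
  apply: measurableD; first exact: measurable_metric_ball.
  by apply: bigsetU_measurable => i _; exact: measurable_metric_ball.
have CT : \bigcup_n C n = setT.
  rewrite -seqDU_bigcup_eq; apply/seteqP; split=> // y _.
  by have [n yn] := cP y _ r0; exists n => //; rewrite ballEmdist /= metric_sym.
have mAC n : measurable (A `&` C n) by exact: measurableI.
have tAC : trivIset setT (fun n => A `&` C n).
  by apply: trivIset_setIl; exact: trivIset_seqDU.
have AE : A = \bigcup_n (A `&` C n) by rewrite -setI_bigcupr CT setIT.
rewrite [in leLHS]AE measure_semi_bigcup//; last exact: bigcupT_measurable.
rewrite [in leRHS]AE ge0_integral_bigcup//; last exact: measurable_funTS.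
apply: lee_nneseries => // n _; apply: (h (c n)) => //.
by move=> y [_ [+ _]].
Qed.

(* The two densities agree almost everywhere, but only the minimum is bounded by
   [b] everywhere. *)
Lemma dominated_density {R : realType} d (Y : measurableType d)
    (mu : {measure set Y -> \bar R}) (q : Y -> \bar R) (b : Y -> R) :
  (forall y, 0 <= q y)%E -> measurable_fun setT q ->
  (forall y, 0 <= b y) -> measurable_fun setT b -> (\int[mu]_y q y < +oo)%E ->
  (forall A, measurable A -> \int[mu]_(y in A) q y <= \int[mu]_(y in A) (b y)%:E)%E ->
  forall A, measurable A ->
    (\int[mu]_(y in A) q y = \int[mu]_(y in A) mine (q y) (b y)%:E)%E.
Proof.
move=> q0 mq b0 mb qoo qb A mA.
have mb' : measurable_fun setT (fun y => (b y)%:E) by apply/measurable_EFinP.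
have mm : measurable_fun setT (fun y => mine (q y) (b y)%:E).
  exact: measurable_mine.
have m0 y : (0 <= mine (q y) (b y)%:E)%E by rewrite le_min q0 lee_fin b0.
have iq : mu.-integrable setT q.
  by apply/integrableP; split => //; under eq_integral do rewrite gee0_abs//.
have iqA : mu.-integrable A q by exact: integrableS iq.
have mB : measurable [set y | ((b y)%:E < q y)%E].
  by rewrite -[X in measurable X]setTI; exact: emeasurable_fun_lt.
apply: ae_eq_integral => //; try exact: measurable_funTS.
apply: integral_ae_eq => //; first exact: measurable_funTS.
move=> E EA mE; apply/eqP; rewrite eq_le; apply/andP; split; last first.
  apply: ge0_le_integral => //; try exact: measurable_funTS.
  by move=> y _; rewrite ge_min lexx.
(* On [B] the minimum is [b], and the integral hypothesis bounds [q] by it; off [B] the minimum is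
   [q]. *)
set B := [set y | ((b y)%:E < q y)%E].
have mEB : measurable (E `&` B) by exact: measurableI.
have mED : measurable (E `\` B) by exact: measurableD.
rewrite -(setDUK (@subIsetl _ E B)) setDIr setDv set0U.
have dB : [disjoint E `&` B & E `\` B].
  by apply/disj_setPS => y [[_ By] [_]].
rewrite !ge0_integral_setU//; try exact: measurable_funTS.
- apply: leeD.
    apply: (le_trans (qb _ mEB)); apply: ge0_le_integral => //; try exact: measurable_funTS.
      by move=> y _; rewrite lee_fin.
    by move=> y [_ /ltW By]; rewrite le_min By lexx.
  apply: ge0_le_integral => //; try exact: measurable_funTS.
  by move=> y [_ By]; rewrite le_min lexx leNgt; apply/negP.
Qed.

(** * The bounds for small and large times, and the bounded density *)

Section density_bounds.
Context {R : realType} {M : pmetricType R} {d : measure_display}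
  {Omega : measurableType d} (X : hunt_process M Omega).
Local Notation P := (start_law X).
Local Notation path := (sample_path X).
Variables (cPsi beta1 beta2 cF alphaF c gamma kappa C1 : R).
Hypotheses (cPsi_gt0 : 0 < cPsi) (beta1_gt1 : 1 < beta1) (beta12 : beta1 <= beta2)
  (cF_gt0 : 0 < cF) (alphaF_gt0 : 0 < alphaF) (c_gt0 : 0 < c) (gamma_gt0 : 0 < gamma)
  (kappa_gt0 : 0 < kappa) (C1_gt0 : 0 < C1).
Variables (mu : {sigma_finite_measure set (borel M) -> \bar R}) (N : set (borel M))
  (Psi : R -> R) (rad : \bar R) (F : R -> M -> M -> R).
Hypotheses (sepM : separable M) (mN : measurable N)
  (pathN : forall x : M, ~ N x -> {ae P (Some x), forall w, forall t : R, 0 <= t ->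
     ~ in_cpt N (path t%:E w)})
  (path_cont : forall x : M, ~ N x -> {ae P (Some x), forall w,
     {within [set t : R | 0 <= t /\ (t%:E < lifetime path w)%E],
        continuous (fun t : R => path t%:E w)}})
  (Psi_homeo : homeomorphism_on [set r : R | 0 <= r] [set r : R | 0 <= r] Psi)
  (Psi_reg : scale_regular cPsi beta1 beta2 Psi)
  (F_gt0 : forall (t : R) (x y : M), time_interval Psi rad t -> 0 < F t x y)
  (mF : measurable_fun
    ((time_interval Psi rad `*` setT) `*` setT : set (R * borel M * borel M))
    (fun z : R * borel M * borel M => F z.1.1 z.1.2 z.2))
  (killed_le : forall (y0 : M) (r t : R) (x : M) (A : set (borel M)),
     0 < r -> (r%:E <= rad)%E -> 0 < t -> t < Psi r -> ball y0 (r / 2) x -> ~ N x ->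
     measurable A -> A `<=` ball y0 (r / 2) ->
     (killed_transition X (ball y0 (r / 2)) t x A <= \int[mu]_(y in A) (F t x y)%:E)%E)
  (exit_le : forall (x : M) (r r' t : R), ~ N x -> 0 < r' -> (r'%:E <= rad)%E ->
     0 < r -> r < r' / 2 -> 0 < t ->
     (cprob X x [set w | (exit_time X (ball x r) w <= t%:E)%E]
        <= (c * expR (- scale_conj Psi (gamma * r) t))%:E)%E)
  (Phi_lower : forall rho t : R, 0 < rho -> 0 < t -> t <= Psi rho ->
     kappa * (Psi rho / t) `^ beta2^-1 <= scale_conj Psi (gamma / 16 * rho) t)
  (absorb : forall (j : nat) (u phi : R), 1 <= u -> kappa * u `^ beta2^-1 <= phi ->
    (u / theta cPsi beta2 ^+ j.+1) `^ alphaF * expR (- (2 ^+ j * phi)) <=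
    C1 * 2^-1 ^+ j.+1 * expR (- (phi / 2))).

Local Notation th := (theta cPsi beta2).

Let Psi_gt0 := scale_gt0 cPsi_gt0 Psi_homeo Psi_reg.

Let th_lt1 : th < 1.
Proof.
have c1 : 1 <= cPsi by exact: cPsi_ge1 Psi_gt0 Psi_reg.
rewrite invf_lt1; last by rewrite mulr_gt0// powR_gt0.
apply: (@lt_le_trans _ _ (8 `^ beta2)); last by rewrite ler_peMl ?powR_ge0.
have b21 : 1 <= beta2 by rewrite (le_trans (ltW beta1_gt1)).
by apply: lt_le_trans (le1r_powR _ b21); lra.
Qed.

Lemma time_interval_lt (r t : R) : 0 < r -> (r%:E <= rad)%E -> 0 < t -> t <= Psi r ->
  time_interval Psi rad t.
Proof.
move=> r0 rR t0 tr; split => //.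
apply: (@le_trans _ _ (Psi r)%:E); first by rewrite lee_fin.
by apply: (scale_lt_ext cPsi_gt0 Psi_homeo Psi_reg) => //; exact: ltW.
Qed.

Lemma measurable_time_interval : measurable (time_interval Psi rad).
Proof.
rewrite (_ : time_interval Psi rad = `]0, +oo[ `&` [set t | (t%:E <= scale_ext Psi rad)%E]).
  apply: measurableI; first exact: measurable_itv.
  rewrite -[X in measurable X]setTI; apply: emeasurable_fun_le => //.
by apply/seteqP; split=> t /=; rewrite in_itv /= andbT.
Qed.

Lemma measurable_time_section (t : R) (x : M) : time_interval Psi rad t ->
  measurable_fun setT (fun y : borel M => F t x y).
Proof.
move=> It.
pose h (y : borel M) : R * borel M * borel M := (t, x, y).
pose D : set (R * borel M * borel M) := (time_interval Psi rad `*` setT) `*` setT.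
apply: (measurable_comp (F := D) (f := fun z : R * borel M * borel M => F z.1.1 z.1.2 z.2)
  (g := h)) => //.
- by apply: measurableX => //; apply: measurableX => //; exact: measurable_time_interval.
- by move=> _ [y _ <-]; split => //; split.
- apply/measurable_fun_pairP; split; last exact: measurable_id.
  exact: measurable_cst.
Qed.

(** The function [G] serves two regimes: [F t x] for small times, and the constant infimum of [F] at
    time [Psi rad] for large ones. The first term is kept as it stands, because each regime bounds
    it differently. *)
Lemma transition_le_localized (x y0 : M) (r t B : R) (G : M -> R) (A : set (borel M)) :
  0 < r -> (r%:E <= rad)%E -> ~ N x -> 0 < t -> t < Psi r ->
  measurable A -> A `<=` ball y0 (r / 4) -> 0 < B -> (forall y, 0 <= G y) ->
  measurable_fun setT (G : borel M -> R) ->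
  (forall s z y, 0 < s -> s <= t -> ball y0 (r / 2) z -> A y ->
     F s z y <= B * (Psi r / s) `^ alphaF * G y) ->
  (transition X t x A <= killed_transition X (ball y0 (r / 2)) t x A +
   (c * B * C1 * expR (- (scale_conj Psi (gamma / 16 * r) t / 2)))%:E *
   \int[mu]_(y in A) (G y)%:E)%E.
Proof.
move=> r0 rR Nx t0 tr mA Ay0 B0 G0 mG hFG.
set phi := scale_conj Psi _ t; set J := (\int[mu]_(y in A) (G y)%:E)%E.
have th0 : 0 < th by exact: theta_gt0.
have J0 : (0 <= J)%E by apply: integral_ge0 => y _; rewrite lee_fin.
have mGE : measurable_fun A (fun y : borel M => (G y)%:E).
  by apply/measurable_EFinP; exact: measurable_funTS.
pose u := Psi r / t.
have u1 : 1 <= u by rewrite ler_pdivlMr// mul1r ltW.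
have uphi : kappa * u `^ beta2^-1 <= phi by apply: Phi_lower => //; exact: ltW.
(* By [scale_conj_iter] this dominates the exit bound for radius [r / 16 / 4 ^ k] and time
   [th ^ k * t]. *)
pose e k := c * expR (- (2 ^+ k * phi)).
pose s k := ((B * (u / th ^+ k.+1) `^ alphaF)%:E * J)%E.
have ss k : 0 < th ^+ k * t by rewrite mulr_gt0// exprn_gt0.
apply: (@le_trans _ _ (killed_transition X (ball y0 (r / 2)) t x A +
    \sum_(k <oo) (e k)%:E * s k)%E).
  apply: (@dyadic_localization _ _ _ _ X N x sepM (pathN Nx) (path_cont Nx)
    y0 r t th A e s r0 t0 th0 th_lt1 mA Ay0).
  - by move=> k; rewrite /e mulr_ge0 ?(ltW c_gt0)// expR_ge0.
  - by move=> k; rewrite /s mule_ge0// lee_fin mulr_ge0 ?(ltW B0)// powR_ge0.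
  - move=> k z Nz; have k4 : 1 <= 4 ^+ k :> R by rewrite exprn_ege1//; lra.
    have k40 : 0 < 4 ^+ k :> R by rewrite (lt_le_trans ltr01).
    have r16 : 0 < r / 16 / 4 ^+ k by rewrite !divr_gt0.
    apply: (le_trans (exit_le Nz r0 rR r16 _ (ss k))).
      rewrite ltr_pdivrMr//; apply: (@lt_le_trans _ _ (r / 2 * 1)); first lra.
      by rewrite ler_wpM2l// divr_ge0// ltW.
    rewrite lee_fin ler_wpM2l ?(ltW c_gt0)// ler_expR lerN2.
    have := @scale_conj_iter _ _ _ _ cPsi_gt0 beta1_gt1 _ Psi_gt0 Psi_reg (gamma / 16 * r) t k t0.
    congr (_ <= scale_conj _ _ _); by rewrite -!mulrA; congr (_ * _); rewrite mulrCA !mulrA.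
  - move=> k z Nz zU.
    have s0 := ss k.+1; have st : th ^+ k.+1 * t <= t.
      by rewrite ler_piMl ?(ltW t0)// exprn_ile1// ltW.
    have It : time_interval Psi rad (th ^+ k.+1 * t).
      by apply: (time_interval_lt r0 rR s0); exact: le_trans (ltW tr).
    apply: (le_trans (killed_le r0 rR s0 (le_lt_trans st tr) zU Nz mA _)).
      apply: (subset_trans Ay0); apply: le_ball; lra.
    have -> : s k = (\int[mu]_(y in A) ((B * (u / th ^+ k.+1) `^ alphaF)%:E * (G y)%:E))%E.
      rewrite ge0_integralZl_EFin//.
        by move=> y _; rewrite lee_fin.
      by rewrite mulr_ge0 ?(ltW B0)// powR_ge0.
    apply: ge0_le_integral => //.
    + by move=> y _; rewrite lee_fin ltW// F_gt0.
    + by apply/measurable_EFinP; apply: measurable_funTS; exact: measurable_time_section.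
    + by apply: measurable_funeM.
    + move=> y Ay; rewrite -EFinM lee_fin (le_trans (hFG _ _ _ s0 st zU Ay))//.
      by rewrite /u invfM [th ^- _ * _]mulrC mulrA.
rewrite leeD2l//.
have a0 : 0 < c * B * C1 * expR (- (phi / 2)) by rewrite !mulr_gt0// expR_gt0.
(* An infinite integral makes the claim trivial. For a finite one, [absorb] leaves the factors
   [2 ^ -(k + 1)], whose sum is at most 1. *)
case Joo : J => [j| |]; last by rewrite Joo in J0.
- have j0 : 0 <= j by rewrite Joo in J0.
  rewrite -EFinM; apply: le_trans (epsilon_trick0 xpredT _); last by rewrite mulr_ge0// ltW.
  apply: lee_nneseries => k _; first move=> _.
    rewrite /s Joo -!EFinM lee_fin !mulr_ge0 ?(ltW c_gt0) ?(ltW B0) ?powR_ge0 ?expR_ge0//.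
  rewrite /s Joo -!EFinM lee_fin /e.
  have := absorb k u1 uphi => h.
  have -> : c * expR (- (2 ^+ k * phi)) * (B * (u / th ^+ k.+1) `^ alphaF * j) =
    c * B * j * ((u / th ^+ k.+1) `^ alphaF * expR (- (2 ^+ k * phi))) by ring.
  apply: (le_trans (ler_wpM2l _ h)); first by rewrite !mulr_ge0 ?(ltW c_gt0) ?(ltW B0).
  by rewrite natrX exprVn le_eqVlt; apply/orP; left; apply/eqP; ring.
- by rewrite gt0_muley ?leey// lte_fin.
Qed.

(** By normality the path almost surely starts at [x], outside [U], so the exit time is 0. *)
Lemma killed_transition_out (U : set M) (t : R) (x : M) (A : set M) : 0 < t -> ~ U x ->
  killed_transition X U t x A = 0%E.
Proof.
move=> t0 Ux; have [B [mB PB hB]] := law_start X (Some x).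
apply/eqP; rewrite eq_le; apply/andP; split; last exact: measure_ge0.
rewrite -PB -(cprob_measurable X x mB); apply: le_cprob => w [_ tU].
apply: hB => /= X0; move: tU; rewrite ltNge => /negP; apply.
apply: (@le_trans _ _ 0%:E); last by rewrite lee_fin ltW.
apply: ereal_inf_lbound; exists 0 => //; split => //.
by rewrite X0 => -[y Uy [yx]]; apply: Ux; rewrite -yx.
Qed.

Lemma truncate_radius (m : R) : (0 < rad)%E -> 0 < m ->
  exists r : R, [/\ 0 < r, (r%:E <= rad)%E, r <= m & r = m \/ rad = r%:E].
Proof.
case: rad => [s|_ m0|//]; last by exists m; split => //; [exact: leey|left].
rewrite lte_fin => s0 m0; have [sm|ms] := leP s m; [exists s|exists m]; split => //.
- by right.
- by rewrite lee_fin ltW.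
- by left.
Qed.

Variable delta : R.
Hypotheses (delta_gt0 : 0 < delta) (delta_le1 : delta <= 1) (rad_gt0 : (0 < rad)%E)
  (diam_le : (delta%:E * diam M <= rad)%E)
  (F_le : forall (s t : R) (x y z w : M),
     time_interval Psi rad s -> time_interval Psi rad t -> s <= t ->
     F s z w / F t x y <=
       cF * (Num.max (Num.max t (Psi (mdist x z))) (Psi (mdist y w)) / s) `^ alphaF).

Let B0 : R := cF * (cPsi * 2 `^ beta2) `^ alphaF.
Let D0 : R := delta `^ (- (beta2 * alphaF)).

Let B0_gt0 : 0 < B0.
Proof. by rewrite mulr_gt0// powR_gt0// mulr_gt0// powR_gt0. Qed.

Let D0_gt0 : 0 < D0. Proof. exact: powR_gt0. Qed.

Let D0_ge1 : 1 <= D0.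
Proof.
rewrite /D0 powRN invf_ge1 ?powR_gt0//.
have ba0 : 0 <= beta2 * alphaF.
  by rewrite mulr_ge0 ?(ltW alphaF_gt0)// (le_trans _ beta12)// (le_trans ler01)// ltW.
have : delta `^ (beta2 * alphaF) <= 1 `^ (beta2 * alphaF).
  by apply: ge0_ler_powR => //; rewrite nnegrE// ltW.
by rewrite powR1.
Qed.

Lemma mdist_le_radius (r : R) (x y : M) : rad = r%:E -> delta * mdist x y <= r.
Proof.
move=> radr; rewrite -lee_fin EFinM -radr; apply: le_trans diam_le.
rewrite lee_pmul2l//; apply: ereal_sup_ubound; by exists (x, y).
Qed.

(** All three terms of the maximum in the hypothesis on [F] are at most
    [m = cPsi * (2 / delta) ^ beta2 * Psi r], as both distances are at most [2 * r / delta]. Raising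
    this to the power [alphaF] is the origin of the factor [delta ^ -(beta2 * alphaF)]. *)
Lemma time_kernel_le (r s t : R) (x y z w : M) : 0 < r -> (r%:E <= rad)%E ->
  0 < s -> s <= t -> t <= Psi r -> delta * mdist x z <= 2 * r -> delta * mdist y w <= 2 * r ->
  F s z w <= B0 * D0 * (Psi r / s) `^ alphaF * F t x y.
Proof.
move=> r0 rR s0 st tr xz yw.
have t0 : 0 < t by exact: lt_le_trans st.
have It : time_interval Psi rad t by exact: time_interval_lt tr.
have Is : time_interval Psi rad s by apply: time_interval_lt (le_trans st tr).
have b20 : 0 <= beta2 by rewrite (le_trans _ beta12)// (le_trans ler01)// ltW.
rewrite -ler_pdivrMr ?F_gt0//; apply: le_trans (F_le x y z w Is It st) _.
have Pr := Psi_gt0 r0.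
pose m := cPsi * (2 / delta) `^ beta2 * Psi r.
have d2 : 1 <= 2 / delta by rewrite ler_pdivlMr// mul1r (le_trans delta_le1)// ler1n.
have Pd v : 0 <= v -> delta * v <= 2 * r -> Psi v <= m.
  move=> v0 vr; apply: (@le_trans _ _ (Psi (2 * r / delta))).
    by apply: (scale_le cPsi_gt0 Psi_homeo Psi_reg) => //; rewrite ler_pdivlMr// mulrC.
  have := @Psi_le_scale _ _ _ _ _ Psi_gt0 Psi_reg r (2 * r / delta) r0.
  have -> : 2 * r / delta / r = 2 / delta by field; rewrite !gt_eqF.
  by apply; rewrite -[leLHS]mul1r mulrAC ler_wpM2r// ltW.
have tm : t <= m.
  apply: (le_trans tr); rewrite -[leLHS]mul1r ler_wpM2r ?(ltW Pr)//.
  rewrite mulr_ege1// ?(cPsi_ge1 Psi_gt0 Psi_reg)//.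
  by have := ler_powR d2 b20; rewrite powRr0.
apply: (@le_trans _ _ (cF * (m / s) `^ alphaF)).
  rewrite ler_wpM2l ?(ltW cF_gt0)// ge0_ler_powR ?nnegrE ?(ltW alphaF_gt0)//.
  - by rewrite divr_ge0 ?(ltW s0)// !le_max (ltW t0).
  - by rewrite divr_ge0 ?(ltW s0)// (le_trans (ltW t0)).
  - by rewrite ler_wpM2r ?invr_ge0 ?(ltW s0)// !ge_max tm !Pd// mdist_ge0.
rewrite le_eqVlt; apply/orP; left; apply/eqP.
have -> : m / s = cPsi * 2 `^ beta2 * delta `^ (- beta2) * (Psi r / s).
  rewrite /m powRM ?invr_ge0 ?(ltW delta_gt0)//.
  by rewrite -powR_inv1 ?(ltW delta_gt0)// -powRrM mulN1r !mulrA.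
rewrite powRM ?mulr_ge0 ?powR_ge0 ?(ltW cPsi_gt0) ?(ltW Pr) ?invr_ge0 ?(ltW s0)//.
rewrite powRM ?mulr_ge0 ?powR_ge0 ?(ltW cPsi_gt0)//.
by rewrite -powRrM mulNr /B0 /D0 !mulrA.
Qed.

(** The bound of [scale_conj_bounded] for [g = gamma]. *)
Let K0 : R := gamma + gamma * (gamma * cPsi) `^ (beta1 - 1)^-1.
(** The terms pay, in order, for the killed part when [t] is small, the killed part at the time
    [Psi rad / 2], and the sum over displacements. *)
Let c' : R := expR K0 + B0 * (2 `^ alphaF + c * C1).

Let Phi := scale_conj Psi.

Let le_Phi (rho rho' t : R) : 0 < t -> rho <= rho' -> Phi rho t <= Phi rho' t.
Proof.
move=> t0 rr; exact: (le_scale_conj2 cPsi_gt0 beta1_gt1 Psi_gt0 Psi_reg t0 (lexx t) rr).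
Qed.

Let c'_gt0 : 0 < c'.
Proof.
by rewrite addr_gt0 ?expR_gt0// mulr_gt0// addr_gt0 ?powR_gt0// mulr_gt0.
Qed.

Let gauss (t : R) (x y : M) : R := expR (- Phi (delta * gamma / 40 * mdist x y) t).

Let dg0 : 0 <= delta * gamma / 40.
Proof. by rewrite divr_ge0// mulr_ge0// ltW. Qed.

Lemma measurable_gauss_section (t : R) (x : M) : 0 < t ->
  measurable_fun setT (fun y : borel M => gauss t x y).
Proof.
move=> t0; apply: (measurableT_comp (@measurable_expR R)).
apply: (measurableT_comp (@oppr_measurable R setT)).
apply: (measurable_scale_conj cPsi_gt0 Psi_homeo Psi_reg beta1_gt1) => //.
  by move=> y _; rewrite mulr_ge0// mdist_ge0.
apply: measurable_funM => //.
apply: (measurableT_comp (measurable_mdist sepM) (g := fun y : borel M => (x : borel M, y))).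
by apply/measurable_fun_pairP; split; [exact: measurable_cst|exact: measurable_id].
Qed.

(* The radius [r = min rad (max (2 * Psi^-1 t) (delta * d(x, y0)))] is large
   enough for [t < Psi r]; if [x] is in the ball of radius [r / 2], then
   [Psi (r / 2) <= t] and the Gaussian factor is bounded below. *)
Lemma transition_le_small (x : M) (t : R) : ~ N x -> 0 < t ->
  (t%:E < scale_ext Psi rad)%E ->
  exists2 e : R, 0 < e & forall (y0 : M) (A : set (borel M)), measurable A ->
    A `<=` ball y0 e ->
    (transition X t x A <= \int[mu]_(y in A) (c' * D0 * F t x y * gauss t x y)%:E)%E.
Proof.
move=> Nx t0 tR.
have [p p0 Pp] := scale_surjective cPsi_gt0 Psi_homeo Psi_reg t0.
(* This radius does not depend on [y0], as the covering argument demands, and is at most the radius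
   [r] chosen below for each [y0]. *)
have [e [e0 eR e2 eor]] := truncate_radius rad_gt0 (mulr_gt0 (ltr0n R 2) p0).
exists (e / 4); first by rewrite divr_gt0.
move=> y0 A mA Ay0.
have m0 : 0 < Num.max (2 * p) (delta * mdist x y0) by rewrite lt_max mulr_gt0.
have [r [r0 rR rm ror]] := truncate_radius rad_gt0 m0.
have er : e <= r.
  case: ror => [->|radr]; first by rewrite le_max e2.
  by move: eR; rewrite radr lee_fin.
have tr : t < Psi r.
  case: ror => [->|radr]; last by move: tR; rewrite radr /= lte_fin.
  rewrite -Pp; apply: (scale_lt cPsi_gt0 Psi_homeo Psi_reg); first exact: ltW.
  by rewrite lt_max ltr_pMl// ltr1n.
have xr : delta * mdist x y0 <= r.
  case: ror => [->|radr]; first by rewrite le_max lexx orbT.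
  exact: mdist_le_radius.
have It : time_interval Psi rad t by split => //; exact: ltW.
have Ar : A `<=` ball y0 (r / 4).
  by apply: (subset_trans Ay0); apply: le_ball; rewrite ler_pM2r.
have A4 y : A y -> mdist x y <= mdist x y0 + r / 4.
  move=> /Ar; rewrite ballEmdist /= => /ltW h.
  by apply: le_trans (metric_triangle x y0 y) _; rewrite lerD2l.
have dr : delta * r <= r by rewrite ler_piMl// ltW.
have mG : measurable_fun setT (F t x : borel M -> R) by exact: measurable_time_section.
have Ft0 y : 0 < F t x y by exact: F_gt0.
have g0 y : 0 <= F t x y * gauss t x y by rewrite mulr_ge0 ?expR_ge0// ltW.
have mg : measurable_fun A (fun y : borel M => (F t x y * gauss t x y)%:E).
  apply/measurable_EFinP; apply: measurable_funTS; apply: measurable_funM => //.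
  exact: measurable_gauss_section.
have mF' : measurable_fun A (fun y : borel M => (F t x y)%:E).
  by apply/measurable_EFinP; exact: measurable_funTS.
pose J := (\int[mu]_(y in A) (F t x y * gauss t x y)%:E)%E.
have intE k : 0 <= k -> (\int[mu]_(y in A) (k * (F t x y * gauss t x y))%:E = k%:E * J)%E.
  move=> k0; under eq_integral do rewrite EFinM.
  by rewrite ge0_integralZl_EFin// => y _; rewrite lee_fin.
have J0 : (0 <= J)%E by apply: integral_ge0 => y _; rewrite lee_fin.
have B1_gt0 : 0 < B0 * D0 by exact: mulr_gt0.
have k0 : 0 <= c * (B0 * D0) * C1 by exact: ltW (mulr_gt0 (mulr_gt0 c_gt0 B1_gt0) C1_gt0).
have hF s z y : 0 < s -> s <= t -> ball y0 (r / 2) z -> A y ->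
    F s z y <= B0 * D0 * (Psi r / s) `^ alphaF * F t x y.
  move=> s0 st; rewrite ballEmdist /= => zr Ay.
  apply: time_kernel_le => //; first exact: ltW.
    have := ler_wpM2l (ltW delta_gt0) (metric_triangle x y0 z).
    have := ler_wpM2l (ltW delta_gt0) (ltW zr); rewrite mulrDr; lra.
  by rewrite mdistxx mulr0 mulr_ge0// ltW.
apply: (le_trans (transition_le_localized r0 rR Nx t0 tr mA Ar B1_gt0
  (fun y => ltW (Ft0 y)) mG hF)).
set phi := scale_conj Psi (gamma / 16 * r) t.
have second : ((c * (B0 * D0) * C1 * expR (- (phi / 2)))%:E *
    \int[mu]_(y in A) (F t x y)%:E <= (c * (B0 * D0) * C1)%:E * J)%E.
  rewrite -intE// -ge0_integralZl_EFin//; last 2 first.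
  - by move=> y _; rewrite lee_fin ltW.
  - by rewrite mulr_ge0 ?expR_ge0.
  apply: ge0_le_integral => //.
  - by move=> y _; rewrite -EFinM lee_fin mulr_ge0 ?(ltW (Ft0 _))// mulr_ge0 ?expR_ge0.
  - exact: measurable_funeM.
  - by under eq_fun do rewrite EFinM; exact: measurable_funeM.
  - move=> y Ay; rewrite -EFinM lee_fin.
    rewrite [leLHS](_ : _ = c * (B0 * D0) * C1 * (F t x y * expR (- (phi / 2)))); last by ring.
    rewrite ler_wpM2l// ler_wpM2l ?(ltW (Ft0 _))//.
    rewrite ler_expR lerN2 ler_pdivlMr// mulrC.
    (* Origin of the 40: on [A], [delta * d(x, y) <= r + r / 4], so [gamma / 40] times it is at most
       [gamma / 32 * r]. The step from 32 to 16 compensates the halved exponent, by superlinearity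
       of [Phi]. *)
    apply: (@le_trans _ _ (2 * Phi (gamma / 32 * r) t)).
      rewrite ler_wpM2l//; apply: le_Phi => //.
      have -> : delta * gamma / 40 * mdist x y = gamma / 40 * (delta * mdist x y) by ring.
      have -> : gamma / 32 * r = gamma / 40 * (r + r / 4) by field.
      rewrite ler_wpM2l ?divr_ge0 ?(ltW gamma_gt0)//.
      by have := ler_wpM2l (ltW delta_gt0) (A4 y Ay); rewrite mulrDr; lra.
    have := @scale_conj_mull _ _ _ _ cPsi_gt0 beta1_gt1 _ Psi_gt0 Psi_reg 2 (gamma / 32 * r) t.
    rewrite (_ : 2 * (gamma / 32 * r) = gamma / 16 * r); last by field.
    by apply => //; rewrite ler1n.
have first : (killed_transition X (ball y0 (r / 2)) t x A <= (expR K0)%:E * J)%E.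
  have [Ux|Ux] := pselect (ball y0 (r / 2) x); last first.
    by rewrite killed_transition_out// mule_ge0// lee_fin expR_ge0.
  apply: (le_trans (killed_le r0 rR t0 tr Ux Nx mA _)).
    by apply: (subset_trans Ar); apply: le_ball; lra.
  have xy0 : mdist x y0 < r / 2 by move: Ux; rewrite ballEmdist /= metric_sym.
  (* With [x] in the ball of radius [r / 2], [delta * d(x, y0) < r], so the maximum that bounds [r]
     must be [2 * p]. *)
  have rp : r <= 2 * p.
    have h : delta * mdist x y0 <= mdist x y0 by rewrite ler_piMl// mdist_ge0.
    by move: rm; rewrite le_max => /orP[//|]; lra.
  rewrite -intE ?expR_ge0//; apply: ge0_le_integral => //.
  - by move=> y _; rewrite lee_fin ltW.
  - by under eq_fun do rewrite EFinM; exact: measurable_funeM.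
  - move=> y Ay; rewrite lee_fin mulrCA -[leLHS]mulr1 ler_wpM2l ?(ltW (Ft0 _))//.
    rewrite -expRD -[leLHS]expR0 ler_expR subr_ge0.
    have r2 : 0 < r / 2 by rewrite divr_gt0.
    have Pr2 : Psi (r / 2) <= t.
      by rewrite -Pp; apply: (scale_le cPsi_gt0 Psi_homeo Psi_reg); lra.
    apply: (le_trans _ (scale_conj_bounded cPsi_gt0 beta1_gt1 Psi_gt0 Psi_reg gamma_gt0 r2 Pr2)).
    apply: le_Phi => //.
    have -> : delta * gamma / 40 * mdist x y = gamma * (delta * mdist x y / 40) by ring.
    rewrite ler_wpM2l ?(ltW gamma_gt0)//.
    have := ler_wpM2l (ltW delta_gt0) (A4 y Ay); rewrite mulrDr; lra.
apply: (le_trans (leeD first second)).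
rewrite -ge0_muleDl ?lee_fin ?expR_ge0//.
under eq_integral do rewrite -mulrA.
rewrite intE; last by rewrite mulr_ge0// ltW.
rewrite lee_wpmul2r// -EFinD lee_fin /c' mulrDl.
have h1 : expR K0 <= expR K0 * D0 by rewrite ler_peMr// expR_ge0.
have h2 : 0 <= B0 * 2 `^ alphaF * D0 by rewrite !mulr_ge0 ?powR_ge0// ltW.
have -> : B0 * (2 `^ alphaF + c * C1) * D0 = B0 * 2 `^ alphaF * D0 + c * (B0 * D0) * C1.
  by ring.
lra.
Qed.

(* At the time [Psi r / 2] all values of [F] are comparable, as
   [delta * diam M <= r]; Chapman-Kolmogorov propagates the bound to [t]. *)
Lemma transition_le_large (r t : R) (x : M) (A : set (borel M)) :
  rad = r%:E -> Psi r <= t -> ~ N x -> measurable A ->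
  (transition X t x A <=
   \int[mu]_(y in A) (c' * D0 * inf [set F (Psi r) z.1 z.2 | z in [set: M * M]])%:E)%E.
Proof.
move=> radr rt Nx mA; set I0 := inf _.
have r0 : 0 < r by move: rad_gt0; rewrite radr lte_fin.
have rR : (r%:E <= rad)%E by rewrite radr.
have Pr := Psi_gt0 r0.
have IPr : time_interval Psi rad (Psi r) by exact: time_interval_lt (lexx _).
have hinf : has_inf [set F (Psi r) z.1 z.2 | z in [set: M * M]].
  split; first by exists (F (Psi r) point point), (point, point).
  by exists 0 => _ [z _ <-]; rewrite ltW// F_gt0.
have I00 : 0 <= I0.
  by apply: lb_le_inf hinf.1 _ => _ [z _ <-]; rewrite ltW// F_gt0.
have B1_gt0 : 0 < B0 * D0 by exact: mulr_gt0.
have diamr (u v : M) : delta * mdist u v <= 2 * r.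
  by apply: (le_trans (mdist_le_radius u v radr)); rewrite ler_peMl ?(ltW r0)// ler1n.
(* The comparison holds against every pair of points at time [Psi r], hence against the infimum. *)
have FI s z y : 0 < s -> s <= Psi r -> F s z y <= B0 * D0 * (Psi r / s) `^ alphaF * I0.
  move=> s0 sr; have q0 : 0 < B0 * D0 * (Psi r / s) `^ alphaF.
    by rewrite mulr_gt0// powR_gt0// divr_gt0.
  rewrite mulrC -ler_pdivrMr//; apply: lb_le_inf hinf.1 _ => _ [[z' y'] _ <-] /=.
  by rewrite ler_pdivrMr// mulrC; exact: time_kernel_le.
(* Strictly below [Psi r], as the bound on the killed transition function requires; the ratio
   [Psi r / t0 = 2] produces the factor [2 ^ alphaF]. *)
pose t0 := Psi r / 2.
have t00 : 0 < t0 by rewrite divr_gt0.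
have t0r : t0 < Psi r by rewrite ltr_pdivrMr// ltr_pMr// ltr1n.
have cI (B : set (borel M)) k : measurable B -> 0 <= k ->
    (\int[mu]_(y in B) (k * I0)%:E = k%:E * \int[mu]_(y in B) I0%:E)%E.
  by move=> mB k0; under eq_integral do rewrite EFinM; rewrite ge0_integralZl_EFin.
have half (z : M) (B : set (borel M)) : ~ N z -> measurable B ->
    (transition X t0 z B <= \int[mu]_(y in B) (c' * D0 * I0)%:E)%E.
  move=> Nz mB.
  pose k := transition_fkernel X (measurable_cst t0) (@measurable_id _ (borel M) setT).
  have kE (C : set (borel M)) : transition X t0 z C = k z C.
    by rewrite /k /= /transition_kernel /= ger0_norm// ltW.
  rewrite kE; have r4 : 0 < r / 4 by rewrite divr_gt0.
  apply: (le_integral_local sepM r4) => //.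
    by move=> y; rewrite lee_fin !mulr_ge0// ltW.
  move=> y0 C mC Cy; rewrite -kE.
  have hF s z' y : 0 < s -> s <= t0 -> ball y0 (r / 2) z' -> C y ->
      F s z' y <= B0 * D0 * (Psi r / s) `^ alphaF * (cst I0 : M -> R) y.
    by move=> s0 st _ _; apply: FI => //; exact: le_trans st (ltW t0r).
  apply: (le_trans (@transition_le_localized z y0 r t0 (B0 * D0) (cst I0) C
    r0 rR Nz t00 t0r mC Cy B1_gt0 (fun=> I00) _ hF)) => //.
  set J := (\int[mu]_(y in C) (cst I0 y)%:E)%E.
  have J0 : (0 <= J)%E by apply: integral_ge0 => y _; rewrite lee_fin.
  rewrite cI//; last by rewrite mulr_ge0// ltW.
  rewrite -/J; set k2 := c * (B0 * D0) * C1 * _.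
  have k20 : 0 <= k2.
    by rewrite mulr_ge0 ?expR_ge0// (ltW (mulr_gt0 (mulr_gt0 c_gt0 B1_gt0) C1_gt0)).
  have k10 : 0 <= B0 * D0 * 2 `^ alphaF by rewrite mulr_ge0 ?powR_ge0// ltW.
  have first : (killed_transition X (ball y0 (r / 2)) t0 z C <=
      (B0 * D0 * 2 `^ alphaF)%:E * J)%E.
    have [Uz|Uz] := pselect (ball y0 (r / 2) z); last first.
      by rewrite killed_transition_out// mule_ge0// lee_fin.
    have It0 : time_interval Psi rad t0 by apply: time_interval_lt (ltW t0r).
    apply: (le_trans (killed_le r0 rR t00 t0r Uz Nz mC _)).
      by apply: (subset_trans Cy); apply: le_ball; lra.
    rewrite /J /= -cI//; apply: ge0_le_integral => //.
    - by move=> y _; rewrite lee_fin ltW// F_gt0.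
    - by apply/measurable_EFinP; apply: measurable_funTS; exact: measurable_time_section.
    - move=> y _; rewrite lee_fin; have := FI t0 z y t00 (ltW t0r).
      by rewrite (_ : Psi r / t0 = 2)// /t0; field; rewrite gt_eqF.
  apply: (le_trans (leeD first (lexx _))).
  rewrite -ge0_muleDl ?lee_fin// lee_wpmul2r// -EFinD lee_fin.
  have phi0 : 0 <= scale_conj Psi (gamma / 16 * r) t0.
    apply: le_trans (Phi_lower r0 t00 (ltW t0r)).
    by rewrite mulr_ge0 ?powR_ge0// ltW.
  have k2le : k2 <= c * (B0 * D0) * C1.
    rewrite /k2 ler_piMr ?(ltW (mulr_gt0 (mulr_gt0 c_gt0 B1_gt0) C1_gt0))//.
    by rewrite -[leRHS]expR0 ler_expR oppr_le0 divr_ge0.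
  have e0 : 0 <= expR K0 * D0 by rewrite mulr_ge0 ?expR_ge0// ltW.
  rewrite /c' mulrDl.
  have -> : B0 * (2 `^ alphaF + c * C1) * D0 = B0 * D0 * 2 `^ alphaF + c * (B0 * D0) * C1.
    by ring.
  lra.
have tt0 : 0 <= t - t0 by rewrite subr_ge0 (le_trans (ltW t0r)).
pose k := transition_fkernel X (measurable_cst (t - t0)) (@measurable_id _ (borel M) setT).
have kE (C : set (borel M)) : k x C = transition X (t - t0) x C.
  by rewrite /k /= /transition_kernel /= ger0_norm.
have := @chapman_kolmogorov _ _ _ _ X _ (borel M) (cst (t - t0)) id (measurable_cst (t - t0))
  (@measurable_id _ (borel M) setT) x t0 A tt0 (ltW t00) mA.
rewrite /= subrK => ->; set J := (\int[mu]_(y in A) _)%E.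
have J0 : (0 <= J)%E by apply: integral_ge0 => y _; rewrite lee_fin !mulr_ge0// ltW.
apply: (@le_trans _ _ (\int[k x]_z J)%E).
  apply: ae_ge0_le_integral => //.
  - by apply: measurable_transition => //; exact: ltW.
  - exists N; split => //.
      by rewrite kE; apply: transition_exceptional mN pathN _ _ tt0 Nx.
    move=> z /= hz; apply: contrapT => Nz; apply: hz => _; exact: half.
rewrite integral_cst// -[leRHS]mule1 lee_wpmul2l// kE.
apply: probability_le1; apply: path_measurable; first by rewrite lee_fin.
exact: measurable_in_cpt measurableT.
Qed.

Let bound (t : R) (x y : M) : R :=
  if (t%:E < scale_ext Psi rad)%E then c' * D0 * F t x y * gauss t x y
  else c' * D0 * inf [set F (fine (scale_ext Psi rad)) z.1 z.2 | z in [set: M * M]].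

Let Dom : set (R * borel M * borel M) := ([set t : R | 0 < t] `*` ~` N) `*` setT.

Let c'D0 : 0 <= c' * D0. Proof. by rewrite mulr_ge0// ltW. Qed.

Lemma radius_finite (t : R) : ~~ (t%:E < scale_ext Psi rad)%E ->
  exists2 r, rad = r%:E & Psi r <= t.
Proof.
case: rad rad_gt0 => [r _|_|//] /=; first by rewrite lte_fin -leNgt => h; exists r.
by rewrite ltry.
Qed.

Lemma bound_ge0 (t : R) (x y : M) : 0 < t -> 0 <= bound t x y.
Proof.
move=> t0; rewrite /bound; case: ifPn => [tR|/radius_finite[r radr rt]].
  by rewrite mulr_ge0 ?expR_ge0// mulr_ge0// ltW// F_gt0//; split => //; exact: ltW.
rewrite mulr_ge0//; apply: lb_le_inf.
  by exists (F (fine (scale_ext Psi rad)) point point), (point, point).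
move=> _ [z _ <-]; rewrite ltW// F_gt0// radr /=; split; last by rewrite /= lexx.
by apply: Psi_gt0; move: rad_gt0; rewrite radr lte_fin.
Qed.

Lemma measurable_bound : measurable_fun Dom
  (fun z : R * borel M * borel M => bound z.1.1 z.1.2 z.2).
Proof.
pose S : set R := [set t | 0 < t /\ (t%:E < scale_ext Psi rad)%E].
pose L : set R := [set t | 0 < t /\ ~~ (t%:E < scale_ext Psi rad)%E].
have mlt : measurable [set t : R | (t%:E < scale_ext Psi rad)%E].
  by rewrite -[X in measurable X]setTI; apply: emeasurable_fun_lt.
have m0 : measurable [set t : R | 0 < t].
  rewrite (_ : [set t : R | 0 < t] = `]0, +oo[%classic) ?measurable_itv//.
  by apply/seteqP; split=> t /=; rewrite in_itv /= andbT.
have mS : measurable S by exact: measurableI.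
have mL : measurable L.
  rewrite (_ : L = [set t | 0 < t] `\` [set t : R | (t%:E < scale_ext Psi rad)%E]).
    exact: measurableD.
  by apply/seteqP; split=> t /= [? /negP].
have mD (I : set R) : measurable I ->
    measurable ((I `*` ~` N) `*` setT : set (R * borel M * borel M)).
  by move=> mI; apply: measurableX => //; apply: measurableX => //; exact: measurableC.
have -> : Dom = ((S `*` ~` N) `*` setT) `|` ((L `*` ~` N) `*` setT).
  apply/seteqP; split=> [[[t x] y] [[/= t0 Nx] _]|[[t x] y] [] [[/= [t0 _] Nx] _]//].
  by case/boolP : (t%:E < scale_ext Psi rad)%E => h; [left|right].
apply/measurable_funU; [exact: mD|exact: mD|split].
- apply: (@eq_measurable_fun _ _ _ _ _ (fun z : R * borel M * borel M =>
    c' * D0 * F z.1.1 z.1.2 z.2 * gauss z.1.1 z.1.2 z.2)).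
    by move=> z /[!inE] -[[[/= _ h] _] _]; rewrite /bound h.
  apply: measurable_funM.
    apply: measurable_funM => //; apply: measurable_funS mF.
      by apply: measurableX => //; apply: measurableX => //; exact: measurable_time_interval.
    by move=> z [[[/= t0 h] _] _]; split => //; split => //; split => //; exact: ltW.
  apply: (measurableT_comp (@measurable_expR R)).
  apply: (measurableT_comp (@oppr_measurable R setT)).
  apply: (measurable_scale_conj cPsi_gt0 Psi_homeo Psi_reg beta1_gt1).
  + exact: mD.
  + by move=> z _; rewrite mulr_ge0// mdist_ge0.
  + by move=> z [[[]]].
  + apply: measurable_funM => //.
    apply: measurable_funTS.
    apply: (measurableT_comp (measurable_mdist sepM)
      (g := fun z : R * borel M * borel M => (z.1.2, z.2))).
    apply/measurable_fun_pairP; split; last exact: measurable_snd.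
    exact: (measurableT_comp measurable_snd measurable_fst).
  + apply: measurable_funTS.
    exact: (measurableT_comp measurable_fst measurable_fst).
- apply: (@eq_measurable_fun _ _ _ _ _ (cst (c' * D0 *
    inf [set F (fine (scale_ext Psi rad)) z.1 z.2 | z in [set: M * M]]))).
    by move=> z /[!inE] -[[[/= _ h] _] _]; rewrite /bound (negbTE h).
  exact: measurable_cst.
Qed.

Lemma measurable_bound_section (t : R) (x : M) : 0 < t -> ~ N x ->
  measurable_fun setT (fun y : borel M => bound t x y).
Proof.
move=> t0 Nx; apply: (measurable_comp (F := Dom)
  (f := fun z : R * borel M * borel M => bound z.1.1 z.1.2 z.2)
  (g := fun y : borel M => (t, x : borel M, y))).
- apply: measurableX => //; apply: measurableX; last exact: measurableC.
  rewrite (_ : [set t : R | 0 < t] = `]0, +oo[%classic) ?measurable_itv//.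
  by apply/seteqP; split=> s /=; rewrite in_itv /= andbT.
- by move=> _ [y _ <-].
- exact: measurable_bound.
- by apply/measurable_fun_pairP; split; [exact: measurable_cst|exact: measurable_id].
Qed.

Lemma transition_le_bound (t : R) (x : M) (A : set (borel M)) :
  0 < t -> ~ N x -> measurable A ->
  (transition X t x A <= \int[mu]_(y in A) (bound t x y)%:E)%E.
Proof.
move=> t0 Nx mA.
have [tR|tR] := boolP (t%:E < scale_ext Psi rad)%E; last first.
  have [r radr rt] := radius_finite tR.
  have -> : bound t x = fun=> c' * D0 * inf [set F (Psi r) z.1 z.2 | z in [set: M * M]].
    by apply/funext => y; rewrite /bound (negbTE tR) radr.
  exact: transition_le_large.
pose k := transition_fkernel X (measurable_cst t) (@measurable_id _ (borel M) setT).
have kE (C : set (borel M)) : transition X t x C = k x C.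
  by rewrite /k /= /transition_kernel /= ger0_norm// ltW.
have [e e0 he] := transition_le_small Nx t0 tR.
rewrite kE; apply: (le_integral_local sepM e0) => //.
- by move=> y; rewrite lee_fin bound_ge0.
- by apply/measurable_EFinP; exact: measurable_bound_section.
- move=> y0 C mC Cy; rewrite -kE; apply: le_trans (he _ _ mC Cy) _.
  by rewrite /bound tR.
Qed.

(** Since [bound] is finite, [transition_le_bound] makes the transition function vanish on [mu]-null
    sets, which yields a density [q]; the same inequality lets [dominated_density] replace [q] by
    its minimum with [bound]. *)
Lemma bounded_transition_density : exists p : R -> M -> M -> R,
  [/\ (forall (t : R) (x y : M), 0 < t -> ~ N x -> 0 <= p t x y),
    measurable_fun Dom (fun z : R * borel M * borel M => p z.1.1 z.1.2 z.2) &
    forall (t : R) (x : M), 0 < t -> ~ N x ->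
      (forall A : set (borel M), measurable A ->
         transition X t x A = \int[mu]_(y in A) (p t x y)%:E)%E /\
      (forall y : M, p t x y <= bound t x y)].
Proof.
have [|q [q0 mq hq]] := @transition_density _ _ _ _ X N mu mN pathN.
  move=> t x A t0 Nx mA muA; apply/eqP; rewrite eq_le measure_ge0 andbT.
  rewrite (le_trans (transition_le_bound t0 Nx mA))//.
  rewrite null_set_integral//.
  by apply/measurable_EFinP; apply: measurable_funTS; exact: measurable_bound_section.
pose pe t x y : \bar R := mine (q (t, x, y)) (bound t x y)%:E.
have pe0 t x y : 0 < t -> (0 <= pe t x y)%E.
  by move=> t0; rewrite le_min q0 lee_fin bound_ge0.
have peb t x y : (pe t x y <= (bound t x y)%:E)%E by rewrite ge_min lexx orbT.
have pefin t x y : 0 < t -> pe t x y \is a fin_num.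
  move=> t0; rewrite ge0_fin_numE ?pe0//.
  exact: le_lt_trans (peb t x y) (ltry _).
exists (fun t x y => fine (pe t x y)); split.
- by move=> t x y t0 _; apply: fine_ge0; exact: pe0.
- apply: measurableT_comp => //.
  apply: measurable_mine; last by apply/measurable_EFinP; exact: measurable_bound.
  by apply: measurable_funTS; move: mq; congr measurable_fun; apply/funext => -[[]].
- move=> t x t0 Nx; split; last first.
    by move=> y; rewrite -lee_fin fineK ?pefin.
  move=> A mA; rewrite hq//.
  under [RHS]eq_integral do rewrite fineK ?pefin//.
  apply: (@dominated_density _ _ _ mu (fun y => q (t, x, y)) (bound t x)) => //.
  + apply: (measurableT_comp mq (g := fun y : borel M => (t, x : borel M, y))).
    by apply/measurable_fun_pairP; split; [exact: measurable_cst|exact: measurable_id].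
  + by move=> y; exact: bound_ge0.
  + exact: measurable_bound_section.
  + rewrite -hq//; apply: (@le_lt_trans _ _ 1%E); last by rewrite ltry.
    apply: probability_le1; apply: path_measurable; first by rewrite lee_fin ltW.
    exact: measurable_in_cpt measurableT.
  + by move=> B mB; rewrite -hq//; exact: transition_le_bound.
Qed.

End density_bounds.

Theorem theorem6p4 (R : realType) (cPsi beta1 beta2 cF alphaF c gamma : R) :
  0 < cPsi -> 1 < beta1 -> beta1 <= beta2 ->
  0 < cF -> 0 < alphaF -> 0 < c -> 0 < gamma ->
  exists2 c' : R, 0 < c' &
  forall (M : pmetricType R) (mu : {sigma_finite_measure set (borel M) -> \bar R})
    (d : measure_display) (Omega : measurableType d) (X : hunt_process M Omega)
    (N : set (borel M)) (Psi : R -> R) (delta : R) (rad : \bar R)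
    (F : R -> M -> M -> R),
  locally_compact [set: M] -> separable M ->
  measurable N ->
  (forall x : M, ~ N x ->
     {ae start_law X (Some x), forall w, forall t : R, 0 <= t ->
        ~ in_cpt N (sample_path X t%:E w)} /\
     {ae start_law X (Some x), forall w,
        {within [set t : R | 0 <= t /\ (t%:E < lifetime (sample_path X) w)%E],
           continuous (fun t : R => sample_path X t%:E w)}}) ->
  homeomorphism_on [set r : R | 0 <= r] [set r : R | 0 <= r] Psi ->
  scale_regular cPsi beta1 beta2 Psi ->
  0 < delta -> delta <= 1 ->
  (0 < rad)%E -> (delta%:E * diam M <= rad)%E ->
  (forall (t : R) (x y : M), time_interval Psi rad t -> 0 < F t x y) ->
  measurable_fun
    ((time_interval Psi rad `*` setT) `*` setT : set (R * borel M * borel M))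
    (fun z : R * borel M * borel M => F z.1.1 z.1.2 z.2) ->
  (forall (s t : R) (x y z w : M),
     time_interval Psi rad s -> time_interval Psi rad t -> s <= t ->
     F s z w / F t x y <=
       cF * (Num.max (Num.max t (Psi (mdist x z))) (Psi (mdist y w)) / s)
              `^ alphaF) ->
  (forall (y0 : M) (rad' : R), 0 < rad' -> (rad'%:E <= rad)%E ->
     let U := ball y0 (rad' / 2) in
     (forall (t : R) (x : M) (A : set (borel M)),
        0 < t -> t < Psi rad' -> U x -> ~ N x ->
        measurable A -> A `<=` U ->
        (killed_transition X U t x A <= \int[mu]_(y in A) (F t x y)%:E)%E) /\
     (forall (x : M) (r t : R),
        U x -> ~ N x -> 0 < r -> r < rad' -> ball x r `<=` U -> 0 < t ->
        (cprob X x [set w | (exit_time X (ball x r) w <= t%:E)%E]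
           <= (c * expR (- scale_conj Psi (gamma * r) t))%:E)%E)) ->
  exists p : R -> M -> M -> R,
    [/\ (forall (t : R) (x y : M), 0 < t -> ~ N x -> 0 <= p t x y),
        measurable_fun
          (([set t : R | 0 < t] `*` ~` N) `*` setT : set (R * borel M * borel M))
          (fun z : R * borel M * borel M => p z.1.1 z.1.2 z.2) &
        forall (t : R) (x : M), 0 < t -> ~ N x ->
          (forall A : set (borel M), measurable A ->
             transition X t x A = \int[mu]_(y in A) (p t x y)%:E)%E /\
          (forall y : M,
             p t x y <=
               if (t%:E < scale_ext Psi rad)%E then
                 c' * delta `^ (- (beta2 * alphaF)) * F t x y *
                   expR (- scale_conj Psi (delta * gamma / 40 * mdist x y) t)
               else
                 c' * delta `^ (- (beta2 * alphaF)) *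
                   inf [set F (fine (scale_ext Psi rad)) z.1 z.2
                       | z in [set: M * M]])].
Proof.
move=> cPsi0 beta11 beta12 cF0 alphaF0 c0 gamma0.
(* The balls to be left have radius [r / 16] at the first step, so [kappa] is taken for
   [gamma / 16]. *)
have gamma160 : 0 < gamma / 16 by rewrite divr_gt0.
have [kappa kappa0 lower] := scale_conj_lower cPsi0 beta11 beta12 gamma160.
have [C C0 absorb] := scale_absorb cPsi0 beta11 beta12 alphaF0 kappa0.
exists (expR (gamma + gamma * (gamma * cPsi) `^ (beta1 - 1)^-1) +
  cF * (cPsi * 2 `^ beta2) `^ alphaF * (2 `^ alphaF + c * C)).
  rewrite addr_gt0 ?expR_gt0// mulr_gt0//.
    by rewrite mulr_gt0// powR_gt0// mulr_gt0// powR_gt0.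
  by rewrite addr_gt0 ?powR_gt0// mulr_gt0.
move=> M mu d Omega X N Psi delta rad F _ sepM mN hX homeo reg delta0 delta1 rad0 diamr
  F0 mF FF hyp.
have pathN x (Nx : ~ N x) := (hX x Nx).1.
have pathC x (Nx : ~ N x) := (hX x Nx).2.
have killed_le (y0 : M) (r t : R) (x : M) (A : set (borel M)) :
     0 < r -> (r%:E <= rad)%E -> 0 < t -> t < Psi r -> ball y0 (r / 2) x -> ~ N x ->
     measurable A -> A `<=` ball y0 (r / 2) ->
     (killed_transition X (ball y0 (r / 2)) t x A <= \int[mu]_(y in A) (F t x y)%:E)%E.
  by move=> r0 rR t0 tr Ux Nx mA AU; exact: (hyp y0 r r0 rR).1.
have exit_le (x : M) (r r' t : R) : ~ N x -> 0 < r' -> (r'%:E <= rad)%E ->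
     0 < r -> r < r' / 2 -> 0 < t ->
     (cprob X x [set w | (exit_time X (ball x r) w <= t%:E)%E]
        <= (c * expR (- scale_conj Psi (gamma * r) t))%:E)%E.
  (* The exit hypothesis is applied with [U] centred at the starting point [x] itself, so that
     [r < r' / 2] places the ball inside [U]. *)
  move=> Nx r'0 r'R r0 rr' t0; apply: (hyp x r' r'0 r'R).2 => //.
  - by apply: ballxx; rewrite divr_gt0.
  - by apply: (lt_le_trans rr'); lra.
  - by apply: le_ball; exact: ltW.
have Psi0 := scale_gt0 cPsi0 homeo reg.
exact: (bounded_transition_density cPsi0 beta11 beta12 cF0 alphaF0 c0 gamma0 kappa0 C0
  sepM mN pathN pathC homeo reg F0 mF killed_le exit_le (lower Psi Psi0 reg) absorb
  delta0 delta1 rad0 diamr FF).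
Qed.
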